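(* Let $\mathbb{G}$ be a compact group and $H$ a Hilbert space. A continuous action of $\mathbb{G}$ on the $C^*$-algebra $\mathcal{L}(H)$ is automatically uniformly continuous, and hence has finite spectrum.
   Context: $\mathcal{L}(H)$ is the $C^*$-algebra of bounded operators on $H$. A continuous action of $\mathbb{G}$ on a $C^*$-algebra $A$ is an action by $*$-automorphisms such that $g\mapsto ga$ is norm-continuous for every $a\in A$. Regard it as a map $A\to\mathcal{C}(\mathbb{G},A)\cong\mathcal{C}(\mathbb{G})\otimes_\varepsilon A$, $a\mapsto(g\mapsto ga)$, where $\otimes_\varepsilon$ is the injective Banach-space tensor product. A subset of $F\otimes_\varepsilon E$ is left-$w^*$-equicontinuous if, via the isometric embedding $F\otimes_\varepsilon E\le\mathcal{L}(F^*,E)$, it is equicontinuous as a set of maps from $F^*$ with the weak$^*$ topology to $E$ with the norm topology. The action is uniformly continuous if this map sends bounded subsets of $A$ to left-$w^*$-equicontinuous subsets of $\mathcal{C}(\mathbb{G})\otimes_\varepsilon A$. It has finite spectrum if only finitely many classes $\alpha$ of irreducible $\mathbb{G}$-representations have non-zero isotypic component $A^\alpha$ (the span of the subrepresentations of $A$ of class $\alpha$). *)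

(* Defs.v *)
From HB Require Import structures.
From mathcomp Require Import all_boot all_order all_algebra.
From mathcomp Require Import sesquilinear.
From mathcomp Require Import all_classical all_reals all_analysis.
From mathcomp Require Import complex ring lra.

Set Implicit Arguments.
Unset Strict Implicit.
Unset Printing Implicit Defensive.

Import Order.TTheory GRing.Theory Num.Theory.
Import numFieldNormedType.Exports.
Local Open Scope classical_set_scope.
Local Open Scope ring_scope.

Local Notation rc := (real_complex _).

Section real_norm.
Variables (R : realType) (E : normedModType R[i]).

(* `|x| lives in R[i], whereas suprema exist in R *)
Definition rnorm (x : E) : R := complex.Re `|x|.

Lemma rnormE x : rc (rnorm x) = `|x|.
Proof. by rewrite /rnorm RRe_real// ger0_real. Qed.

Lemma rnorm_le (x : E) (r : R) : (rnorm x <= r) = (`|x| <= rc r).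
Proof. by rewrite -lecR rnormE. Qed.

Lemma rnorm_ge0 x : 0 <= rnorm x.
Proof. by rewrite -lecR rnormE; exact: normr_ge0. Qed.

Lemma rnorm_continuous : continuous rnorm.
Proof.
move=> x; apply/cvgrPdist_lt => e e0.
have e0' : 0 < rc e by rewrite -[0]/(rc 0) ltcR.
near=> y; rewrite -ltcR; have : `|x - y| < rc e.
  by near: y; exact: cvgr_dist_lt.
apply: le_lt_trans; rewrite -rnormE lecR ler_norml lerNl opprB !lerBlDr.
rewrite -!lecR !(rmorphD (real_complex R))/= !rnormE.
by apply/andP; split; [have := ler_normD (y - x) x|have := ler_normD (x - y) y];
  rewrite subrK // distrC.
Unshelve. all: by end_near. Qed.

End real_norm.

Section bounded_operators.
Variables (R : realType) (E F : normedModType R[i]).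

Definition bop_pred : {pred E -> F} :=
  [pred T : E -> F | `[< linear T /\ continuous T >]].

Record bop := Bop { bop_fun :> E -> F ; _ : bop_fun \in bop_pred }.

HB.instance Definition _ := [isSub for bop_fun].
HB.instance Definition _ := [Choice of bop by <:].

Lemma bopP (T : bop) : linear T /\ continuous T.
Proof. by case: T => T /= /asboolP. Qed.

HB.instance Definition _ (T : bop) :=
  GRing.isLinear.Build R[i] E F _ T (bopP T).1.

Lemma bop_eqP (S T : bop) : S =1 T -> S = T.
Proof. by move=> ST; apply: val_inj; apply/funext. Qed.

Lemma bop_submod_closed : submod_closed bop_pred.
Proof.
split; first by apply/asboolP; split=> [a x y|]; [rewrite scaler0 addr0|exact: cst_continuous].
move=> a f g /asboolP[lf cf] /asboolP[lg cg]; apply/asboolP; split.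
  move=> b x y /=; rewrite !fctE lf lg !scalerDr !scalerA (mulrC a b) -!addrA.
  by congr (_ + _); rewrite addrCA.
by move=> x; apply: cvgD; [apply: cvgZr; exact: cf|exact: cg].
Qed.

HB.instance Definition _ := GRing.isSubmodClosed.Build _ _ bop_pred
  bop_submod_closed.
HB.instance Definition _ := [SubChoice_isSubLmodule of bop by <:].

Lemma bop_bounded (T : bop) :
  exists2 M : R, 0 <= M & forall x, `|T x| <= rc M * `|x|.
Proof.
have /linear_boundedP/pinfty_ex_gt0[r r0 rP] : bounded_near T (nbhs (0 : E)).
  exact/linear_bounded_continuous/(bopP T).2.
have /complex_realP[M rM] : r \is Num.real by rewrite ger0_real// ltW.
by rewrite rM in r0 rP; exists M => //; rewrite -lecR ltW.
Qed.

Definition opnorm (T : bop) : R :=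
  sup [set rnorm (T x) | x in [set x : E | `|x| <= 1]].

Lemma opnorm_has_sup (T : bop) :
  has_sup [set rnorm (T x) | x in [set x : E | `|x| <= 1]].
Proof.
split; first by exists (rnorm (T 0)), 0 => //=; rewrite normr0.
have [M M0 TM] := bop_bounded T; exists M => _ [x /= x1 <-].
rewrite rnorm_le (le_trans (TM x))//.
by rewrite -[leRHS]mulr1 ler_wpM2l// lecR.
Qed.

Lemma opnorm_ge0 (T : bop) : 0 <= opnorm T.
Proof.
apply: le_trans (rnorm_ge0 (T 0)) _; apply: ub_le_sup.
  exact: (opnorm_has_sup T).2.
by exists 0 => //=; rewrite normr0.
Qed.

Lemma le_opnorm (T : bop) x : `|T x| <= rc (opnorm T) * `|x|.
Proof.
have [->|x0] := eqVneq x 0; first by rewrite linear0 !normr0 mulr0.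
rewrite -ler_pdivrMr ?normr_gt0//.
rewrite -[X in X <= _](_ : `|T (`|x|^-1 *: x)| = _).
  rewrite -rnorm_le; apply: ub_le_sup; first exact: (opnorm_has_sup T).2.
  by exists (`|x|^-1 *: x) => //=; rewrite normrZ normfV normr_id mulVf ?normr_eq0.
by rewrite linearZ normrZ normfV normr_id mulrC.
Qed.

Lemma opnorm_le (T : bop) (M : R) :
  0 <= M -> (forall x, `|T x| <= rc M * `|x|) -> opnorm T <= M.
Proof.
move=> M0 TM; apply: ge_sup; first exact: (opnorm_has_sup T).1.
move=> _ [x /= x1 <-]; rewrite rnorm_le (le_trans (TM x))//.
by rewrite -[leRHS]mulr1 ler_wpM2l// lecR.
Qed.

Let norm (T : bop) : R[i] := rc (opnorm T).

Let ler_normD S T : norm (S + T) <= norm S + norm T.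
Proof.
rewrite /norm -rmorphD lecR; apply: opnorm_le.
  by rewrite addr_ge0 ?opnorm_ge0.
move=> x; rewrite rmorphD mulrDl.
by rewrite (le_trans (ler_normD _ _))// lerD ?le_opnorm.
Qed.

Let normZ_le (l : R[i]) T : norm (l *: T) <= `|l| * norm T.
Proof.
rewrite /norm -{1}(@rnormE R R[i]^o l) -rmorphM lecR; apply: opnorm_le.
  by rewrite mulr_ge0 ?opnorm_ge0 ?rnorm_ge0.
by move=> x; rewrite rmorphM/= rnormE normrZ -mulrA ler_wpM2l// le_opnorm.
Qed.

Let normrZ (l : R[i]) T : norm (l *: T) = `|l| * norm T.
Proof.
apply/eqP; rewrite eq_le normZ_le/=.
have [->|l0] := eqVneq l 0.
  by rewrite normr0 mul0r /norm lecR opnorm_ge0.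
rewrite -ler_pdivlMl ?normr_gt0// -normfV.
by rewrite (le_trans _ (normZ_le _ _))// scalerA mulVf// scale1r.
Qed.

Let normr0_eq0 T : norm T = 0 -> T = 0.
Proof.
move=> T0; apply: bop_eqP => x; apply/eqP; rewrite -normr_le0.
by rewrite (le_trans (le_opnorm T x))// -/(norm T) T0 mul0r.
Qed.

HB.instance Definition _ :=
  Lmodule_isNormed.Build R[i] bop ler_normD normrZ normr0_eq0.

Lemma bop_normE (T : bop) : `|T| = rc (opnorm T).
Proof. by []. Qed.

Lemma le_bop_norm (T : bop) x : `|T x| <= `|T| * `|x|.
Proof. exact: le_opnorm. Qed.

Lemma bounded_bop (T : E -> F) (M : R[i]) :
  linear T -> (forall x, `|T x| <= M * `|x|) -> T \in bop_pred.
Proof.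
move=> lT TM; apply/asboolP; split=> //.
pose T' := GRing.isLinear.Build R[i] E F _ T lT.
pose L : {linear E -> F} := HB.pack T T'.
apply: (@bounded_linear_continuous _ _ _ L); apply/linear_boundedP.
exists `|M|; split=> [|r Mr x]; first exact: normr_real.
have MTx : 0 <= M * `|x| by apply: le_trans (TM x).
rewrite (le_trans (TM x))// -(ger0_norm MTx) normrM normr_id.
by rewrite ler_wpM2r// ltW.
Qed.

End bounded_operators.

HB.mixin Record isCompactGroup G & Topological G & Group G := {
  mulg_continuous : continuous (fun gh : G * G => (gh.1 * gh.2)%g);
  invg_continuous : continuous (fun g : G => (g^-1)%g);
  group_compact : compact [set: G];
  group_hausdorff : hausdorff_space G }.

#[short(type="compactGroupType")]
HB.structure Definition CompactGroup :=
  { G of Topological G & Group G & isCompactGroup G }.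

Section continuous_functions.
Variables (R : realType) (G : compactGroupType).

Definition cfun_pred : {pred G -> R[i]^o} :=
  [pred u : G -> R[i]^o | `[< continuous u >]].

Record cfun := CFun { cfun_fun :> G -> R[i]^o ; _ : cfun_fun \in cfun_pred }.

HB.instance Definition _ := [isSub for cfun_fun].
HB.instance Definition _ := [Choice of cfun by <:].

Lemma cfunP (u : cfun) : continuous u.
Proof. by case: u => u /= /asboolP. Qed.

Lemma cfun_submod_closed : submod_closed cfun_pred.
Proof.
split; first by apply/asboolP; exact: cst_continuous.
move=> a f g /asboolP cf /asboolP cg; apply/asboolP => x.
by apply: cvgD; [apply: cvgZr; exact: cf|exact: cg].
Qed.

HB.instance Definition _ := GRing.isSubmodClosed.Build _ _ cfun_pred
  cfun_submod_closed.
HB.instance Definition _ := [SubChoice_isSubLmodule of cfun by <:].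

Definition supnorm (u : cfun) : R := sup (range (fun g => rnorm (u g))).

Lemma supnorm_has_sup (u : cfun) : has_sup (range (fun g => rnorm (u g))).
Proof.
split; first by exists (rnorm (u 1%g)), 1%g.
have : compact ((fun g => rnorm (u g)) @` [set: G]).
  apply: continuous_compact; last exact: group_compact.
  apply: continuous_subspaceT => g.
  exact: continuous_comp (@cfunP u g) (@rnorm_continuous _ _ _).
move=> /compact_bounded/pinfty_ex_gt0[M M0 uM].
exists M => _ [g _ <-]; rewrite (le_trans (ler_norm _))//.
by apply: uM; exists g.
Qed.

Lemma le_supnorm (u : cfun) g : `|u g| <= rc (supnorm u).
Proof.
by rewrite -rnorm_le; apply: ub_le_sup; [exact: (supnorm_has_sup u).2|exists g].
Qed.

Lemma supnorm_le (u : cfun) (M : R) :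
  (forall g, `|u g| <= rc M) -> supnorm u <= M.
Proof.
move=> uM; apply: ge_sup; first exact: (supnorm_has_sup u).1.
by move=> _ [g _ <-]; rewrite rnorm_le.
Qed.

Lemma supnorm_ge0 (u : cfun) : 0 <= supnorm u.
Proof.
apply: le_trans (rnorm_ge0 (u 1%g)) _; rewrite rnorm_le; exact: le_supnorm.
Qed.

Let norm (u : cfun) : R[i] := rc (supnorm u).

Let ler_normD u v : norm (u + v) <= norm u + norm v.
Proof.
rewrite /norm -rmorphD lecR; apply: supnorm_le => g.
by rewrite rmorphD (le_trans (ler_normD _ _))// lerD ?le_supnorm.
Qed.

Let normZ_le (l : R[i]) u : norm (l *: u) <= `|l| * norm u.
Proof.
rewrite /norm -{1}(@rnormE R R[i]^o l) -rmorphM lecR; apply: supnorm_le => g.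
by rewrite rmorphM/= rnormE normrZ ler_wpM2l// le_supnorm.
Qed.

Let normrZ (l : R[i]) u : norm (l *: u) = `|l| * norm u.
Proof.
apply/eqP; rewrite eq_le normZ_le/=.
have [->|l0] := eqVneq l 0.
  by rewrite normr0 mul0r /norm lecR supnorm_ge0.
rewrite -ler_pdivlMl ?normr_gt0// -normfV.
by rewrite (le_trans _ (normZ_le _ _))// scalerA mulVf// scale1r.
Qed.

Let normr0_eq0 u : norm u = 0 -> u = 0.
Proof.
move=> u0; apply: val_inj; apply/funext => g; apply/eqP; rewrite -normr_le0.
by rewrite (le_trans (le_supnorm u g))// -/(norm u) u0.
Qed.

HB.instance Definition _ :=
  Lmodule_isNormed.Build R[i] cfun ler_normD normrZ normr0_eq0.

Lemma cfun_normE (u : cfun) : `|u| = rc (supnorm u).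
Proof. by []. Qed.

End continuous_functions.

Notation dual F := (bop F (GRing.regular _)).

Section injective_tensor_product.
Variables (R : realType) (F E : normedModType R[i]).

Definition weak_star : topologicalType :=
  initial_topology (fun mu : dual F => (mu : F -> R[i]^o) : {ptws F -> R[i]^o}).

Lemma elem_tensor_subproof (u : F) (a : E) :
  (fun mu : dual F => mu u *: a) \in @bop_pred R (dual F) E.
Proof.
apply: (@bounded_bop _ _ _ _ (`|u| * `|a|)) => [l mu nu /=|mu].
  by rewrite /= scalerDl scalerA.
rewrite normrZ mulrAC ler_wpM2r// mulrC.
exact: (@le_bop_norm R F R[i]^o mu u).
Qed.

Definition elem_tensor u a : bop (dual F) E := Bop (elem_tensor_subproof u a).

(* F \otimes_eps E, the completion of F \otimes E, is identified with its image
   under the isometric embedding into the operators F^* -> E *)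
Definition inj_tensor : set (bop (dual F) E) :=
  closure [set T | exists n (u : 'I_n -> F) (a : 'I_n -> E),
    T = \sum_i elem_tensor (u i) (a i)].

Definition left_wstar_equicontinuous (W : set (bop (dual F) E)) : Prop :=
  equicontinuous W (fun T => (T : dual F -> E) : weak_star -> E).

End injective_tensor_product.

(* inner is linear in its first variable *)
HB.mixin Record isHilbert (R : realType) H & CompleteNormedModule R[i] H := {
  inner : {dot H for @Num.Def.conjC R[i]};
  inner_norm : forall x : H, inner x x = `|x| ^+ 2 }.

#[short(type="hilbertType")]
HB.structure Definition Hilbert (R : realType) :=
  { H of CompleteNormedModule R[i] H & isHilbert R H }.

Section riesz.
Variables (R : realType) (H : hilbertType R).
Implicit Types x y z : H.

Lemma innerD x y z : inner (x + y) z = inner x z + inner y z.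
Proof. exact: linearDl. Qed.
Lemma innerZ (a : R[i]) x z : inner (a *: x) z = a * inner x z.
Proof. exact: linearZl_LR. Qed.
Lemma innerC x y : inner x y = (inner y x)^*.
Proof. by rewrite hermC /= expr0 mul1r. Qed.
Lemma innerDr x y z : inner z (x + y) = inner z x + inner z y.
Proof. by rewrite innerC innerD rmorphD/= -!innerC. Qed.
Lemma innerZr (a : R[i]) x z : inner z (a *: x) = a^* * inner z x.
Proof. by rewrite innerC innerZ rmorphM/= -innerC. Qed.

Lemma inner_bessel x y :
  `| `|y| ^+ 2 *: x - inner x y *: y| ^+ 2
    = `|y| ^+ 2 * (`|x| ^+ 2 * `|y| ^+ 2 - `|inner x y| ^+ 2).
Proof.
have yy : inner y y = `|y| ^+ 2 by rewrite inner_norm.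
rewrite -!inner_norm -scaleNr !(innerD, innerDr, innerZ, innerZr) yy.
rewrite rmorphN !rmorphXn/= (CrealP (normr_real y)).
rewrite -(innerC y x) [inner y x]innerC normCK; ring.
Qed.

Lemma inner_le x y : `|inner x y| <= `|x| * `|y|.
Proof.
have [->|y0] := eqVneq y 0.
  by rewrite innerC linear0l conjC0 !normr0 mulr0.
rewrite -ler_sqr ?nnegrE ?mulr_ge0// exprMn -subr_ge0.
by rewrite -(pmulr_rge0 _ (_ : 0 < `|y| ^+ 2)) ?exprn_gt0 ?normr_gt0// -inner_bessel exprn_ge0.
Qed.

Lemma rnormX2 x : rc (rnorm x ^+ 2) = `|x| ^+ 2.
Proof. by rewrite rmorphXn/= rnormE. Qed.

Lemma parallelogram x y :
  rnorm (x - y) ^+ 2 = 2 * rnorm x ^+ 2 + 2 * rnorm y ^+ 2 - 4 * rnorm (2^-1 *: (x + y)) ^+ 2.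
Proof.
apply: (@complexI R).
rewrite !mulr_natl (rmorphB (real_complex R)) (rmorphD (real_complex R)).
rewrite !(rmorphMn (real_complex R)) /= !rnormX2 -!inner_norm.
rewrite -scaleN1r !(innerD, innerDr, innerZ, innerZr) !rmorphN fmorphV !rmorph_nat rmorph1.
by field.
Qed.

Lemma riesz (f : bop H R[i]^o) : exists z, forall x, f x = inner x z.
Proof.
have [f0|] := pselect (forall x, f x = 0).
  by exists 0 => x; rewrite f0 innerC linear0l conjC0.
move=> /existsNP[x0 /eqP fx0].
pose K : set H := [set x | f x = 1].
have Kx0 : K ((f x0)^-1 *: x0) by rewrite /K/= linearZ/= -[_ *: _]/(_ * _) mulVf.
pose N := [set rnorm x | x in K].
pose d := inf N.
have Nd : has_inf N.
  split; first by exists (rnorm ((f x0)^-1 *: x0)), ((f x0)^-1 *: x0).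
  by exists 0 => _ [x _ <-]; exact: rnorm_ge0.
have Kd x : K x -> d <= rnorm x by move=> Kx; apply: ge_inf; [exact: Nd.2|exists x].
have d0 : 0 <= d by apply: lb_le_inf; [exact: Nd.1|move=> _ [x _ <-]; exact: rnorm_ge0].
pose Kd' e := [set x | K x /\ rnorm x < d + e].
have Kd'0 e : 0 < e -> Kd' e !=set0.
  by move=> e0; have [_ [x Kx <-] xe] := inf_adherent e0 Nd; exists x.
pose F := filter_from [set e : R | 0 < e] Kd'.
have FF : ProperFilter F.
  apply: filter_from_proper => //; apply: filter_from_filter.
    by exists 1 => /=.
  move=> e1 e2 /= e10 e20; exists (Num.min e1 e2); first by rewrite /= lt_min e10.
  by move=> x [Kx]; rewrite /= -ltrBlDl lt_min !ltrBlDl => /andP[? ?].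
have cF : cauchy F.
  apply: cauchy_exP => e e0.
  have /complex_realP[r re] : e \is Num.real by rewrite ger0_real// ltW.
  have r0 : 0 < r by rewrite -ltcR -re.
  pose del := Num.min 1 (r ^+ 2 / (8 * d + 5)).
  have del0 : 0 < del.
    by rewrite lt_min ltr01 divr_gt0 ?exprn_gt0//; lra.
  have [x [Kx xd]] := Kd'0 _ del0.
  exists x, del => // y [Ky yd] /=.
  rewrite -ball_normE /= -rnormE re ltcR -ltr_sqr ?nnegrE ?rnorm_ge0 ?ltW//.
  rewrite parallelogram.
  have Kxy : K (2^-1 *: (x + y)).
    rewrite /K/= linearZ/= linearD/= Kx Ky -[_ *: _]/(_ * _).
    by rewrite mulVf// pnatr_eq0.
  have dxy := Kd _ Kxy.
  have h1 : d ^+ 2 <= rnorm (2^-1 *: (x + y)) ^+ 2 by rewrite ler_sqr ?nnegrE ?rnorm_ge0.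
  have h2 : rnorm x ^+ 2 < (d + del) ^+ 2 by rewrite ltr_sqr ?nnegrE ?rnorm_ge0 ?addr_ge0// ltW.
  have h3 : rnorm y ^+ 2 < (d + del) ^+ 2 by rewrite ltr_sqr ?nnegrE ?rnorm_ge0 ?addr_ge0// ltW.
  have d1 : del <= 1 by rewrite ge_min lexx.
  have d2 : del * (8 * d + 5) <= r ^+ 2.
    by rewrite -ler_pdivlMr ?ge_min ?lexx ?orbT//; lra.
  move: h1 h2 h3 d2; rewrite !expr2; nra.
have [z Fz] : exists z, F --> z by exists (lim F); exact: cauchy_cvg.
have Kz : K z.
  have fz : f @ F --> f z by apply: continuous_cvg => //; exact: (bopP f).2.
  have f1 : f @ F --> (1 : R[i]^o).
    by apply: cvg_near_cst; exists 1 => //= x [Kx _]; exact: Kx.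
  exact: (@cvg_unique _ (@norm_hausdorff _ R[i]^o) _ _ _ _ fz f1).
have zd : rnorm z = d.
  apply/eqP; rewrite eq_le Kd// andbT.
  apply/ler_addgt0Pr => e e0.
  have fz : @rnorm _ H @ F --> rnorm z by apply: continuous_cvg => //; exact: rnorm_continuous.
  apply: (@closed_cvg _ _ F FF _ [set r : R | r <= d + e] _ _ _ fz).
    exact: closed_le.
  by exists e => //= x [_ /ltW].
have perp h : f h = 0 -> inner h z = 0.
  move=> fh.
  have [->|h0] := eqVneq h 0; first by rewrite linear0l.
  have := inner_bessel z h.
  set w := _ - _ => wE.
  have h20 : `|h| ^+ 2 != 0 by rewrite expf_neq0 ?normr_eq0.
  have Kw : K (`|h| ^- 2 *: w).
    have fw : f w = `|h| ^+ 2.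
      have -> : f w = `|h| ^+ 2 * f z - inner z h * f h.
        by rewrite linearB/= !linearZ.
      by rewrite fh Kz mulr1 mulr0 subr0.
    by rewrite /K/= linearZ/= fw [LHS]mulVf.
  have := Kd _ Kw; rewrite -zd -lecR !rnormE -ler_sqr ?nnegrE//.
  rewrite normrZ exprMn wE normfV (ger0_norm (exprn_ge0 _ _))//.
  rewrite (_ : (`|h| ^+ 2)^-1 ^+ 2 * _ = `|z| ^+ 2 - 
    `|inner z h| ^+ 2 / `|h| ^+ 2); last first.
    by field; rewrite normr_eq0.
  rewrite lerBrDl gerDr pmulr_lle0 ?invr_gt0 ?exprn_gt0 ?normr_gt0//.
  move=> k0; have /eqP : `|inner z h| ^+ 2 == 0 by rewrite eq_le k0 exprn_ge0.
  move=> /eqP; rewrite expf_eq0/= normr_eq0 => /eqP zh.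
  by rewrite innerC zh conjC0.
have z0 : `|z| ^+ 2 != 0.
  rewrite expf_neq0// normr_eq0; apply/eqP => z0.
  by move: Kz; rewrite /K/= z0 linear0 => /eqP; rewrite eq_sym oner_eq0.
exists (`|z| ^- 2 *: z) => x.
have : f (x - f x *: z) = 0.
  by rewrite linearB linearZ/= Kz -[_ *: _]/(_ * _) mulr1 subrr.
move=> /perp; rewrite -scaleNr innerD innerZ mulNr => /eqP; rewrite subr_eq0 => /eqP xz.
rewrite innerZr xz inner_norm fmorphV rmorphXn/= (CrealP (normr_real z)).
by rewrite mulrCA mulVf// mulr1.
Qed.

Lemma adjoint_exists (T : bop H H) :
  exists S : bop H H, forall x y, inner (T x) y = inner x (S y).
Proof.
have fy y : exists z, forall x, inner (T x) y = inner x z.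
  pose f x : R[i]^o := inner (T x) y.
  have fP : f \in @bop_pred R H R[i]^o.
    apply: (@bounded_bop _ _ _ _ (`|T| * `|y|)) => [a u v|x].
      by rewrite /f linearP innerD innerZ.
    rewrite (le_trans (inner_le _ _))// mulrAC ler_wpM2r// le_bop_norm//.
  have [z zP] := riesz (Bop fP); exists z => x; exact: zP.
have /choice[S SP] := fy.
have inj u v : (forall x, inner x u = inner x v) -> u = v.
  move=> uv; apply/eqP; rewrite -subr_eq0 -normr_eq0.
  suff : `|u - v| ^+ 2 == 0 by rewrite expf_eq0.
  rewrite -inner_norm -[X in inner _ (_ + X)]scaleN1r innerDr innerZr uv.
  by rewrite rmorphN rmorph1 mulN1r subrr.
have SB : S \in @bop_pred R H H.
  apply: (@bounded_bop _ _ _ _ `|T|) => [a u v|y].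
    by apply: inj => x; rewrite -SP !(innerDr, innerZr) -!SP.
  have [->|Sy0] := eqVneq (S y) 0; first by rewrite normr0 mulr_ge0.
  rewrite -(ler_pM2l (_ : 0 < `|S y|)) ?normr_gt0// -expr2 -inner_norm -SP.
  rewrite -(@ger0_norm _ (inner _ _)); last by rewrite SP inner_norm exprn_ge0.
  rewrite (le_trans (inner_le _ _))// mulrA ler_wpM2r//.
  by rewrite mulrC le_bop_norm.
by exists (Bop SB).
Qed.

End riesz.

Section operator_star_algebra.
Variables (R : realType) (H : hilbertType R).

Lemma bop_comp_subproof (S T : bop H H) : S \o T \in @bop_pred R H H.
Proof.
apply/asboolP; split=> [a x y /=|x]; first by rewrite !linearP.
by apply: continuous_comp; [exact: (bopP T).2|exact: (bopP S).2].
Qed.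

Definition bop_comp (S T : bop H H) : bop H H := Bop (bop_comp_subproof S T).

Definition adjoint (T : bop H H) : bop H H := projT1 (cid (adjoint_exists T)).

Lemma adjointP (T : bop H H) x y : inner (T x) y = inner x (adjoint T y).
Proof. by rewrite /adjoint; case: cid => S /=. Qed.

Record star_automorphism (f : bop H H -> bop H H) : Prop := {
  star_aut_linear : linear f;
  star_aut_bijective : bijective f;
  star_aut_comp : forall S T, f (bop_comp S T) = bop_comp (f S) (f T);
  star_aut_adjoint : forall T, f (adjoint T) = adjoint (f T) }.

Record continuous_star_action (G : compactGroupType)
    (act : G -> bop H H -> bop H H) : Prop := {
  star_action1 : forall T, act 1%g T = T;
  star_actionM : forall g h T, act (g * h)%g T = act g (act h T);
  star_action_aut : forall g, star_automorphism (act g);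
  star_action_continuous : forall T, continuous (fun g => act g T) }.

End operator_star_algebra.

Section uniform_continuity.
Variables (R : realType) (G : compactGroupType) (A : normedModType R[i]).

Lemma dirac_subproof (g : G) :
  (fun u : cfun R G => u g) \in @bop_pred R (cfun R G) R[i]^o.
Proof.
by apply: (@bounded_bop _ _ _ _ 1) => // u; rewrite mul1r; exact: le_supnorm.
Qed.

Definition cfun_dirac (g : G) : dual (cfun R G) := Bop (dirac_subproof g).

(* The isometric isomorphism C(G) \otimes_eps A ~ C(G, A), which maps u \otimes a
   to g |-> u g *: a, sends T, seen as an operator C(G)^* -> A, to
   g |-> T (cfun_dirac g). Hence Phi is a |-> (g |-> act g a). *)
Definition is_orbit_map (act : G -> A -> A)
    (Phi : A -> bop (dual (cfun R G)) A) : Prop :=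
  forall a, inj_tensor (Phi a) /\ forall g, Phi a (cfun_dirac g) = act g a.

Definition uniformly_continuous_action (act : G -> A -> A) : Prop :=
  exists2 Phi, is_orbit_map act Phi &
    forall B : set A, bounded_set B -> left_wstar_equicontinuous (Phi @` B).

End uniform_continuity.

Section spectrum.
Variables (R : realType) (G : compactGroupType).

(* irreducible representations of a compact group are finite-dimensional;
   continuity is that of the matrix coefficients *)
Record irrep := Irrep {
  irrep_space : vectType R[i];
  irrep_fun :> G -> 'End(irrep_space);
  irrep1 : irrep_fun 1%g = \1%VF;
  irrepM : forall g h, irrep_fun (g * h)%g = (irrep_fun g \o irrep_fun h)%VF;
  irrep_continuous : forall (phi : 'Hom(irrep_space, R[i]^o)) v,
    continuous (fun g => phi (irrep_fun g v) : R[i]^o);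
  irrep_neq0 : fullv != 0%VS :> {vspace irrep_space};
  irrep_irreducible : forall U : {vspace irrep_space},
    (forall g, (irrep_fun g @: U <= U)%VS) -> U = 0%VS \/ U = fullv }.

Definition irrep_equiv (rho sigma : irrep) : Prop :=
  exists2 phi : 'Hom(irrep_space rho, irrep_space sigma), bijective phi &
    forall g v, phi (rho g v) = sigma g (phi v).

Variable A : normedModType R[i].
Implicit Type act : G -> A -> A.

Definition subrep_of_class act (rho : irrep) (W : set A) : Prop :=
  exists phi : {linear irrep_space rho -> A},
    [/\ injective phi, forall g v, phi (rho g v) = act g (phi v)
      & W = range phi].

Definition isotypic act (rho : irrep) : set A :=
  [set a | exists n (c : 'I_n -> R[i]) (w : 'I_n -> A),
    (forall i, exists2 W, subrep_of_class act rho W & W (w i))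
    /\ a = \sum_i c i *: w i].

Definition finite_spectrum act : Prop :=
  exists n (s : 'I_n -> irrep), forall rho : irrep,
    (exists2 a, isotypic act rho a & a != 0) -> exists i, irrep_equiv rho (s i).

End spectrum.

(* Main.v *)
(* Write al for the action and A^G for its fixed-point algebra. No Haar measure
   is used: the diameter of the orbit averages of a continuous function on G
   can be made arbitrarily small, which gives an invariant mean, and applied to
   the orbit of a rank-one projection it gives a non-zero compact element of
   A^G. Spectral projections of such elements are finite-rank projections in
   A^G, and the minimal ones add up to the identity (a Peter-Weyl theorem for
   the projective representation implementing al).
   Call p, q in A^G disjoint if p A^G q = 0. If q_0, q_1, ... are pairwise
   disjoint with unit vectors y_n in their ranges, Bessel's inequality lets one
   choose indices b_k such that the functions
     f_k(g) = <al_g(|y_2k><y_bk|) y_bk, y_2k>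
   are almost orthogonal for the mean. For T = sum_k |y_2k><y_bk| one has
   f_k(g) = <al_g(T) y_bk, y_2k>, so norm-continuity of g |-> al_g(T) makes the
   f_k equicontinuous with f_k(1) = 1. Hence they form a totally bounded family
   whose L^2-norms are bounded below, which contradicts almost orthogonality.
   So finitely many minimal projections meet all classes; their corners are
   finite-dimensional and determine al, whence al_g = sum_j f_j(g) al_(t_j)
   with finitely many continuous f_j. Uniform continuity is then immediate, and
   the linear independence of coefficients of inequivalent irreducible
   representations bounds the number of classes in the spectrum. *)
From HB Require Import structures.
Require Import Defs.
From mathcomp Require Import all_boot all_order all_algebra.
From mathcomp Require Import perm.
From mathcomp Require Import all_classical all_reals all_analysis.
From mathcomp Require Import complex ring lra.

Set Implicit Arguments.
Unset Strict Implicit.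
Unset Printing Implicit Defensive.

Import Order.TTheory GRing.Theory Num.Theory.
Import numFieldNormedType.Exports.
Local Open Scope classical_set_scope.
Local Open Scope ring_scope.

Local Notation rc := (real_complex _).

(** * Averages of continuous functions on a compact group *)

(** An automorphism of the algebra of all bounded operators is conjugation by a unitary [u_g] that
    is unique only up to a phase, so [u] need not be a representation. The proof therefore stays
    with expressions in [act] in which phases cancel: [f_k(g)] is <u_g y_2k, y_2k> times the
    conjugate of <u_g y_bk, y_bk>. The second factor can be varied: against a prescribed continuous
    function only finitely many indices give a large mean, which leaves room to choose [b_k] after
    all earlier ones. The choice precedes [T]; cutting by fixed projections then shows that
    [act g T] has the coefficients prepared in advance. The passage to finitely many functions rests
    on rigidity: a linear map commuting with left and right multiplication by fixed operators is
    zero once it vanishes on finitely many finite-dimensional corners. The form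
    [sum_j f_j(g) act (t_j)] displays the orbit map as a finite sum of elementary tensors and puts
    the coefficients of all occurring irreducible representations into the span of the same
    [f_j]. *)

Section oscillation.
Variables (R : realType) (G : groupType) (E : zmodType) (nu : E -> R).
Hypotheses (nu0 : nu 0 = 0) (nuD : forall a b, nu (a + b) <= nu a + nu b).
Implicit Types (F : G -> E) (K L : seq G) (x y : G).

(** Left unnormalised, so that [E] need only be an abelian group; the division by [size L] becomes a
    factor on the right of the estimates. *)
Definition rsum F L x := \sum_(k <- L) F (x * k)%g.

(** Both translates are controlled at once because the estimate is used inside a double average: [x]
    is the base point and [a] runs through the inner list. *)
Definition unif_net F (e : R) K := forall h, exists2 k, k \in K &
  forall x a, nu (F (x * h * a)%g - F (x * k * a)%g) <= e.

Lemma nu_sum (I : Type) (s : seq I) (f : I -> E) :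
  nu (\sum_(i <- s) f i) <= \sum_(i <- s) nu (f i).
Proof.
elim: s => [|i s IH]; first by rewrite !big_nil nu0.
by rewrite !big_cons (le_trans (nuD _ _))// lerD2l.
Qed.

Lemma rsum_allpairs F K L x :
  rsum F [seq (k * l)%g | k <- K, l <- L] x = \sum_(k <- K) rsum F L (x * k)%g.
Proof.
rewrite /rsum big_allpairs_dep/=; apply: eq_bigr => k _.
by apply: eq_bigr => l _; rewrite mulgA.
Qed.

(* Averaging over K contracts the oscillation: one term at x and one term at y
   can be matched up to e, the remaining ones differ by at most D. *)
Lemma rsum_contract F K L (D e : R) : K != [::] -> unif_net F e K ->
  (forall x y, nu (rsum F L x - rsum F L y) <= D * (size L)%:R) ->
  forall x y, nu (rsum F [seq (k * l)%g | k <- K, l <- L] x -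
                  rsum F [seq (k * l)%g | k <- K, l <- L] y) <=
    (((size K).-1)%:R * D + e) * (size L)%:R.
Proof.
move=> K0 UC LD x y; rewrite !rsum_allpairs.
have n0 : (0 < size K)%N by rewrite lt0n size_eq0.
pose i0 := Ordinal n0; rewrite !(big_nth 1%g) !big_mkord.
have [k kK kP] := UC (y^-1 * x * nth 1%g K i0)%g.
have jn : (index k K < size K)%N by rewrite index_mem.
pose j := Ordinal jn.
rewrite [X in _ - X](reindex_inj (@perm_inj _ (tperm i0 j)))/= -sumrB.
rewrite (bigD1 i0)//= tpermL (le_trans (nuD _ _))// mulrDl [leRHS]addrC lerD//.
  rewrite nth_index// /rsum -sumrB (le_trans (nu_sum _ _))//.
  rewrite mulr_natr -sum1_size -sumrMnr; apply: ler_sum => l _.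
  by apply: le_trans (kP y _); rewrite !mulgA mulgV mul1g.
rewrite -big_filter (le_trans (nu_sum _ _))// big_filter.
apply: (@le_trans _ _ (\sum_(i < size K | i != i0) D * (size L)%:R)).
  by apply: ler_sum => i _; exact: LD.
by rewrite sumr_const cardC1 card_ord -[leLHS]mulr_natl mulrA.
Qed.

(** With n the size of an [e / 2]-net, one round of averaging turns a bound [D] on the normalised
    oscillation into ((n - 1) D + e / 2) / n. This affine map has fixed point [e / 2] and ratio
    [q < 1], so iteration gets below [e]. *)
Lemma small_oscillation F (D : R) :
  (forall x y, nu (F x - F y) <= D) ->
  (forall e, 0 < e -> exists2 K, K != [::] & unif_net F e K) ->
  forall e, 0 < e -> exists2 L, L != [::] &
    forall x y, nu (rsum F L x - rsum F L y) <= e * (size L)%:R.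
Proof.
move=> FD UC e e0; have e20 : 0 < e / 2 by lra.
have [K K0 UK] := UC _ e20.
have n0 : (0 < size K)%N by rewrite lt0n size_eq0.
pose n : R := (size K)%:R; have n0' : 0 < n by rewrite ltr0n.
pose q : R := (size K).-1%:R / n.
have nE : n = (size K).-1%:R + 1 by rewrite natr1 prednK.
have q01 : 0 <= q < 1.
  by rewrite /q divr_ge0 ?ler0n//= ltr_pdivrMr// mul1r nE ltrDl.
have step m : exists2 L, L != [::] &
    forall x y, nu (rsum F L x - rsum F L y) <= (e / 2 + q ^+ m * `|D|) * (size L)%:R.
  elim: m => [|m [L L0 LP]].
    exists [:: 1%g] => // x y; rewrite /rsum !big_seq1 !mulg1 mulr1 expr0 mul1r.
    by rewrite (le_trans (FD _ _))// (le_trans (ler_norm D))// lerDr ltW.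
  exists [seq (k * l)%g | k <- K, l <- L] => [|x y].
    by rewrite -size_eq0 size_allpairs muln_eq0 !size_eq0 negb_or K0 L0.
  rewrite (le_trans (rsum_contract K0 UK LP x y))// size_allpairs natrM -/n.
  have qn : q * n = (size K).-1%:R by rewrite /q divfK ?gt_eqF.
  rewrite le_eqVlt; apply/orP; left; apply/eqP.
  rewrite exprS (_ : (_ + q * _ * _) * _ =
    (e / 2 * n + (q * n) * (q ^+ m * `|D|)) * (size L)%:R); last by ring.
  by rewrite qn nE; ring.
have [m qm] : exists m, q ^+ m * `|D| <= e / 2.
  have : (fun m => q ^+ m * `|D|) @ \oo --> (0 : R).
    rewrite -[X in _ --> X](mul0r `|D|); apply: cvgMl.
    by apply: cvg_expr; case/andP: q01 => ? ?; rewrite ger0_norm.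
  move=> /cvgrPdist_le/(_ _ e20)[m _ mP]; exists m.
  by have := mP m (leqnn m); rewrite sub0r normrN; exact: le_trans (ler_norm _).
have [L L0 LP] := step m; exists L => // x y.
by rewrite (le_trans (LP x y))// ler_wpM2r//; lra.
Qed.

End oscillation.

Section real_norm_theory.
Variables (R : realType) (E : normedModType R[i]).
Implicit Types (x y : E) (a : R[i]).

Lemma rnorm0 : rnorm (0 : E) = 0.
Proof. by rewrite /rnorm normr0. Qed.

Lemma rnormD x y : rnorm (x + y) <= rnorm x + rnorm y.
Proof. by rewrite -lecR rmorphD/= !rnormE ler_normD. Qed.

Lemma rnormN x : rnorm (- x) = rnorm x.
Proof. by rewrite /rnorm normrN. Qed.

Lemma rnorm_distC x y : rnorm (x - y) = rnorm (y - x).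
Proof. by rewrite /rnorm distrC. Qed.

Lemma rnorm_distD z x y : rnorm (x - y) <= rnorm (x - z) + rnorm (z - y).
Proof. by rewrite -lecR rmorphD/= !rnormE ler_distD. Qed.

Lemma rnorm_eq0 x : (rnorm x == 0) = (x == 0).
Proof. by rewrite -(inj_eq (@complexI R)) rnormE normr_eq0. Qed.

Lemma rnorm_le0 x : rnorm x <= 0 -> x = 0.
Proof. by move=> x0; apply/eqP; rewrite -rnorm_eq0 eq_le x0 rnorm_ge0. Qed.

Lemma rnorm_gt0 x : (0 < rnorm x) = (x != 0).
Proof. by rewrite lt_def rnorm_eq0 rnorm_ge0 andbT. Qed.

Lemma rnormZ a x : rnorm (a *: x) = rnorm (a : R[i]^o) * rnorm x.
Proof. by apply: (@complexI R); rewrite rmorphM/= !rnormE normrZ. Qed.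

Lemma rnormMn x n : rnorm (x *+ n) = n%:R * rnorm x.
Proof.
rewrite -scaler_nat rnormZ; congr (_ * _); apply: (@complexI R).
by rewrite rnormE normr_nat rmorph_nat.
Qed.

Lemma rnorm_eq_le x y : (forall e, 0 < e -> rnorm (x - y) <= e) -> x = y.
Proof.
move=> xy; apply/eqP; rewrite -subr_eq0; apply/eqP/rnorm_le0.
by apply/ler_addgt0Pr => e e0; rewrite add0r xy.
Qed.

Lemma cvg_rnormP (T : Type) (F : set_system T) {FF : Filter F} (f : T -> E) l :
  f @ F --> l <-> forall e : R, 0 < e -> \forall t \near F, rnorm (l - f t) < e.
Proof.
split=> [/cvgrPdist_lt fl e e0|fl].
  have : 0 < rc e by rewrite ltcR.
  by move=> /fl; apply: filterS => t; rewrite -rnormE ltcR.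
apply/cvgrPdist_lt => e e0.
have /complex_realP[r re] : e \is Num.real by rewrite ger0_real// ltW.
have r0 : 0 < r by rewrite -ltcR -re.
by apply: filterS (fl r r0) => t; rewrite re -rnormE ltcR.
Qed.

End real_norm_theory.

Lemma cvgMg (G : compactGroupType) (T : Type) (F : set_system T)
    (FF : Filter F) (f g : T -> G) a b :
  f @ F --> a -> g @ F --> b -> (fun t => f t * g t)%g @ F --> (a * b)%g.
Proof.
move=> fa gb.
exact: (cvg_comp _ _ (cvg_pair fa gb) (@mulg_continuous G (a, b))).
Qed.

Section uniform_nets.
Variables (R : realType) (G : compactGroupType) (E : normedModType R[i]).
Implicit Types (F : G -> E) (e : R).

(** Compactness of [G * G] makes the estimate near each [h0] uniform in [x] and [a]; compactness of
    [G] then leaves finitely many [h0]. *)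
Lemma continuous_unif_net F : continuous F ->
  forall e, 0 < e -> exists2 K, K != [::] & unif_net (@rnorm R E) F e K.
Proof.
move=> cF e e0.
have e20 : 0 < e / 2 by lra.
have [cG GG] := (@group_compact G, compact_setX (@group_compact G) (@group_compact G)).
have local h0 : \forall h \near h0, forall x a,
    rnorm (F (x * h * a)%g - F (x * h0 * a)%g) <= e.
  have := (compact_near_coveringP _).1 GG G (nbhs h0)
    (fun h xa => rnorm (F (xa.1 * h * xa.2)%g - F (xa.1 * h0 * xa.2)%g) <= e) _.
  move=> H; have {H}: \forall h \near h0, ([set: G] `*` [set: G]) `<=`
     (fun xa => rnorm (F (xa.1 * h * xa.2)%g - F (xa.1 * h0 * xa.2)%g) <= e).
    apply: H => -[x0 a0] _.
    have cP : {for ((x0, a0), h0),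
        continuous (fun p : (G * G) * G => F (p.1.1 * p.2 * p.1.2)%g)}.
      apply: (continuous_comp (f := fun p : (G * G) * G => (p.1.1 * p.2 * p.1.2)%g)).
        apply: cvgMg; last by apply: cvg_comp; [exact: cvg_fst|exact: cvg_snd].
        apply: cvgMg; last exact: cvg_snd.
        by apply: cvg_comp; [exact: cvg_fst|exact: cvg_fst].
      exact: cF.
    have /cvg_rnormP/(_ _ e20) h1 := cP.
    have h2 : \forall xa \near (x0, a0),
        rnorm (F (x0 * h0 * a0)%g - F (xa.1 * h0 * xa.2)%g) < e / 2.
      have : (fun xa : G * G => (xa, h0)) @ (x0, a0) --> ((x0, a0), h0).
        exact: (cvg_pair cvg_id (cvg_cst h0)).
      by move=> /(_ _ h1).
    have h3 : \forall xa \near (x0, a0) & h \near h0,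
        rnorm (F (x0 * h0 * a0)%g - F (xa.1 * h * xa.2)%g) < e / 2 /\
        rnorm (F (x0 * h0 * a0)%g - F (xa.1 * h0 * xa.2)%g) < e / 2.
      apply: filterI; first exact: h1.
      by exists ([set xa : G * G |
        rnorm (F (x0 * h0 * a0)%g - F (xa.1 * h0 * xa.2)%g) < e / 2], setT) => //=;
        [split => //; exact: filterT|move=> [? ?] []].
    apply: filterS h3 => -[xa h]/= [p1 p2].
    rewrite (le_trans (rnorm_distD (F (x0 * h0 * a0)%g) _ _))// rnorm_distC.
    by lra.
  by apply: filterS => h H x a; exact: (H (x, a)).
(* The filter of finite lists ordered by inclusion turns [compact_near_coveringP] into the
   extraction of a finite subcover. *)
pose FL := filter_from [set: seq G] (fun L0 => [set L : seq G | {subset L0 <= L}]).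
have FFL : ProperFilter FL.
  apply: filter_from_proper => [|L _]; last by exists L => /=.
  apply: filter_from_filter; first by exists [::].
  move=> L1 L2 _ _; exists (L1 ++ L2) => // L /= LL.
  by split=> x xL; apply: LL; rewrite mem_cat xL ?orbT.
have : \forall L \near FL, [set: G] `<=` (fun h => exists2 k, k \in L & forall x a,
    rnorm (F (x * h * a)%g - F (x * k * a)%g) <= e).
  apply: ((compact_near_coveringP _).1 cG) => h0 _.
  exists ([set h | forall x a, rnorm (F (x * h * a)%g - F (x * h0 * a)%g) <= e],
     [set L : seq G | {subset [:: h0] <= L}]) => /=.
    by split; [exact: local|exists [:: h0]].
  by move=> [h L]/= [hP LP]; exists h0 => //; apply: LP; rewrite inE.
move=> [K _ KP]; exists (1%g :: K) => // h; apply: KP => //=.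
by move=> k kK; rewrite inE kK orbT.
Qed.

End uniform_nets.

Section mean.
Variables (R : realType) (G : compactGroupType) (E : normedModType R[i]).
Implicit Types (F : G -> E) (e : R) (c : E) (L : seq G).

Definition lsum F L x := \sum_(k <- L) F (k * x)%g.

(** With left averages and a bound uniform in [x], invariance under right translation is immediate,
    since it only moves [x]; uniqueness comes from a comparison with right averages. *)
Definition is_mean F c := forall e, 0 < e -> exists2 L, L != [::] &
  forall x, rnorm (lsum F L x - c *+ size L) <= e * (size L)%:R.

Lemma rnorm_sum (I : Type) (s : seq I) (f : I -> E) :
  rnorm (\sum_(i <- s) f i) <= \sum_(i <- s) rnorm (f i).
Proof. exact: nu_sum (@rnorm0 _ _) (@rnormD _ _) _ _ _. Qed.

Lemma rnorm_sum_le (I : eqType) (s : seq I) (f : I -> E) e :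
  (forall i, i \in s -> rnorm (f i) <= e) ->
  rnorm (\sum_(i <- s) f i) <= e * (size s)%:R.
Proof.
move=> fe; rewrite (le_trans (rnorm_sum _ _))// mulr_natr -sum1_size -sumrMnr.
by rewrite big_seq [leRHS]big_seq; exact: ler_sum.
Qed.

Lemma rnorm_sum_dist (I : eqType) (s : seq I) (f : I -> E) c e :
  (forall i, i \in s -> rnorm (f i - c) <= e) ->
  rnorm (\sum_(i <- s) f i - c *+ size s) <= e * (size s)%:R.
Proof.
move=> fe; rewrite -[in c *+ _]sum1_size -sumrMnr -sumrB.
exact: rnorm_sum_le.
Qed.

Lemma continuous_rnorm_bounded F : continuous F -> exists B, forall x, rnorm (F x) <= B.
Proof.
move=> /continuous_unif_net/(_ _ ltr01)[K _ KP].
exists (1 + \sum_(k <- K) rnorm (F k)) => x; have [k kK kP] := KP x.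
rewrite -[F x](subrK (F k)) (le_trans (rnormD _ _))// lerD//.
  by have := kP 1%g 1%g; rewrite !mul1g !mulg1.
by rewrite (big_rem k)//= lerDl sumr_ge0// => *; exact: rnorm_ge0.
Qed.

Lemma right_average F : continuous F -> forall e, 0 < e -> exists2 L, L != [::] &
  forall x y, rnorm (rsum F L x - rsum F L y) <= e * (size L)%:R.
Proof.
move=> cF; have [B FB] := continuous_rnorm_bounded cF.
apply: (small_oscillation (@rnorm0 _ _) (@rnormD _ _) (D := B + B)) => [x y|e e0].
  by rewrite (le_trans (rnormD _ _))// rnormN lerD.
exact: continuous_unif_net.
Qed.

Lemma left_average F : continuous F -> forall e, 0 < e -> exists2 L, L != [::] &
  forall x y, rnorm (lsum F L x - lsum F L y) <= e * (size L)%:R.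
Proof.
move=> cF e e0.
have cFV : continuous (fun x => F (x^-1)%g).
  by move=> x; apply: continuous_comp; [exact: invg_continuous|exact: cF].
have [L L0 LP] := right_average cFV e0.
exists [seq k^-1 | k <- L]%g => [|x y]; first by rewrite -size_eq0 size_map size_eq0.
have rl z : lsum F [seq k^-1 | k <- L]%g z = rsum (fun x => F (x^-1)%g) L z^-1%g.
  by rewrite /lsum big_map; apply: eq_bigr => k _; rewrite invgM invgK.
by rewrite !rl size_map.
Qed.

Lemma size_gt0R L : L != [::] -> 0 < (size L)%:R :> R.
Proof. by rewrite -size_eq0 ltr0n lt0n. Qed.

(* Evaluating the double average over L x L' in both orders shows that left and
   right averages have the same limit. *)
Lemma left_right_average F c d L L' e e' : L != [::] ->
  (forall x, rnorm (lsum F L x - c *+ size L) <= e * (size L)%:R) ->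
  (forall x, rnorm (rsum F L' x - d) <= e' * (size L')%:R) ->
  rnorm (c *+ size L' - d) <= (e + e') * (size L')%:R.
Proof.
move=> L0 Lc Ld; have sL := size_gt0R L0.
pose S := \sum_(k <- L) \sum_(l <- L') F (k * l)%g.
have S1 : rnorm (S - d *+ size L) <= e' * (size L')%:R * (size L)%:R.
  by apply: rnorm_sum_dist => k _; exact: Ld.
have S2 : rnorm (S - c *+ size L *+ size L') <= e * (size L)%:R * (size L')%:R.
  by rewrite /S exchange_big/=; apply: rnorm_sum_dist => k _; exact: Lc.
rewrite -(ler_pM2l sL) -rnormMn mulrnBl -mulrnA mulnC mulrnA.
rewrite (le_trans (rnorm_distD S _ _))// rnorm_distC (le_trans (lerD S2 S1))//.
by rewrite le_eqVlt; apply/orP; left; apply/eqP; ring.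
Qed.

(** Small oscillation alone forces a right average to be close to the mean, so a list found without
    reference to [c] can serve several means or several functions at once. *)
Lemma is_mean_right F c L e : is_mean F c ->
  (forall x y, rnorm (rsum F L x - rsum F L y) <= e * (size L)%:R) ->
  forall x, rnorm (rsum F L x - c *+ size L) <= e * (size L)%:R.
Proof.
move=> Fc LP x; rewrite rnorm_distC.
have [->|L0] := eqVneq L [::].
  by rewrite /rsum big_nil mulr0n subr0 rnorm0 mulr0.
apply/ler_addgt0Pr => d d0; have sL := size_gt0R L0.
have d1 : 0 < d / (size L)%:R by rewrite divr_gt0.
have [K K0 KP] := Fc _ d1.
rewrite (le_trans (left_right_average K0 KP (fun y => LP y x)))//.
by rewrite mulrDl divfK ?gt_eqF// addrC.
Qed.

Lemma is_mean_uniq F c c' : continuous F -> is_mean F c -> is_mean F c' -> c = c'.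
Proof.
move=> cF Fc Fc'; apply: rnorm_eq_le => e e0.
have e20 : 0 < e / 2 by lra.
have [L L0 LP] := right_average cF e20; have sL := size_gt0R L0.
have h1 := is_mean_right Fc LP 1%g; have h2 := is_mean_right Fc' LP 1%g.
rewrite -(ler_pM2l sL) -rnormMn mulrnBl (le_trans (rnorm_distD (rsum F L 1%g) _ _))//.
by rewrite rnorm_distC (le_trans (lerD h1 h2))// -mulrDl -splitr mulrC.
Qed.

Lemma is_mean_mulg F c y : is_mean F c -> is_mean (fun x => F (x * y)%g) c.
Proof.
move=> Fc e e0; have [L L0 LP] := Fc e e0; exists L => // x.
rewrite (_ : lsum _ _ _ = lsum F L (x * y)%g)//.
by apply: eq_bigr => k _; rewrite mulgA.
Qed.

Lemma is_mean_cst c : is_mean (fun=> c) c.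
Proof.
move=> e e0; exists [:: 1%g] => // x.
by rewrite /lsum big_seq1 mulr1n subrr rnorm0 mulr1 ltW.
Qed.

End mean.

(** Additivity with a Lipschitz bound is asked instead of linearity because the instance
    [x |-> rc (rdot x w)] is only real-linear. *)
Lemma is_mean_lip (R : realType) (G : compactGroupType) (E E' : normedModType R[i])
    (phi : E -> E') (B : R) (F : G -> E) c :
  {morph phi : a b / a + b} -> (forall a, rnorm (phi a) <= B * rnorm a) ->
  is_mean F c -> is_mean (phi \o F) (phi c).
Proof.
move=> phiD phiB Fc e e0.
have phi0 : phi 0 = 0 by apply: (addrI (phi 0)); rewrite -phiD !addr0.
have phiN a : phi (- a) = - phi a.
  by apply/eqP; rewrite -addr_eq0 -phiD addNr phi0.
have phiMn a n : phi (a *+ n) = phi a *+ n.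
  by elim: n => [|n IH]; rewrite ?mulr0n// !mulrS phiD IH.
have B0 : 0 < `|B| + 1 by rewrite ltr_wpDl.
have eB : 0 < e / (`|B| + 1) by rewrite divr_gt0.
have [L L0 LP] := Fc _ eB; exists L => // x.
rewrite /lsum/= -(big_morph phi phiD phi0) -phiMn -phiN -phiD.
rewrite (le_trans (phiB _))// (@le_trans _ _ ((`|B| + 1) * (e / (`|B| + 1) * (size L)%:R)))//.
  apply: (@le_trans _ _ ((`|B| + 1) * rnorm (\sum_(k <- L) F (k * x)%g - c *+ size L))).
    by rewrite ler_wpM2r ?rnorm_ge0// (le_trans (ler_norm B))// lerDl.
  by rewrite ler_wpM2l ?(ltW B0)//; exact: LP.
by rewrite mulrA mulrCA divff ?gt_eqF// mulr1.
Qed.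

Lemma rnorm_pair1 (R : realType) (E E' : normedModType R[i]) (p : E * E') :
  rnorm p.1 <= rnorm p.
Proof. by rewrite -lecR !rnormE prod_normE num_le_max lexx. Qed.

Lemma rnorm_pair2 (R : realType) (E E' : normedModType R[i]) (p : E * E') :
  rnorm p.2 <= rnorm p.
Proof. by rewrite -lecR !rnormE prod_normE num_le_max lexx orbT. Qed.


Lemma is_meanD (R : realType) (G : compactGroupType) (E : normedModType R[i])
    (F F' : G -> E) c c' d : continuous F -> continuous F' ->
  is_mean F c -> is_mean F' c' -> is_mean (F \+ F') d -> d = c + c'.
Proof.
move=> cF cF' Fc Fc' Fd; apply: rnorm_eq_le => e e0.
have e40 : 0 < e / 4 by lra.
(* A right average of the pair oscillates little in both components, which provides one list [L] for
   [F], [F'] and their sum. *)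
have cP : continuous (fun x => (F x, F' x)).
  by move=> x; exact: (cvg_pair (cF x) (cF' x)).
have [L L0 LP] := right_average cP e40; have sL := size_gt0R R L0.
have rP x : rsum (fun x => (F x, F' x)) L x = (rsum F L x, rsum F' L x).
  by rewrite /rsum; elim: (L) => [|k s IH]; rewrite ?big_nil// !big_cons IH.
have L1 x y : rnorm (rsum F L x - rsum F L y) <= e / 4 * (size L)%:R.
  by apply: le_trans (LP x y); rewrite !rP; apply: le_trans (rnorm_pair1 _).
have L2 x y : rnorm (rsum F' L x - rsum F' L y) <= e / 4 * (size L)%:R.
  by apply: le_trans (LP x y); rewrite !rP; apply: le_trans (rnorm_pair2 _).
have rD x : rsum (F \+ F') L x = rsum F L x + rsum F' L x by exact: big_split.
have L3 x y : rnorm (rsum (F \+ F') L x - rsum (F \+ F') L y) <= e / 2 * (size L)%:R.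
  rewrite !rD opprD addrACA (le_trans (rnormD _ _))//.
  by rewrite (le_trans (lerD (L1 x y) (L2 x y)))// -mulrDl; lra.
have h1 := is_mean_right Fc L1 1%g; have h2 := is_mean_right Fc' L2 1%g.
have h3 := is_mean_right Fd L3 1%g.
rewrite -(ler_pM2l sL) -rnormMn mulrnBl mulrnDl.
rewrite (le_trans (rnorm_distD (rsum (F \+ F') L 1%g) _ _))// rnorm_distC {2}rD.
rewrite opprD addrACA (le_trans (lerD h3 (rnormD _ _)))//.
by rewrite (le_trans (lerD (lexx _) (lerD h1 h2)))//; lra.
Qed.

(** The sets [B e] of approximate means shrink with [e]. Comparing two elements of [B e] with a
    common right average bounds its diameter by [4 * e], so these sets generate a Cauchy filter. *)
Lemma is_mean_ex (R : realType) (G : compactGroupType) (E : completeNormedModType R[i])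
    (F : G -> E) : continuous F -> exists c, is_mean F c.
Proof.
move=> cF.
pose B e := [set c | exists2 L, L != [::] &
  forall x, rnorm (lsum F L x - c *+ size L) <= e * (size L)%:R].
have B0 e : 0 < e -> B e !=set0.
  move=> e0; have [L L0 LP] := left_average cF e0.
  have sL := size_gt0R R L0.
  exists (((size L)%:R : R[i])^-1 *: lsum F L 1%g), L => // x.
  by rewrite -scaler_nat scalerA divff ?scale1r// pnatr_eq0 size_eq0.
have Bd e c c' : 0 < e -> B e c -> B e c' -> rnorm (c - c') <= 4 * e.
  move=> e0 [L L0 LP] [L' L'0 LP'].
  have [K K0 KP] := right_average cF e0; have sK := size_gt0R R K0.
  have h1 := left_right_average L0 LP (fun x => KP x 1%g).
  have h2 := left_right_average L'0 LP' (fun x => KP x 1%g).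
  rewrite -(ler_pM2l sK) -rnormMn mulrnBl.
  rewrite (le_trans (rnorm_distD (rsum F K 1%g) _ _))// [X in _ + X]rnorm_distC.
  by rewrite (le_trans (lerD h1 h2))//; lra.
pose FF := filter_from [set e : R | 0 < e] B.
have PF : ProperFilter FF.
  apply: filter_from_proper => //; apply: filter_from_filter; first by exists 1 => /=.
  move=> e1 e2 /= e10 e20; exists (Num.min e1 e2); first by rewrite /= lt_min e10.
  by move=> c [L L0 LP]; split; exists L => // x; rewrite (le_trans (LP x))//
    ler_wpM2r// ge_min lexx ?orbT.
have cauF : cauchy FF.
  apply: cauchy_exP => e e0.
  have /complex_realP[r re] : e \is Num.real by rewrite ger0_real// ltW.
  have r0 : 0 < r by rewrite -ltcR -re.
  have r80 : 0 < r / 8 by lra.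
  have [c Bc] := B0 _ r80; exists c, (r / 8) => // c' Bc' /=.
  rewrite -ball_normE /= -rnormE re ltcR (le_lt_trans (Bd _ _ _ r80 Bc Bc'))//; lra.
have [c Fc] : exists c : E, FF --> c by apply/cvg_ex; exact: (@cauchy_cvg E FF).
exists c => e e0; have e20 : 0 < e / 2 by lra.
have [d /= d0 dP] := (@cvg_rnormP _ _ _ FF _ id c).1 Fc _ e20.
have m0 : 0 < Num.min d (e / 2) by rewrite lt_min d0.
have [c' [L L0 LP]] := B0 _ m0; exists L => // x.
have cc' : rnorm (c - c') < e / 2.
  apply: dP; exists L => // y; rewrite (le_trans (LP y))//.
  by rewrite ler_wpM2r// ge_min lexx.
rewrite (le_trans (rnorm_distD (c' *+ size L) _ _))//.
rewrite -mulrnBl rnormMn [e]splitr mulrDl lerD//.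
  by rewrite (le_trans (LP x))// ler_wpM2r// ge_min lexx orbT.
by rewrite mulrC ler_wpM2r// rnorm_distC ltW.
Qed.

(** * The underlying real inner product and the mean of real functions *)

Section real_inner_product.
Variables (R : realType) (H : hilbertType R).
Implicit Types (x y z : H) (a : R[i]).

Definition rdot x y : R := complex.Re (inner x y).

Lemma rdotDl x y z : rdot (x + y) z = rdot x z + rdot y z.
Proof. by rewrite /rdot innerD raddfD. Qed.

Lemma rdotC x y : rdot x y = rdot y x.
Proof. by rewrite /rdot innerC; case: (inner y x). Qed.

Lemma rdotDr x y z : rdot z (x + y) = rdot z x + rdot z y.
Proof. by rewrite rdotC rdotDl !(rdotC z). Qed.

Lemma rdotZl (a : R) x y : rdot (rc a *: x) y = a * rdot x y.
Proof. by rewrite /rdot innerZ; case: (inner x y) => u v /=; rewrite mul0r subr0. Qed.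

Lemma rdotZr (a : R) x y : rdot x (rc a *: y) = a * rdot x y.
Proof. by rewrite rdotC rdotZl rdotC. Qed.

Lemma rdotNl x y : rdot (- x) y = - rdot x y.
Proof. by rewrite /rdot linearNl raddfN. Qed.

Lemma rdotNr x y : rdot x (- y) = - rdot x y.
Proof. by rewrite rdotC rdotNl rdotC. Qed.

Lemma rdotBl x y z : rdot (x - y) z = rdot x z - rdot y z.
Proof. by rewrite rdotDl rdotNl. Qed.

Lemma rdotBr x y z : rdot z (x - y) = rdot z x - rdot z y.
Proof. by rewrite rdotDr rdotNr. Qed.

Lemma rdotxx x : rdot x x = rnorm x ^+ 2.
Proof.
by apply: (@complexI R); rewrite rnormX2 /rdot inner_norm RRe_real// rpredX// normr_real.
Qed.

Lemma Re_le_rnorm a : `|complex.Re a| <= rnorm (a : R[i]^o).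
Proof. by rewrite -lecR rnormE; exact: normc_ge_Re. Qed.

Lemma Im_le_rnorm a : `|complex.Im a| <= rnorm (a : R[i]^o).
Proof.
by rewrite -lecR rnormE normc_def lecR -sqrtr_sqr ler_wsqrtr// lerDr sqr_ge0.
Qed.

Lemma rnorm_inner x y : rnorm (inner x y : R[i]^o) <= rnorm x * rnorm y.
Proof. by rewrite -lecR rmorphM/= !rnormE; exact: inner_le. Qed.

Lemma rdot_le x y : `|rdot x y| <= rnorm x * rnorm y.
Proof. exact: le_trans (Re_le_rnorm _) (rnorm_inner _ _). Qed.

Lemma rnorm_rc (a : R) : rnorm (rc a : R[i]^o) = `|a|.
Proof. by apply: (@complexI R); rewrite rnormE normc_def/= expr0n addr0 sqrtr_sqr. Qed.

Lemma inner_sep x y : (forall z, rdot x z = rdot y z) -> x = y.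
Proof.
move=> xy; apply/eqP; rewrite -subr_eq0 -rnorm_eq0.
suff : rnorm (x - y) ^+ 2 == 0 by rewrite expf_eq0.
by rewrite -rdotxx rdotBl xy subrr.
Qed.

End real_inner_product.

Lemma continuous_sum (K : numFieldType) (E : normedModType K) (X : topologicalType)
    (I : Type) (s : seq I) (f : I -> X -> E) :
  (forall i, continuous (f i)) -> continuous (fun x => \sum_(i <- s) f i x).
Proof.
move=> cf; elim: s => [|i s IH] x.
  by under eq_fun do rewrite big_nil; exact: cvg_cst.
by under eq_fun do rewrite big_cons; apply: cvgD; [exact: cf|exact: IH].
Qed.

Section real_mean.
Variables (R : realType) (G : compactGroupType).
Implicit Types (f : G -> R) (c : R).

Definition is_rmean f c := is_mean (fun g => rc (f g) : R[i]^o) (rc c : R[i]^o).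

Definition rmean f := xget 0 [set c | is_rmean f c].

Lemma continuous_rc f : continuous f -> continuous (fun g => rc (f g) : R[i]^o).
Proof.
move=> cf g; apply/cvg_rnormP => e e0.
have /cvgrPdist_lt/(_ _ e0) := cf g; apply: filterS => t.
by rewrite -rmorphB rnorm_rc.
Qed.

Lemma is_rmean_le f c C : is_rmean f c -> (forall g, f g <= C) -> c <= C.
Proof.
move=> fc fC; apply/ler_addgt0Pr => e e0.
have [L L0 /(_ 1%g)] := fc e e0; have sL := size_gt0R R L0.
rewrite /lsum -rmorph_sum -rmorphMn -rmorphB rnorm_rc => /ler_normlP[LP _].
have LC : \sum_(i <- L) f (i * 1)%g <= C * (size L)%:R.
  by rewrite mulr_natr -sum1_size -sumrMnr; exact: ler_sum.
by rewrite -(ler_pM2r sL) mulrDl mulr_natr; lra.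
Qed.

Variables (H : hilbertType R) (x0 : H) (x01 : rnorm x0 = 1).

Lemma is_mean_rdot (F : G -> H) (c w : H) :
  is_mean F c -> is_rmean (fun g => rdot (F g) w) (rdot c w).
Proof.
apply: (@is_mean_lip _ _ _ _ (fun x => rc (rdot x w) : R[i]^o) (rnorm w)).
  by move=> a b; rewrite rdotDl rmorphD.
by move=> a; rewrite rnorm_rc mulrC rdot_le.
Qed.

Lemma rmeanP f : continuous f -> is_rmean f (rmean f).
Proof.
move=> cf; apply: xgetPex.
(* Existence of means is proved for functions into a complete space: [f] is transported into [H]
   along the unit vector [x0] and read back with [rdot]. *)
have cF : continuous (fun g => rc (f g) *: x0).
  by move=> g; apply: cvgZl; exact: continuous_rc.
have [c Fc] := is_mean_ex cF; have cP := is_mean_rdot x0 Fc.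
exists (rdot c x0); rewrite /= /is_rmean.
suff -> : f = (fun g => rdot (rc (f g) *: x0) x0) by [].
by apply/funext => g; rewrite rdotZl rdotxx x01 expr1n mulr1.
Qed.

Lemma rmean_eq f c : continuous f -> is_rmean f c -> rmean f = c.
Proof.
move=> cf fc; apply: (@complexI R).
exact: (is_mean_uniq (continuous_rc cf) (rmeanP cf) fc).
Qed.

Lemma rmean_rdot (F : G -> H) (c w : H) : continuous (fun g => rdot (F g) w) ->
  is_mean F c -> rmean (fun g => rdot (F g) w) = rdot c w.
Proof. by move=> cF Fc; apply: rmean_eq => //; exact: is_mean_rdot. Qed.

Lemma rmean_cst c : rmean (fun=> c) = c.
Proof. by apply: rmean_eq; [exact: cst_continuous|exact: is_mean_cst]. Qed.

Lemma rmean_mulg f y : continuous f -> rmean (fun g => f (g * y)%g) = rmean f.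
Proof.
move=> cf; apply: rmean_eq; last exact: (is_mean_mulg y (rmeanP cf)).
move=> g; apply: continuous_comp; last exact: cf.
by apply: cvgMg; [exact: cvg_id|exact: cvg_cst].
Qed.

Lemma rmeanD f f' : continuous f -> continuous f' ->
  rmean (fun g => f g + f' g) = rmean f + rmean f'.
Proof.
move=> cf cf'; apply: (@complexI R); rewrite rmorphD/=.
apply: (is_meanD (continuous_rc cf) (continuous_rc cf') (rmeanP cf) (rmeanP cf')).
have cD : continuous (fun g => f g + f' g) by move=> g; apply: cvgD; [exact: cf|exact: cf'].
have := rmeanP cD; rewrite /is_rmean; congr (is_mean _ _).
by apply/funext => g; rewrite rmorphD.
Qed.

Lemma rmeanZ f c : continuous f -> rmean (fun g => c * f g) = c * rmean f.
Proof.
move=> cf; apply: rmean_eq; first by move=> g; apply: cvgMr; exact: cf.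
have := is_mean_lip (phi := fun z : R[i]^o => (rc c * z : R[i]^o)) (B := `|c|) _ _ (rmeanP cf).
have -> : (fun z : R[i]^o => (rc c * z : R[i]^o)) \o (fun g => rc (f g) : R[i]^o) =
    (fun g => rc (c * f g) : R[i]^o) by apply/funext => g /=; rewrite rmorphM.
rewrite -rmorphM; apply; first by move=> a b; rewrite mulrDr.
by move=> a; rewrite -rnorm_rc -lecR rmorphM/= !rnormE normrM.
Qed.

Lemma rmean_le f C : continuous f -> (forall g, f g <= C) -> rmean f <= C.
Proof. by move=> cf; apply: is_rmean_le; exact: rmeanP. Qed.

Lemma rmeanN f : continuous f -> rmean (fun g => - f g) = - rmean f.
Proof.
move=> cf; rewrite -mulN1r -rmeanZ//; congr rmean.
by apply/funext => g; rewrite mulN1r.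
Qed.

Lemma rmeanB f f' : continuous f -> continuous f' ->
  rmean (fun g => f g - f' g) = rmean f - rmean f'.
Proof.
move=> cf cf'; rewrite -rmeanN// -rmeanD// => g; apply: cvgN; exact: cf'.
Qed.

Lemma rmean_ge f C : continuous f -> (forall g, C <= f g) -> C <= rmean f.
Proof.
move=> cf fC; rewrite -[leRHS]opprK -rmeanN// lerNr; apply: rmean_le => g.
  by apply: cvgN; exact: cf.
by rewrite lerN2.
Qed.

(** Positivity of the mean without a measure: finitely many translates of the set where [f] is at
    least [c] cover [G], so the translates of [f] add up to at least [c], and each has the mean of
    [f]. *)
Lemma rmean_cover f (K : seq G) c : continuous f -> (forall g, 0 <= f g) ->
  (forall g, exists2 k, k \in K & c <= f (g * k^-1)%g) ->
  c <= rmean f * (size K)%:R.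
Proof.
move=> cf f0 fK.
have cf' k : continuous (fun g => f (g * k)%g).
  move=> g; apply: continuous_comp; last exact: cf.
  by apply: cvgMg; [exact: cvg_id|exact: cvg_cst].
have cS (L : seq G) : continuous (fun g => \sum_(k <- L) f (g * k^-1)%g).
  by apply: continuous_sum => k; exact: cf'.
have <- : rmean (fun g => \sum_(k <- K) f (g * k^-1)%g) = rmean f * (size K)%:R.
  elim: (K) => [|k L IH].
    by under eq_fun do rewrite big_nil; rewrite rmean_cst mulr0.
  under eq_fun do rewrite big_cons.
  by rewrite rmeanD// IH rmean_mulg//= -natr1 mulrDr mulr1 addrC.
apply: rmean_ge => // g; have [k kK kc] := fK g.
by rewrite (big_rem k)//= (le_trans kc)// lerDl sumr_ge0.
Qed.

End real_mean.

(** * Operators on a Hilbert space and their *-automorphisms *)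

Lemma rnormM (R : realType) (a b : R[i]) :
  rnorm (a * b : R[i]^o) = rnorm (a : R[i]^o) * rnorm (b : R[i]^o).
Proof. exact: (rnormZ (E := R[i]^o)). Qed.

Lemma bop_sumE (R : realType) (E F : normedModType R[i]) (I : Type) (s : seq I)
    (T : I -> bop E F) x : (\sum_(i <- s) T i) x = \sum_(i <- s) T i x.
Proof. by elim/big_rec2: _ => // i u v _ <-. Qed.

Section operators.
Variables (R : realType) (H : hilbertType R).
Implicit Types (x y z : H) (S T p : bop H H) (a : R[i]).

Local Notation "S ** T" := (bop_comp S T) (at level 40, left associativity).

Lemma bopDE S T x : (S + T) x = S x + T x. Proof. by []. Qed.
Lemma bopBE S T x : (S - T) x = S x - T x. Proof. by []. Qed.
Lemma bopZE a S x : (a *: S) x = a *: S x. Proof. by []. Qed.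
Lemma bop0E x : (0 : bop H H) x = 0. Proof. by []. Qed.
Lemma bop_compE S T x : (S ** T) x = S (T x). Proof. by []. Qed.

Lemma rnorm_bop T x : rnorm (T x) <= rnorm T * rnorm x.
Proof. by rewrite -lecR rmorphM/= !rnormE; exact: le_bop_norm. Qed.

Lemma rnorm_bop_le T (M : R) :
  0 <= M -> (forall x, rnorm (T x) <= M * rnorm x) -> rnorm T <= M.
Proof.
move=> M0 TM; rewrite rnorm_le bop_normE lecR; apply: opnorm_le => // x.
by rewrite -!rnormE -rmorphM lecR.
Qed.

Lemma bop_id_subproof : (fun x : H => x) \in @bop_pred R H H.
Proof. by apply/asboolP; split=> // x; exact: cvg_id. Qed.
Definition bop_id : bop H H := Bop bop_id_subproof.

Lemma rank1_subproof x y : (fun z => inner z y *: x) \in @bop_pred R H H.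
Proof.
apply: (@bounded_bop _ _ _ _ (`|x| * `|y|)) => [a u v|z].
  by rewrite innerD innerZ scalerDl scalerA.
by rewrite normrZ -mulrA mulrC ler_wpM2l// mulrC inner_le.
Qed.
Definition rank1 x y : bop H H := Bop (rank1_subproof x y).

Lemma rank1E x y z : rank1 x y z = inner z y *: x. Proof. by []. Qed.

Lemma inner0l x : inner 0 x = 0. Proof. by rewrite linear0l. Qed.
Lemma inner0r x : inner x 0 = 0. Proof. by rewrite innerC inner0l rmorph0. Qed.
Lemma innerNl x y : inner (- x) y = - inner x y. Proof. by rewrite linearNl. Qed.
Lemma innerNr x y : inner x (- y) = - inner x y.
Proof. by rewrite innerC innerNl rmorphN/= -innerC. Qed.
Lemma inner_suml (I : Type) (s : seq I) (F : I -> H) x :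
  inner (\sum_(i <- s) F i) x = \sum_(i <- s) inner (F i) x.
Proof. by rewrite (big_morph (fun z => inner z x) (fun u v => innerD u v x) (inner0l x)). Qed.
Lemma inner_sumr (I : Type) (s : seq I) (F : I -> H) x :
  inner x (\sum_(i <- s) F i) = \sum_(i <- s) inner x (F i).
Proof. by rewrite (big_morph (inner x) (fun u v => innerDr u v x) (inner0r x)). Qed.

Lemma innerxx x : inner x x = rc (rnorm x ^+ 2).
Proof. by rewrite inner_norm rnormX2. Qed.

Lemma inner_inj x y : (forall z, inner z x = inner z y) -> x = y.
Proof. by move=> xy; apply: inner_sep => z; rewrite rdotC /rdot xy -/(rdot z y) rdotC. Qed.

Lemma adjoint_uniq T S : (forall x y, inner (T x) y = inner x (S y)) -> adjoint T = S.
Proof.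
by move=> TS; apply: bop_eqP => y; apply: inner_inj => x; rewrite -adjointP TS.
Qed.

Lemma adjointPr T x y : inner x (T y) = inner (adjoint T x) y.
Proof. by rewrite innerC adjointP -innerC. Qed.

Lemma adjointK T : adjoint (adjoint T) = T.
Proof. by apply: adjoint_uniq => x y; rewrite -adjointPr. Qed.

Lemma adjoint_comp S T : adjoint (S ** T) = adjoint T ** adjoint S.
Proof. by apply: adjoint_uniq => x y /=; rewrite !adjointP. Qed.

Lemma adjoint_rank1 x y : adjoint (rank1 x y) = rank1 y x.
Proof.
apply: adjoint_uniq => u v; rewrite !rank1E innerZ innerZr mulrC; congr (_ * _).
exact: innerC.
Qed.

Lemma adjointD S T : adjoint (S + T) = adjoint S + adjoint T.
Proof. by apply: adjoint_uniq => x y; rewrite !bopDE innerD innerDr !adjointP. Qed.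

Lemma adjointZ a S : adjoint (a *: S) = a^* *: adjoint S.
Proof. by apply: adjoint_uniq => x y; rewrite !bopZE innerZ innerZr conjCK adjointP. Qed.

Lemma adjoint0 : adjoint (0 : bop H H) = 0.
Proof. by apply: adjoint_uniq => x y; rewrite !bop0E inner0l inner0r. Qed.

Lemma bop_compA S T U : S ** (T ** U) = S ** T ** U.
Proof. exact: bop_eqP. Qed.
Lemma bop_comp1 S : S ** bop_id = S.
Proof. exact: bop_eqP. Qed.
Lemma bop_comp1l S : bop_id ** S = S.
Proof. exact: bop_eqP. Qed.
Lemma bop_compDl S T U : (S + T) ** U = S ** U + T ** U.
Proof. exact: bop_eqP. Qed.
Lemma bop_compDr S T U : U ** (S + T) = U ** S + U ** T.
Proof. by apply: bop_eqP => x; rewrite /= linearD. Qed.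
Lemma bop_compZl a S T : (a *: S) ** T = a *: (S ** T).
Proof. exact: bop_eqP. Qed.
Lemma bop_compZr a S T : S ** (a *: T) = a *: (S ** T).
Proof. by apply: bop_eqP => x; rewrite /= linearZ. Qed.
Lemma bop_comp0l S : 0 ** S = 0.
Proof. exact: bop_eqP. Qed.
Lemma bop_comp0r S : S ** 0 = 0.
Proof. by apply: bop_eqP => x /=; rewrite linear0. Qed.
Lemma bop_compNr S T : S ** (- T) = - (S ** T).
Proof. by apply: bop_eqP => x /=; rewrite linearN. Qed.
Lemma bop_compNl S T : (- S) ** T = - (S ** T).
Proof. exact: bop_eqP. Qed.
Lemma bop_comp_suml (I : Type) (s : seq I) (F : I -> bop H H) S :
  (\sum_(i <- s) F i) ** S = \sum_(i <- s) F i ** S.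
Proof. by rewrite (big_morph (fun T => T ** S) (fun U V => bop_compDl U V S) (bop_comp0l S)). Qed.
Lemma bop_comp_sumr (I : Type) (s : seq I) (F : I -> bop H H) S :
  S ** (\sum_(i <- s) F i) = \sum_(i <- s) S ** F i.
Proof. by rewrite (big_morph (fun T => S ** T) (fun U V => bop_compDr U V S) (bop_comp0r S)). Qed.

Lemma comp_rank1 T x y : T ** rank1 x y = rank1 (T x) y.
Proof. by apply: bop_eqP => z; rewrite /= linearZ. Qed.

Lemma rank1_comp T x y : rank1 x y ** T = rank1 x (adjoint T y).
Proof. by apply: bop_eqP => z; rewrite /= adjointP. Qed.

Lemma rank1Zl a x y : rank1 (a *: x) y = a *: rank1 x y.
Proof. by apply: bop_eqP => z; rewrite bopZE !rank1E !scalerA mulrC. Qed.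

Lemma rank1_rank1 x y u v : rank1 x y ** rank1 u v = inner u y *: rank1 x v.
Proof. by rewrite comp_rank1 rank1E rank1Zl. Qed.

Lemma rank1_neq0 x y : x != 0 -> y != 0 -> rank1 x y != 0.
Proof.
move=> x0 y0; apply/eqP => /(congr1 (fun T : bop H H => T y)).
rewrite rank1E bop0E => /eqP; rewrite scaler_eq0 (negPf x0) orbF inner_norm.
by rewrite expf_eq0/= normr_eq0 (negPf y0).
Qed.

Lemma rnorm_sqr_le x (M : R) : 0 <= M -> rnorm x ^+ 2 <= M * rnorm x -> rnorm x <= M.
Proof.
move=> M0; have [->//|x0] := eqVneq (rnorm x) 0.
by rewrite expr2 ler_pM2r// lt_def x0 rnorm_ge0.
Qed.

Lemma unit_multiple x : x != 0 ->
  exists2 u, rnorm u = 1 & x = rc (rnorm x) *: u.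
Proof.
move=> x0; have rx : rnorm x != 0 by rewrite rnorm_eq0.
exists (rc (rnorm x)^-1 *: x).
  by rewrite rnormZ rnorm_rc ger0_norm ?invr_ge0 ?rnorm_ge0// mulVf.
by rewrite scalerA -rmorphM divff// rmorph1 scale1r.
Qed.

Lemma rnorm_inner_le T (M : R) : 0 <= M ->
  (forall x y, rnorm x = 1 -> rnorm y = 1 -> rnorm (inner (T x) y : R[i]^o) <= M) ->
  rnorm T <= M.
Proof.
move=> M0 TM; apply: rnorm_bop_le => // x.
have [->|x0] := eqVneq x 0; first by rewrite linear0 rnorm0 mulr0.
have [->|y0] := eqVneq (T x) 0; first by rewrite rnorm0 mulr_ge0 ?rnorm_ge0.
have [u u1 xu] := unit_multiple x0; have [v v1 yv] := unit_multiple y0.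
have := TM u v u1 v1; rewrite -(ler_pM2l (_ : 0 < rnorm x)) ?rnorm_gt0// => uv.
rewrite [leRHS]mulrC (le_trans _ uv)//.
have -> : rnorm x * rnorm (inner (T u) v : R[i]^o) = rnorm (inner (T x) v : R[i]^o).
  by rewrite {2}xu linearZ/= innerZ rnormM rnorm_rc ger0_norm ?rnorm_ge0.
rewrite {2}yv innerZ innerxx v1 expr1n mulr1 rnorm_rc ger0_norm ?rnorm_ge0//.
Qed.

Definition is_proj p := p ** p = p /\ adjoint p = p.

Lemma proj_id p x : is_proj p -> p (p x) = p x.
Proof. by move=> [pp _]; rewrite -[in RHS]pp. Qed.

Lemma proj_inner p x y : is_proj p -> inner (p x) y = inner (p x) (p y).
Proof. by move=> pP; rewrite -{1}(proj_id x pP) adjointP pP.2. Qed.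

Lemma proj_contract p x : is_proj p -> rnorm (p x) <= rnorm x.
Proof.
move=> pp; apply: rnorm_sqr_le; first exact: rnorm_ge0.
rewrite -rdotxx /rdot -proj_inner// -/(rdot _ _) mulrC.
exact: le_trans (ler_norm _) (rdot_le _ _).
Qed.

Lemma proj_unit p : is_proj p -> p != 0 -> exists2 u, rnorm u = 1 & p u = u.
Proof.
move=> pP p0; have [x px] : exists x, p x != 0.
  apply: contrapT => /forallNP px; case/eqP: p0.
  by apply: bop_eqP => x; apply/eqP/negP/negP; apply/negPn/negP => /px.
have [u u1 pxu] := unit_multiple px; exists u => //.
have rp : rc (rnorm (p x)) != 0 by rewrite fmorph_eq0 rnorm_eq0.
apply: (scalerI rp); rewrite -linearZ -pxu; exact: proj_id.
Qed.

Lemma rank1_proj x : rnorm x = 1 -> is_proj (rank1 x x).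
Proof.
move=> x1; split; last exact: adjoint_rank1.
by rewrite rank1_rank1 innerxx x1 expr1n scale1r.
Qed.

Lemma rnorm_rank1 x y : rnorm (rank1 x y) <= rnorm x * rnorm y.
Proof.
apply: rnorm_bop_le => [|z]; first by rewrite mulr_ge0 ?rnorm_ge0.
by rewrite rank1E rnormZ -mulrA mulrC ler_wpM2l ?rnorm_ge0// mulrC rnorm_inner.
Qed.

End operators.

Notation "S ** T" := (bop_comp S T) (at level 40, left associativity).
Arguments bop_id {R H}.

Section star_automorphisms.
Variables (R : realType) (H : hilbertType R) (f : bop H H -> bop H H).
Hypothesis fP : star_automorphism f.
Implicit Types (x y z : H) (S T p : bop H H) (a : R[i]).

Let fM S T : f (S ** T) = f S ** f T. Proof. exact: star_aut_comp. Qed.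
Let fadj T : f (adjoint T) = adjoint (f T). Proof. exact: star_aut_adjoint. Qed.
Lemma star_aut0 : f 0 = 0.
Proof. by have := star_aut_linear fP (-1) 0 0; rewrite scaler0 addr0 scaleN1r addNr. Qed.
Lemma star_autD S T : f (S + T) = f S + f T.
Proof. by have := star_aut_linear fP 1 S T; rewrite !scale1r. Qed.
Lemma star_autZ a T : f (a *: T) = a *: f T.
Proof. by have := star_aut_linear fP a T 0; rewrite !addr0 star_aut0 addr0. Qed.
Lemma star_autN T : f (- T) = - f T.
Proof. by rewrite -scaleN1r star_autZ scaleN1r. Qed.
Lemma star_aut_eq0 T : f T = 0 -> T = 0.
Proof. by move=> fT; apply: (bij_inj (star_aut_bijective fP)); rewrite fT star_aut0. Qed.

Lemma star_aut_proj p : is_proj p -> is_proj (f p).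
Proof. by move=> [pp pa]; split; rewrite -?fM -?fadj ?pp ?pa. Qed.

(** For a rank-one projection [P], every [P ** T ** P] is a multiple of [P], and an automorphism
    preserves this. Tested on [rank1 v z] it shows that the image of [P] sends every [v] to a
    multiple of its unit vector [z]. *)
Lemma star_aut_rank1 x : rnorm x = 1 -> exists2 z, rnorm z = 1 & f (rank1 x x) = rank1 z z.
Proof.
move=> x1; have fp := star_aut_proj (rank1_proj x1).
have [|z z1 fz] := proj_unit fp.
  apply/eqP => /star_aut_eq0/eqP; apply/negP; apply: rank1_neq0;
  by rewrite -rnorm_gt0 x1.
exists z => //; have [h fhK hfK] := star_aut_bijective fP.
apply: bop_eqP => v.
have key : exists c, f (rank1 x x) v = c *: z.
  have E : f (rank1 x x) ** rank1 v z ** f (rank1 x x) =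
      inner (h (rank1 v z) x) x *: f (rank1 x x).
    rewrite -{1}(hfK (rank1 v z)) -!fM -star_autZ.
    by rewrite comp_rank1 -rank1Zl.
  exists (inner (h (rank1 v z) x) x).
  have := congr1 (fun T : bop H H => T z) E.
  by rewrite !bop_compE fz rank1E innerxx z1 expr1n scale1r => ->; rewrite bopZE fz.
have [c vc] := key; rewrite vc rank1E; congr (_ *: _).
have := congr1 (inner ^~ z) vc; rewrite innerZ innerxx z1 expr1n mulr1 => <-.
by rewrite adjointP fp.2 fz.
Qed.

(** Matrix coefficients survive the automorphism: cutting [T] by the projections on [y] and [x]
    gives [inner (T x) y] times [rank1 y x], and the image of [rank1 y x] has norm one at [z].
    Applied to the inverse as well, this makes the action isometric. *)
Lemma star_aut_norm_ge T : rnorm T <= rnorm (f T).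
Proof.
apply: rnorm_inner_le => [|x y x1 y1]; first exact: rnorm_ge0.
pose m := rank1 y x.
have [z z1 fz] := star_aut_rank1 x1.
have mz : rnorm (f m z) = 1.
  apply/eqP; rewrite -(@eqrXn2 _ 2) ?rnorm_ge0// expr1n -rdotxx /rdot.
  rewrite adjointP -fadj -[f _ (f _ _)]/((f (adjoint m) ** f m) z) -fM adjoint_rank1.
  rewrite rank1_rank1 innerxx y1 expr1n scale1r fz rank1E !innerxx z1 expr1n scale1r.
  by rewrite innerxx z1 expr1n.
have E : f (rank1 y y) ** f T ** f (rank1 x x) = inner (T x) y *: f m.
  by rewrite -!fM -star_autZ rank1_comp rank1_rank1 adjointPr adjointK.
have := congr1 (fun S : bop H H => rnorm (S z)) E.
rewrite bopZE rnormZ mz mulr1 => <- /=.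
rewrite fz rank1E innerxx z1 expr1n scale1r.
rewrite (le_trans (proj_contract _ (star_aut_proj (rank1_proj y1))))//.
by rewrite (le_trans (rnorm_bop _ _))// z1 mulr1.
Qed.

End star_automorphisms.

(** * Continuous actions *)

Lemma lip_continuous (R : realType) (X : topologicalType) (E E' : normedModType R[i])
    (F : X -> E) (phi : E -> E') (B : R) :
  (forall a b, rnorm (phi a - phi b) <= B * rnorm (a - b)) ->
  continuous F -> continuous (fun x => phi (F x)).
Proof.
move=> phiB cF x; apply/cvg_rnormP => e e0.
have B0 : 0 < `|B| + 1 by rewrite ltr_wpDl.
have /cvg_rnormP/(_ _ (divr_gt0 e0 B0)) := cF x; apply: filterS => y.
rewrite ltr_pdivlMr// mulrC; apply: le_lt_trans.
by rewrite (le_trans (phiB _ _))// ler_wpM2r ?rnorm_ge0// (le_trans (ler_norm B))// lerDl.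
Qed.

Lemma continuous_rdot (R : realType) (X : topologicalType) (H : hilbertType R)
    (F F' : X -> H) : continuous F -> continuous F' ->
  continuous (fun x => rdot (F x) (F' x)).
Proof.
move=> cF cF' x.
have -> : (fun x => rdot (F x) (F' x)) =
    (fun x => 4^-1 * (rnorm (F x + F' x) ^+ 2 - rnorm (F x - F' x) ^+ 2)).
  apply/funext => y; rewrite -!rdotxx !(rdotDl, rdotDr, rdotNl, rdotNr).
  by rewrite (rdotC (F' y)); field.
apply: cvgMr; apply: cvgB; rewrite !expr2; apply: cvgM;
  (apply: continuous_comp; last exact: rnorm_continuous);
  by [apply: cvgD; [exact: cF|exact: cF']|apply: cvgB; [exact: cF|exact: cF']].
Qed.

Lemma is_mean_bound (R : realType) (G : compactGroupType) (E : normedModType R[i])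
    (F : G -> E) c (B : R) :
  is_mean F c -> (forall g, rnorm (F g) <= B) -> rnorm c <= B.
Proof.
move=> Fc FB; apply/ler_addgt0Pr => e e0.
have [L L0 /(_ 1%g) LP] := Fc e e0; have sL := size_gt0R R L0.
rewrite -(ler_pM2l sL) -rnormMn -(subrK (lsum F L 1%g) (c *+ _)).
rewrite (le_trans (rnormD _ _))// rnorm_distC.
have h : rnorm (lsum F L 1%g) <= B * (size L)%:R by apply: rnorm_sum_le => k _.
by rewrite (le_trans (lerD LP h))//; lra.
Qed.

Section action.
Variables (R : realType) (G : compactGroupType) (H : hilbertType R).
Variable act : G -> bop H H -> bop H H.
Hypothesis hact : continuous_star_action act.
Implicit Types (x y z v w : H) (S T p e : bop H H) (a : R[i]) (g h : G).

Let autP g := star_action_aut hact g.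

Lemma act1 T : act 1%g T = T. Proof. exact: star_action1. Qed.
Lemma actM g h T : act (g * h)%g T = act g (act h T). Proof. exact: star_actionM. Qed.
Lemma actVK g T : act g (act g^-1 T)%g = T.
Proof. by rewrite -actM mulgV act1. Qed.
Lemma actKV g T : act g^-1%g (act g T) = T.
Proof. by rewrite -actM mulVg act1. Qed.
Lemma act0 g : act g 0 = 0. Proof. exact: star_aut0 (autP g). Qed.
Lemma actD g S T : act g (S + T) = act g S + act g T. Proof. exact: star_autD (autP g) _ _. Qed.
Lemma actZ g a T : act g (a *: T) = a *: act g T. Proof. exact: star_autZ (autP g) _ _. Qed.
Lemma actN g T : act g (- T) = - act g T. Proof. exact: star_autN (autP g) _. Qed.
Lemma act_comp g S T : act g (S ** T) = act g S ** act g T.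
Proof. exact: star_aut_comp (autP g) _ _. Qed.
Lemma act_adjoint g T : act g (adjoint T) = adjoint (act g T).
Proof. exact: star_aut_adjoint (autP g) _. Qed.
Lemma act_id g : act g bop_id = bop_id.
Proof.
have := act_comp g bop_id (act g^-1%g bop_id).
by rewrite bop_comp1l actVK bop_comp1 => <-.
Qed.
Lemma act_sum (I : Type) (s : seq I) (F : I -> bop H H) g :
  act g (\sum_(i <- s) F i) = \sum_(i <- s) act g (F i).
Proof. exact: (big_morph (act g) (actD g) (act0 g)). Qed.

Lemma rnorm_act g T : rnorm (act g T) = rnorm T.
Proof.
apply/eqP; rewrite eq_le (star_aut_norm_ge (autP g)) andbT.
by have := star_aut_norm_ge (autP g^-1%g) (act g T); rewrite actKV.
Qed.

Lemma act_continuous T : continuous (fun g => act g T).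
Proof. exact: star_action_continuous. Qed.

Lemma act_continuous_at T x : continuous (fun g => act g T x).
Proof.
apply: (@lip_continuous _ _ _ _ _ (fun S : bop H H => S x) (rnorm x) _ (@act_continuous T)).
by move=> a b; rewrite mulrC -bopBE rnorm_bop.
Qed.

Lemma act_proj g p : is_proj p -> is_proj (act g p).
Proof. exact: star_aut_proj. Qed.

Lemma act_rank1 g x : rnorm x = 1 -> exists2 z, rnorm z = 1 & act g (rank1 x x) = rank1 z z.
Proof. exact: star_aut_rank1. Qed.

Definition fixed S := forall g, act g S = S.

Lemma fixed_comp S T : fixed S -> fixed T -> fixed (S ** T).
Proof. by move=> fS fT g; rewrite act_comp fS fT. Qed.
Lemma fixed_adjoint S : fixed S -> fixed (adjoint S).
Proof. by move=> fS g; rewrite act_adjoint fS. Qed.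
Lemma fixed_id : fixed bop_id. Proof. exact: act_id. Qed.

Lemma mean_operator T : exists e, [/\ fixed e,
    forall v, is_mean (fun g => act g T v) (e v)
  & forall r, 0 < r -> exists2 L, L != [::] &
      rnorm (\sum_(k <- L) act k T - e *+ size L) <= r * (size L)%:R].
Proof.
have mex v := is_mean_ex (@act_continuous_at T (v)).
have /choice[e0 e0P] := mex.
have e0D u v : e0 (u + v) = e0 u + e0 v.
  apply: is_meanD (e0P u) (e0P v) _; try exact: act_continuous_at.
  have := e0P (u + v); congr (is_mean _ _).
  by apply/funext => g /=; rewrite linearD.
have e0Z a v : e0 (a *: v) = a *: e0 v.
  have h := is_mean_lip (phi := fun u => a *: u) (B := rnorm (a : R[i]^o)) (scalerDr a) _ (e0P v).
  apply: (is_mean_uniq (@act_continuous_at T (a *: v)) (e0P _)).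
  have -> : (fun g => act g T (a *: v)) = (fun u => a *: u) \o (fun g => act g T v).
    by apply/funext => g /=; rewrite linearZ.
  by apply: h => u; rewrite rnormZ.
have e0B : e0 \in @bop_pred R H H.
  apply: (@bounded_bop _ _ _ _ `|T|) => [a u v|v]; first by rewrite e0D e0Z.
  rewrite -!rnormE -rmorphM lecR; apply: is_mean_bound (e0P v) _ => g.
  by rewrite (le_trans (rnorm_bop _ _))// rnorm_act.
pose e := Bop e0B.
have approx r : 0 < r -> exists2 L, L != [::] & forall x : G,
      rnorm (rsum (fun g => act g T) L x - e *+ size L) <= r * (size L)%:R.
  move=> r0; have [L L0 LP] := right_average (@act_continuous T) r0; exists L => // x.
  have rv (y : G) v : rsum (fun g => act g T v) L y = (rsum (fun g => act g T) L y) v.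
    by rewrite /rsum bop_sumE.
  have eMn v n : (e *+ n) v = e v *+ n.
    by elim: n => [|n IH]; rewrite ?mulr0n// !mulrS bopDE IH.
  apply: rnorm_bop_le => [|v]; first by rewrite mulr_ge0 ?ler0n// ltW.
  rewrite bopBE eMn -rv mulrAC; apply: (is_mean_right (e0P v)) => y z.
  rewrite !rv -bopBE (le_trans (rnorm_bop _ _))// mulrAC.
  by rewrite ler_wpM2r ?rnorm_ge0.
exists e; split=> // [y|r r0]; last first.
  have [L L0 /(_ 1%g)] := approx r r0; rewrite /rsum.
  by under eq_bigr do rewrite mul1g; exists L.
apply: rnorm_eq_le => r r0; have r20 : 0 < r / 2 by lra.
have [L L0 LP] := approx _ r20; have sL := size_gt0R R L0.
(* [act y] carries the average at the identity to the average at [y], so [e] and [act y e] are both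
   close to the latter. *)
have h1 : rnorm (rsum (fun g => act g T) L y - act y e *+ size L) <= r / 2 * (size L)%:R.
  apply: le_trans (LP 1%g); rewrite -[leRHS](rnorm_act y) actD actN act_sum.
  rewrite (_ : act y (e *+ _) = act y e *+ size L); last first.
    by elim: (size L) => [|n IH]; rewrite ?mulr0n ?act0// !mulrS actD IH.
  by rewrite /rsum; under [in leRHS]eq_bigr => k _ do rewrite -actM mul1g.
rewrite -(ler_pM2l sL) -rnormMn mulrnBl.
rewrite (le_trans (rnorm_distD (rsum (fun g => act g T) L y) _ _))//.
by rewrite rnorm_distC (le_trans (lerD h1 (LP y)))//; lra.
Qed.

Lemma mean_sandwich S S' T e : (forall v, is_mean (fun g => act g T v) (e v)) ->
  (forall g, S ** act g T ** S' = 0) -> S ** e ** S' = 0.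
Proof.
move=> eP ST; apply: bop_eqP => u.
have h := is_mean_lip (phi := fun w => S w) (B := rnorm S) (linearD S)
  (@rnorm_bop _ _ S) (eP (S' u)).
have E : (fun w => S w) \o (fun g => act g T (S' u)) = (fun=> 0).
  by apply/funext => g; have := congr1 (fun T : bop H H => T u) (ST g).
rewrite E in h.
rewrite bop0E !bop_compE.
by apply: is_mean_uniq h (@is_mean_cst _ _ _ _); exact: cst_continuous.
Qed.

End action.

(** * Compact operators and fixed projections *)

(** Ultrafilters stand in for the diagonal extraction of subsequences: along an ultrafilter every
    bounded function is nearly constant. *)
Lemma ultra_small_oscillation (R : realType) (X : Type) (U : set_system X)
    (f : X -> R) (B : R) : UltraFilter U -> U [set x | `|f x| <= B] ->
  forall e, 0 < e -> exists2 S, U S & forall x y, S x -> S y -> `|f x - f y| <= e.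
Proof.
move=> UU UB e e0; have e20 : 0 < e / 2 by lra.
have FB : U [set x | `[- B, B]%classic (f x)].
  by apply: filterS UB => x /=; rewrite in_itv/= ler_norml.
have [p [_ clp]] := @segment_compact R (- B) B (f @ U) _ FB.
pose S := [set x | `|p - f x| < e / 2].
exists S; last first.
  move=> x y Sx Sy; rewrite (le_trans (ler_distD p _ _))// [in leLHS]distrC.
  by rewrite [e]splitr lerD ?ltW.
have [//|US] := in_ultra_setVsetC S UU.
have [y []] := clp [set r | ~ (`|p - r| < e / 2)] (ball p (e / 2)) US (nbhsx_ballx _ _ e20).
by move=> + pr; case.
Qed.

Lemma rnorm_le_ReIm (R : realType) (a : R[i]) :
  rnorm (a : R[i]^o) <= `|complex.Re a| + `|complex.Im a|.
Proof.
rewrite -lecR rnormE normc_def lecR.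
rewrite -[leRHS]ger0_norm ?addr_ge0// -sqrtr_sqr ler_wsqrtr// sqrrD !real_normK ?num_real//.
by rewrite -addrA lerD2l lerDr mulrn_wge0// mulr_ge0.
Qed.

Lemma ultra_small_oscillationC (R : realType) (X : Type) (U : set_system X)
    (f : X -> R[i]) (B : R) : UltraFilter U ->
  U [set x | rnorm (f x : R[i]^o) <= B] ->
  forall e, 0 < e ->
  exists2 S, U S & forall x y, S x -> S y -> rnorm (f x - f y : R[i]^o) <= e.
Proof.
move=> UU UB e e0; have e20 : 0 < e / 2 by lra.
have URe : U [set x | `|complex.Re (f x)| <= B].
  by apply: filterS UB => x; apply: le_trans; exact: Re_le_rnorm.
have UIm : U [set x | `|complex.Im (f x)| <= B].
  by apply: filterS UB => x; apply: le_trans; exact: Im_le_rnorm.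
have [S US SP] := ultra_small_oscillation UU URe e20.
have [T UT TP] := ultra_small_oscillation UU UIm e20.
exists (S `&` T); first exact: filterI.
move=> x y [Sx Tx] [Sy Ty]; rewrite (le_trans (rnorm_le_ReIm _))// [e]splitr.
by rewrite !raddfB lerD ?SP ?TP.
Qed.

Section finite_rank.
Variables (R : realType) (H : hilbertType R).
Implicit Types (x y z : H) (S T p K : bop H H) (a : R[i]).

Definition rank_le n T := exists2 s : seq (H * H), (size s <= n)%N &
  T = \sum_(u <- s) rank1 u.1 u.2.

(** On a Hilbert space, norm approximation by finite rank is equivalent to compactness; it is the
    form in which averages of a rank-one projection provide it. *)
Definition compact_op T := forall e : R, 0 < e ->
  exists n, exists2 K, rank_le n K & rnorm (T - K) <= e.

Lemma rank_le_rank1 x y : rank_le 1 (rank1 x y).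
Proof. by exists [:: (x, y)] => //; rewrite big_seq1. Qed.

Lemma rank_le0 n : rank_le n 0.
Proof. by exists [::] => //; rewrite big_nil. Qed.

Lemma rank_leD m n S T : rank_le m S -> rank_le n T -> rank_le (m + n) (S + T).
Proof.
move=> [s sm ->] [t tn ->]; exists (s ++ t); first by rewrite size_cat leq_add.
by rewrite big_cat.
Qed.

Lemma rank_le_compl n S T : rank_le n T -> rank_le n (S ** T).
Proof.
move=> [s sn ->]; exists [seq (S u.1, u.2) | u <- s]; first by rewrite size_map.
by rewrite bop_comp_sumr big_map; apply: eq_bigr => u _; rewrite comp_rank1.
Qed.

Lemma adjoint_sum (I : Type) (s : seq I) (F : I -> bop H H) :
  adjoint (\sum_(i <- s) F i) = \sum_(i <- s) adjoint (F i).
Proof. exact: (big_morph _ (@adjointD _ _) (@adjoint0 _ _)). Qed.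

Lemma rank_le_adjoint n T : rank_le n T -> rank_le n (adjoint T).
Proof.
move=> [s sn ->]; exists [seq (u.2, u.1) | u <- s]; first by rewrite size_map.
by rewrite adjoint_sum big_map; apply: eq_bigr => u _; rewrite adjoint_rank1.
Qed.

Lemma rank_leZ n a T : rank_le n T -> rank_le n (a *: T).
Proof. by move=> Tn; rewrite -[T]bop_comp1l -bop_compZl; exact: rank_le_compl. Qed.

Lemma rank_le_compact n T : rank_le n T -> compact_op T.
Proof. by move=> Tn e e0; exists n, T => //; rewrite subrr rnorm0 ltW. Qed.

Lemma rnorm_comp S T : rnorm (S ** T) <= rnorm S * rnorm T.
Proof.
apply: rnorm_bop_le => [|x]; first by rewrite mulr_ge0 ?rnorm_ge0.
by rewrite bop_compE (le_trans (rnorm_bop _ _))// -mulrA ler_wpM2l ?rnorm_ge0// rnorm_bop.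
Qed.

Lemma compact_compl S T : compact_op T -> compact_op (S ** T).
Proof.
move=> cT e e0; have S0 : 0 < rnorm S + 1 by rewrite ltr_wpDl ?rnorm_ge0.
have [n [K Kn TK]] := cT _ (divr_gt0 e0 S0).
exists n, (S ** K); first exact: rank_le_compl.
rewrite -bop_compNr -bop_compDr (le_trans (rnorm_comp _ _))//.
rewrite (@le_trans _ _ ((rnorm S + 1) * (e / (rnorm S + 1))))//.
  by apply: ler_pM; rewrite ?rnorm_ge0// lerDl.
by rewrite mulrC divfK ?gt_eqF.
Qed.

Lemma rnorm_adjoint T : rnorm (adjoint T) <= rnorm T.
Proof.
apply: rnorm_bop_le => [|x]; first exact: rnorm_ge0.
apply: rnorm_sqr_le; first by rewrite mulr_ge0 ?rnorm_ge0.
rewrite -rdotxx /rdot -adjointP (le_trans (ler_norm _))//.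
rewrite (le_trans (rdot_le _ _))// mulrAC ler_wpM2r ?rnorm_ge0//.
exact: rnorm_bop.
Qed.

Lemma adjointN T : adjoint (- T) = - adjoint T.
Proof. by rewrite -scaleN1r adjointZ rmorphN rmorph1 scaleN1r. Qed.

Lemma compact_adjoint T : compact_op T -> compact_op (adjoint T).
Proof.
move=> cT e /cT[n [K Kn TK]]; exists n, (adjoint K); first exact: rank_le_adjoint.
by rewrite -adjointN -adjointD (le_trans (rnorm_adjoint _)).
Qed.

(* A subspace on which finitely many functionals have no common zero has a finite
   Parseval frame; no orthogonal projection theorem is needed. *)
Lemma finite_frame (bs : seq H) (S : set H) :
  (forall a x y, S x -> S y -> S (a *: x + y)) ->
  (forall x, S x -> (forall b, b \in bs -> inner x b = 0) -> x = 0) ->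
  exists2 zs : seq H, (forall z, z \in zs -> S z) &
    forall x, S x -> \sum_(z <- zs) inner x z *: z = x.
Proof.
elim: bs S => [|b bs IH] S Slin Sb.
  by exists [::] => // x /Sb ->//; rewrite big_nil.
have [[z0 [Sz0 z00 z0b]]|noz] :=
    pselect (exists z, [/\ S z, z != 0 & forall b, b \in bs -> inner z b = 0]); last first.
  apply: IH => // x Sx xb; apply/eqP/negPn/negP => x0; apply: noz.
  by exists x.
have S0 : S 0 by have := Slin (-1) _ _ Sz0 Sz0; rewrite scaleN1r addNr.
have [z z1 zE] := unit_multiple z00.
have rz0 : rnorm z0 != 0 by rewrite rnorm_eq0.
have Ez : z = rc (rnorm z0)^-1 *: z0.
  by rewrite {2}zE scalerA -rmorphM mulVf// rmorph1 scale1r.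
have Sz : S z by rewrite Ez -[_ *: _]addr0; exact: Slin.
have zb b' : b' \in bs -> inner z b' = 0 by move=> /z0b h; rewrite Ez innerZ h mulr0.
have zbn : inner z b != 0.
  apply/eqP => zb0; have : z = 0.
    by apply: Sb => // b'; rewrite inE => /orP[/eqP ->//|/zb].
  by move=> z0'; move: z1; rewrite z0' rnorm0 => /eqP; rewrite eq_sym oner_eq0.
(* The orthogonal complement of [z] in [S]. A vector of it killed by the remaining [bs] can be
   corrected by a multiple of [z] so that [b] kills it too; hence it is a multiple of [z] and
   orthogonal to [z]. *)
pose S' := [set x | S x /\ inner x z = 0].
have [||zs zsS zsP] := IH S'.
- move=> a x y [Sx xz] [Sy yz]; split; first exact: Slin.
  by rewrite innerD innerZ xz yz mulr0 addr0.
- move=> x [Sx xz] xb.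
  have : x - (inner x b / inner z b) *: z = 0.
    apply: Sb; first by rewrite -scaleNr addrC; exact: Slin.
    move=> b'; rewrite inE innerD innerNl innerZ => /orP[/eqP ->|b'bs].
      by rewrite divfK// subrr.
    by rewrite xb// (zb b')// mulr0 subr0.
  move/eqP; rewrite subr_eq0 => /eqP xE; move: xz; rewrite {1}xE innerZ innerxx z1.
  by rewrite expr1n rmorph1 mulr1 => c0; rewrite xE c0 scale0r.
exists (z :: zs) => [w|x Sx]; first by rewrite inE => /orP[/eqP ->//|/zsS[]].
have Sx' : S' (x - inner x z *: z).
  split; first by rewrite -scaleNr addrC; exact: Slin.
  by rewrite innerD innerNl innerZ innerxx z1 expr1n rmorph1 mulr1 subrr.
rewrite big_cons -[RHS](subrKC (inner x z *: z)); congr (_ + _).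
rewrite -[RHS](zsP _ Sx') big_seq [RHS]big_seq; apply: eq_bigr => w /zsS[_ wz].
by rewrite innerD innerNl innerZ [inner z w]innerC wz conjC0 mulr0 subr0.
Qed.

End finite_rank.

(** * Top eigenspaces of compact operators *)

Section top_eigenspace.
Variables (R : realType) (H : hilbertType R).
Implicit Types (x y z : H) (S T p K v : bop H H) (a : R[i]).

Lemma ultra_rank_le (U : set_system H) n K : UltraFilter U ->
  U [set x | rnorm x <= 1] -> rank_le n K ->
  forall e : R, 0 < e -> exists2 S, U S &
    forall x y, S x -> S y -> rnorm (K x - K y) <= e.
Proof.
move=> UU U1 [s _ ->]; elim: s => [|[u w] s IH] e e0.
  exists setT => [|x y _ _]; first exact: filterT.
  by rewrite big_nil !bop0E subr0 rnorm0 ltW.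
have e20 : 0 < e / 2 by lra.
have [S US SP] := IH _ e20.
have w0 : 0 < rnorm u + 1 by rewrite ltr_wpDl ?rnorm_ge0.
have Ub : U [set x | rnorm (inner x w : R[i]^o) <= rnorm w].
  apply: filterS U1 => x /= x1; rewrite (le_trans (rnorm_inner _ _))//.
  by rewrite ler_piMl ?rnorm_ge0.
have [S' US' SP'] := ultra_small_oscillationC UU Ub (divr_gt0 e20 w0).
exists (S `&` S') => [|x y [Sx Sx'] [Sy Sy']]; first exact: filterI.
rewrite big_cons !bopDE !rank1E opprD addrACA -scalerBl/=.
rewrite (le_trans (rnormD _ _))// [e]splitr lerD ?SP// rnormZ.
rewrite (@le_trans _ _ (e / 2 / (rnorm u + 1) * (rnorm u + 1)))//.
  by apply: ler_pM; rewrite ?rnorm_ge0 ?SP'// lerDl.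
by rewrite divfK ?gt_eqF.
Qed.

Lemma almost_norming v (t : R) : 0 <= t -> t < rnorm v ->
  exists2 x, rnorm x = 1 & t < rnorm (v x).
Proof.
move=> t0 tv; apply: contrapT => /forallPNP H1; move: tv; apply/negP; rewrite -leNgt.
apply: rnorm_bop_le => // x.
have [->|x0] := eqVneq x 0; first by rewrite linear0 rnorm0 mulr0.
have [u u1 ->] := unit_multiple x0.
rewrite linearZ/= !rnormZ u1 mulr1 mulrC ler_wpM2r ?rnorm_ge0//.
by rewrite leNgt; apply/negP; exact: H1.
Qed.

(* Unit vectors x with |v x| close to |v| are approximate eigenvectors of v^* v,
   and compactness makes them converge along an ultrafilter. *)
Lemma top_eigenvector v : v != 0 -> compact_op v ->
  exists2 x, x != 0 & adjoint v (v x) = rc (rnorm v ^+ 2) *: x.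
Proof.
move=> v0 cv; pose n := rnorm v; have n0 : 0 < n by rewrite rnorm_gt0.
pose C := adjoint v ** v; pose l := n ^+ 2; have l0 : 0 < l by rewrite exprn_gt0.
have Cx x : rnorm x = 1 -> rnorm (C x - rc l *: x) ^+ 2 <= l * (l - rnorm (v x) ^+ 2).
  move=> x1; rewrite -rdotxx rdotBl !rdotBr !rdotZl !rdotZr (rdotC x) !rdotxx x1.
  have -> : rdot (C x) x = rnorm (v x) ^+ 2.
    by rewrite rdotC /rdot bop_compE -adjointP -/(rdot _ _) rdotxx.
  have : rnorm (C x) ^+ 2 <= l * rnorm (v x) ^+ 2.
    rewrite -exprMn ler_sqr ?nnegrE ?mulr_ge0 ?rnorm_ge0//.
    by rewrite (le_trans (rnorm_bop (adjoint v) (v x)))// ler_wpM2r ?rnorm_ge0// rnorm_adjoint.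
  nra.
pose F e := [set x | rnorm x = 1 /\ rnorm (C x - rc l *: x) <= e].
have F0 e : 0 < e -> F e !=set0.
  (* [d] solves [n ^+ 2 * d * (2 * n) = e ^+ 2], which is what [Cx] yields once [rnorm (v x)]
     exceeds [n - d]. The maximum with 0 makes [t] admissible for [almost_norming]. *)
  move=> e0; pose d := e ^+ 2 / (2 * n ^+ 3).
  have d0 : 0 < d by rewrite divr_gt0 ?exprn_gt0// mulr_gt0// exprn_gt0.
  pose t := Num.max 0 (n - d).
  have t0 : 0 <= t by rewrite le_max lexx.
  have tn : t < n by rewrite gt_max n0/= ltrBlDr ltrDl.
  have nt : n - t <= d by rewrite lerBlDr -lerBlDl le_max lexx orbT.
  have [x x1 xt] := almost_norming t0 tn; exists x; split => //.
  rewrite -ler_sqr ?nnegrE ?rnorm_ge0 ?(ltW e0)// (le_trans (Cx x x1))//.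
  have xt2 : t ^+ 2 <= rnorm (v x) ^+ 2 by rewrite ler_sqr ?nnegrE ?rnorm_ge0// ltW.
  have -> : e ^+ 2 = d * (2 * n ^+ 3).
    by rewrite /d divfK// mulf_neq0// ?expf_neq0 ?gt_eqF.
  rewrite (@le_trans _ _ (l * (l - t ^+ 2)))// ?ler_wpM2l ?lerB ?(ltW l0)//.
  have -> : l * (l - t ^+ 2) = (n - t) * (n ^+ 2 * (n + t)) by rewrite /l; ring.
  have -> : d * (2 * n ^+ 3) = d * (n ^+ 2 * (2 * n)) by ring.
  apply: ler_pM; rewrite ?subr_ge0 ?(ltW tn)// ?mulr_ge0 ?sqr_ge0 ?addr_ge0 ?(ltW n0)//.
  by rewrite ler_wpM2l ?sqr_ge0//; lra.
pose FF := filter_from [set e : R | 0 < e] F.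
have PF : ProperFilter FF.
  apply: filter_from_proper => //; apply: filter_from_filter; first by exists 1 => /=.
  move=> e1 e2 /= e10 e20; exists (Num.min e1 e2); first by rewrite /= lt_min e10.
  by move=> x [x1]; rewrite le_min => /andP[? ?]; split.
have [U [UU FU]] := ultraFilterLemma PF.
have UF e : 0 < e -> U (F e) by move=> e0; apply: FU; exists e.
have U1 : U [set x | rnorm x <= 1].
  by apply: filterS (UF _ ltr01) => x [/= -> _].
have cC : compact_op C by exact: compact_compl.
have small e : 0 < e -> exists2 S, U S & forall x y, S x -> S y -> rnorm (x - y) <= e.
  (* The path from [l x] to [l y] passes through [C x], [K x], [K y] and [C y]: five differences of
     size at most [d]. *)
  move=> e0; pose d := e * l / 5.
  have d0 : 0 < d by rewrite !mulr_gt0.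
  have [m [K Km CK]] := cC d d0.
  have [S US SP] := ultra_rank_le UU U1 Km d0.
  exists (S `&` F d) => [|x y [Sx [x1 Fx]] [Sy [y1 Fy]]]; first by apply: filterI => //; exact: UF.
  have CKx z : rnorm z = 1 -> rnorm (C z - K z) <= d.
    by move=> z1; rewrite -bopBE (le_trans (rnorm_bop _ _))// z1 mulr1.
  rewrite -(ler_pM2r l0) mulrC.
  have -> : l * rnorm (x - y) = rnorm (rc l *: x - rc l *: y).
    by rewrite -scalerBr rnormZ rnorm_rc gtr0_norm.
  rewrite (le_trans (rnorm_distD (C x) _ _))// (le_trans (lerD (lexx _) (rnorm_distD (K x) _ _)))//.
  rewrite (le_trans (lerD (lexx _) (lerD (lexx _) (rnorm_distD (K y) _ _))))//.
  rewrite (le_trans (lerD (lexx _) (lerD (lexx _) (lerD (lexx _) (rnorm_distD (C y) _ _)))))//.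
  have h1 := CKx x x1; have h2 := CKx y y1; have h3 := SP x y Sx Sy.
  rewrite rnorm_distC (rnorm_distC (K y)).
  move: Fx Fy h1 h2 h3; rewrite /d; lra.
have cauU : cauchy U.
  apply: cauchy_exP => e e0.
  have /complex_realP[r re] : e \is Num.real by rewrite ger0_real// ltW.
  have r0 : 0 < r by rewrite -ltcR -re.
  have r20 : 0 < r / 2 by lra.
  have [S US SP] := small _ r20; have [x Sx] := filter_ex US; exists x.
  apply: filterS US => y Sy; rewrite -ball_normE /= -rnormE re ltcR.
  by rewrite (le_lt_trans (SP x y Sx Sy))//; lra.
have [z Uz] : exists z : H, U --> z by apply/cvg_ex; exact: (@cauchy_cvg H U).
have near e : 0 < e -> exists2 x, F e x & rnorm (z - x) < e.
  move=> e0; have h : U [set x | rnorm (z - x) < e].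
    by apply: (@cvg_rnormP _ _ _ U _ id z).1 Uz _ e0.
  by have [x [Fx zx]] := filter_ex (filterI (UF _ e0) h); exists x.
exists z.
  apply/eqP => z0; have h : (0 : R) < 1 / 2 by lra.
  by have [x [x1 _]] := near _ h; rewrite z0 sub0r rnormN x1; lra.
apply: rnorm_eq_le => e e0; pose B := l + l + 1.
have B0 : 0 < B by rewrite /B; lra.
have [x [x1 Fx] zx] := near _ (divr_gt0 e0 B0).
rewrite -[adjoint v (v z)]/(C z) (le_trans (rnorm_distD (C x) _ _))//.
rewrite (le_trans (lerD (lexx _) (rnorm_distD (rc l *: x) _ _)))//.
have h1 : rnorm (C z - C x) <= l * rnorm (z - x).
  rewrite -linearB (le_trans (rnorm_bop _ _))// ler_wpM2r ?rnorm_ge0//.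
  by rewrite (le_trans (rnorm_comp _ _))// /l expr2 ler_wpM2r ?rnorm_ge0// rnorm_adjoint.
have h2 : rnorm (rc l *: x - rc l *: z) = l * rnorm (z - x).
  by rewrite -scalerBr rnormZ rnorm_rc gtr0_norm// rnorm_distC.
rewrite [in X in _ <= X](_ : e = B * (e / B)); last by rewrite mulrC divfK ?gt_eqF.
have h3 : l * rnorm (z - x) <= l * (e / B) by rewrite ler_wpM2l ?ltW.
by rewrite h2; move: Fx h1 h3; rewrite /B; lra.
Qed.

(** On the eigenspace [adjoint v ** v] is multiplication by [l], so a finite rank [K] within [l / 2]
    of it is injective there, and the functionals of [K] feed [finite_frame]. The last clause says
    that [p] is the largest projection of this kind, which will make it invariant. *)
Lemma top_eigenprojection v : v != 0 -> compact_op v ->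
  exists n p, [/\ is_proj p, p != 0, rank_le n p,
    adjoint v ** v ** p = rc (rnorm v ^+ 2) *: p
  & forall T, adjoint v ** v ** T = rc (rnorm v ^+ 2) *: T -> p ** T = T].
Proof.
move=> v0 cv; pose l := rnorm v ^+ 2; have l0 : 0 < l by rewrite exprn_gt0// rnorm_gt0.
pose S := [set x | adjoint v (v x) = rc l *: x].
have Slin a x y : S x -> S y -> S (a *: x + y).
  by rewrite /S/= => xS yS; rewrite !linearP/= xS yS.
have l20 : 0 < l / 2 by lra.
have [m [K [s _ KE] CK]] := compact_compl (adjoint v) cv l20.
have [|zs zsS zsP] := finite_frame (bs := [seq u.2 | u <- s]) Slin.
  move=> x Sx xs; have Kx : K x = 0.
    rewrite KE bop_sumE big1_seq// => u /andP[_ us].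
    by rewrite rank1E xs ?scale0r//; apply/mapP; exists u.
  apply: rnorm_le0; have : rnorm (rc l *: x) <= l / 2 * rnorm x.
    rewrite -Sx -[adjoint v (v x)](subr0) -Kx -[adjoint v (v x)]/((adjoint v ** v) x).
    by rewrite -bopBE (le_trans (rnorm_bop _ _))// ler_wpM2r ?rnorm_ge0.
  by rewrite rnormZ rnorm_rc gtr0_norm//; nra.
pose p := \sum_(z <- zs) rank1 z z.
have pE x : p x = \sum_(z <- zs) inner x z *: z by rewrite bop_sumE.
have S0 : S 0 by rewrite /S/= !linear0.
have pS x : S (p x).
  rewrite pE big_seq; elim/big_rec: _ => // z y zzs Sy.
  by apply: Slin => //; exact: zsS.
have pid x : S x -> p x = x by rewrite pE; exact: zsP.
exists (size zs), p; split.
- split; first by apply: bop_eqP => x; rewrite bop_compE pid.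
  by rewrite adjoint_sum; apply: eq_bigr => z _; rewrite adjoint_rank1.
- have [x x0 /pid px] := top_eigenvector v0 cv; apply/eqP => p0.
  by move: x0; rewrite -px p0 bop0E eqxx.
- by exists [seq (z, z) | z <- zs]; rewrite ?size_map// big_map.
- by apply: bop_eqP => x; rewrite !bop_compE bopZE; exact: pS.
- move=> T /(congr1 (fun T : bop H H => bop_fun T)) CT; apply: bop_eqP => x.
  by rewrite bop_compE pid//; have := congr1 (fun f => f x) CT.
Qed.

End top_eigenspace.

(** * Minimal fixed projections *)

Section fixed_projections.
Variables (R : realType) (G : compactGroupType) (H : hilbertType R).
Variable act : G -> bop H H -> bop H H.
Hypothesis hact : continuous_star_action act.
Implicit Types (x y z : H) (S T p q r v w e : bop H H) (a : R[i]) (g h : G).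

Local Notation fixed := (fixed act).

Lemma fixed_top_eigenprojection v : fixed v -> v != 0 -> compact_op v ->
  exists n p, [/\ is_proj p, p != 0, fixed p, rank_le n p
  & adjoint v ** v ** p = rc (rnorm v ^+ 2) *: p].
Proof.
move=> fv v0 cv; have [n [p [pP p0 pn Cp pmax]]] := top_eigenprojection v0 cv.
exists n, p; split=> //.
have fC g : act g (adjoint v ** v) = adjoint v ** v.
  by rewrite (act_comp hact) (act_adjoint hact) fv.
(* [act g p] has its range in the same eigenspace, hence lies below [p]. The same for the inverse of
   [g], transported by [act g], gives the opposite relation. *)
have pg g : p ** act g p = act g p.
  by apply: pmax; rewrite -{1}(fC g) -(act_comp hact) Cp (actZ hact).
move=> g; have gp : act g p ** p = p.
  by have := congr1 (act g) (pg g^-1%g); rewrite (act_comp hact) !(actVK hact).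
have := congr1 (@adjoint _ _) gp.
by rewrite adjoint_comp -(act_adjoint hact) pP.2 pg.
Qed.

Lemma fixed_mulV_eigen v p (l : R) : l != 0 ->
  adjoint v ** v ** p = rc l *: p -> p = rc l^-1 *: (adjoint v ** v ** p).
Proof. by move=> l0 ->; rewrite scalerA -rmorphM mulVf// rmorph1 scale1r. Qed.

Definition minimal_proj p := [/\ is_proj p, p != 0, fixed p, exists n, rank_le n p
  & forall q, is_proj q -> q != 0 -> fixed q -> p ** q = q -> q = p].

Lemma proj_comp_sym p q : is_proj p -> is_proj q -> p ** q = q -> q ** p = q.
Proof. by move=> [_ pa] [_ qa] /(congr1 (@adjoint _ _)); rewrite adjoint_comp pa qa. Qed.

(** A vector [z] in the range of [p - q] is killed by [q = q ** p]. This is a linear relation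
    between the vectors [q u.1]; one of them has the non-zero coefficient [inner z u.2] and can be
    eliminated from the sum that represents [q]. *)
Lemma rank_le_subproj n p q : is_proj p -> is_proj q -> p ** q = q -> q != p ->
  rank_le n p -> exists2 m, n = m.+1 & rank_le m q.
Proof.
move=> pP qP pq qp [s sn pE].
have qpq := proj_comp_sym pP qP pq.
have [w pw] : exists w : H, (p - q) w != 0.
  apply: contrapT => /forallNP w0; case/eqP: qp; apply/esym/eqP; rewrite -subr_eq0.
  by apply/eqP/bop_eqP => w; apply/eqP/negPn/negP/w0.
pose z := (p - q) w.
have pz : p z = z by rewrite /z -bop_compE bop_compDr bop_compNr pP.1 pq.
have qz : q z = 0 by rewrite /z -bop_compE bop_compDr bop_compNr qP.1 qpq subrr.
have [u us zu] : exists2 u, u \in s & inner z u.2 != 0.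
  apply: contrapT => /forallPNP zs; case/eqP: pw; rewrite -/z -pz pE bop_sumE.
  rewrite big1_seq// => u /andP[_ us]; rewrite rank1E.
  by have /negP/negPn/eqP-> := zs u us; rewrite scale0r.
have qE x : q x = inner x u.2 *: q u.1 + \sum_(t <- rem u s) inner x t.2 *: q t.1.
  rewrite -[in LHS]qpq bop_compE pE bop_sumE linear_sum (big_rem u)// rank1E linearZ/=.
  by congr (_ + _); apply: eq_bigr => t _; rewrite linearZ.
have := sn; case: n sn => [|m] sn; first by move: us sn; case: (s).
move=> sm; exists m => //; 
exists [seq (q t.1, t.2 - (inner z t.2 / inner z u.2)^* *: u.2) | t <- rem u s].
  by rewrite size_map size_rem// -ltnS prednK//; case: (s) us.
rewrite big_map; apply: bop_eqP => x; rewrite bop_sumE qE.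
have qu : q u.1 = - \sum_(t <- rem u s) (inner z t.2 / inner z u.2) *: q t.1.
  have /eqP := qE z; rewrite qz eq_sym addr_eq0 => /eqP E.
  apply: (scalerI zu); rewrite E scalerN scaler_sumr; congr (- _).
  by apply: eq_bigr => t _; rewrite scalerA mulrCA divff// mulr1.
rewrite qu scalerN scaler_sumr -sumrN -big_split/=; apply: eq_bigr => t _.
rewrite innerDr innerNr innerZr conjCK scalerBl addrC; congr (_ - _).
by rewrite scalerA mulrC.
Qed.

Lemma minimal_below n r : is_proj r -> r != 0 -> fixed r -> rank_le n r ->
  exists2 q, minimal_proj q & r ** q = q.
Proof.
elim: n r => [|n IH] r rP r0 fr rn.
  case: rn r0 => -[|//] _ ->; by rewrite big_nil eqxx.
have [rmin|] := pselect (minimal_proj r); first by exists r; rewrite ?rP.1.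
move=> nmin.
have [q [qP q0 fq rq qr]] : exists q, [/\ is_proj q, q != 0, fixed q, r ** q = q & q != r].
  apply: contrapT => noq; apply: nmin; split=> //; first by exists n.+1.
  by move=> q qP q0 fq rq; apply/eqP/negPn/negP => qr; apply: noq; exists q.
have [m [<-] qm] := rank_le_subproj rP qP rq qr rn.
have [q' q'm qq'] := IH _ qP q0 fq qm; exists q' => //.
by rewrite -qq' bop_compA rq.
Qed.

Lemma mean_rank1_compact u e : rnorm u = 1 ->
  (forall s : R, 0 < s -> exists2 L, L != [::] &
      rnorm (\sum_(k <- L) act k (rank1 u u) - e *+ size L) <= s * (size L)%:R) ->
  compact_op e.
Proof.
move=> u1 eP s s0; have [L L0 LP] := eP s s0; have sL := size_gt0R R L0.
exists (size L), (rc (size L)%:R^-1 *: \sum_(k <- L) act k (rank1 u u)).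
  apply: rank_leZ; elim: (L) => [|k t IH]; first by rewrite big_nil; exact: rank_le0.
  have [z _ zE] := act_rank1 hact k u1.
  rewrite big_cons zE -[size _]/(1 + size t)%N.
  by apply: rank_leD IH; exact: rank_le_rank1.
rewrite -(ler_pM2l sL) -rnormMn mulrnBl rnorm_distC [leRHS]mulrC.
rewrite -(scaler_nat _ (_ *: _)) scalerA fmorphV rmorph_nat mulfV ?scale1r//.
by rewrite pnatr_eq0 size_eq0.
Qed.

(* g |-> <al_g(P) u, u> is non-negative and bounded below near the identity,
   so that its mean is positive. *)
Lemma mean_rank1_neq0 u e : rnorm u = 1 ->
  (forall v : H, is_mean (fun g => act g (rank1 u u) v) (e v)) -> e != 0.
Proof.
move=> u1 eP; pose P := rank1 u u; pose f g := rdot (act g P u) u.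
have cf : continuous f.
  by apply: continuous_rdot; [exact: act_continuous_at|exact: cst_continuous].
have fE : rmean f = rdot (e u) u by apply: (rmean_rdot u1) => //; exact: eP.
have f0 g : 0 <= f g.
  rewrite /f /rdot proj_inner; last exact/(act_proj hact)/rank1_proj.
  by rewrite -/(rdot _ _) rdotxx sqr_ge0.
have h2 : (0 : R) < 1 / 2 by lra.
have [K K0 KP] := continuous_unif_net (act_continuous hact (T := P)) h2.
have h : 1 / 2 <= rmean f * (size K)%:R.
  apply: (rmean_cover u1) => // g.
  have [k kK kP] := KP g; exists k => //.
  have := kP 1%g k^-1%g; rewrite !mul1g mulgV (act1 hact) => gk.
  have fP : f 1%g = 1.
    by rewrite /f (act1 hact) rank1E innerxx u1 expr1n rmorph1 scale1r rdotxx u1 expr1n.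
  have : `|rdot ((act (g * k^-1)%g P - P) u) u| <= 1 / 2.
    rewrite (le_trans (rdot_le _ _))// u1 mulr1 (le_trans (rnorm_bop _ _))// u1 mulr1//.
  rewrite bopBE rdotBl ler_norml => /andP[+ _].
  by move: fP; rewrite /f (act1 hact) => ->; rewrite -/(f _); lra.
apply/eqP => e0; move: h; rewrite fE.
by rewrite e0 bop0E /rdot inner0l mul0r; lra.
Qed.

(** The average [e] of [rank1 u u] would be annihilated by all minimal projections, because these
    are fixed and kill [u]. But [e] is non-zero, compact and fixed, and an eigenprojection obtained
    from it contains a minimal projection. *)
Lemma minimal_total x : (forall p, minimal_proj p -> p x = 0) -> x = 0.
Proof.
move=> px; apply/eqP/negPn/negP => x0; have [u u1 xu] := unit_multiple x0.
have pu p : minimal_proj p -> p u = 0.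
  move=> /px; rewrite xu linearZ/= => /eqP; rewrite scaler_eq0.
  by rewrite fmorph_eq0 rnorm_eq0 (negPf x0) => /eqP.
have [e [fe eP eL]] := mean_operator hact (rank1 u u).
have e0 : e != 0 by exact: mean_rank1_neq0 eP.
have ce : compact_op e by exact: mean_rank1_compact eL.
have pe p : minimal_proj p -> p ** e = 0.
  move=> pm; rewrite -[p ** e]bop_comp1; apply: (mean_sandwich eP) => g.
  case: (pm) => _ _ fp _ _.
  rewrite bop_comp1 -{1}(fp g) -(act_comp hact) comp_rank1 pu//.
  by rewrite -[0](scale0r u) rank1Zl scale0r (act0 hact).
(* The adjoint is taken so that [r] belongs to [e ** adjoint e], whose left factor [e] is killed by
   [q]. *)
have v0 : adjoint e != 0.
  by apply: contra e0 => /eqP e0; rewrite -[e]adjointK e0 adjoint0.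
have [n [r [rP r0 fr rn rE]]] :=
  fixed_top_eigenprojection (fixed_adjoint hact fe) v0 (compact_adjoint ce).
have [q qm rq] := minimal_below rP r0 fr rn.
have [qP q0 _ _ _] := qm.
have qr : q ** r = 0.
  have l0 : rnorm (adjoint e) ^+ 2 != 0 by rewrite expf_eq0/= rnorm_eq0.
  rewrite (fixed_mulV_eigen l0 rE) bop_compZr !bop_compA adjointK (pe _ qm).
  by rewrite !bop_comp0l scaler0.
by case/eqP: q0; rewrite -(proj_comp_sym rP qP rq).
Qed.

Definition disjoint_proj p q := forall w, fixed w -> p ** w ** q = 0.

Lemma disjoint_proj_sym p q : is_proj p -> is_proj q ->
  disjoint_proj p q -> disjoint_proj q p.
Proof.
move=> [_ pa] [_ qa] pq w fw.
have := congr1 (@adjoint _ _) (pq _ (fixed_adjoint hact fw)).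
by rewrite !adjoint_comp adjointK pa qa adjoint0 bop_compA.
Qed.

(** Schur's lemma for minimal projections: the top eigenprojection of [adjoint v ** v], where
    [v = p ** w ** q], is fixed and below [q], hence equal to [q]. So [v] is a multiple of a partial
    isometry from the range of [q] into that of [p]. *)
Lemma minimal_intertwiner p q w : fixed p -> minimal_proj q -> fixed w ->
  p ** w ** q != 0 ->
  exists2 l : R, l != 0 & adjoint (p ** w ** q) ** (p ** w ** q) = rc l *: q.
Proof.
move=> fp [qP q0 fq [n qn] qmin] fw v0; set v := p ** w ** q in v0 *.
have cv : compact_op v by apply: rank_le_compact; exact: rank_le_compl qn.
have fv : fixed v by exact: (fixed_comp hact (fixed_comp hact fp fw) fq).
have [m [s [sP s0 fs _ sE]]] := fixed_top_eigenprojection fv v0 cv.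
have l0 : rnorm v ^+ 2 != 0 by rewrite expf_eq0/= rnorm_eq0.
have vq : v ** q = v by rewrite /v -bop_compA qP.1.
have qv : q ** adjoint v = adjoint v by rewrite -[in RHS]vq adjoint_comp qP.2.
have qs : q ** s = s by rewrite (fixed_mulV_eigen l0 sE) bop_compZr !bop_compA qv.
exists (rnorm v ^+ 2) => //; rewrite -(qmin _ sP s0 fs qs) -sE.
by rewrite (qmin _ sP s0 fs qs) -bop_compA vq.
Qed.

End fixed_projections.

(** * Finitely many disjoint fixed projections *)

Lemma dependent_sequence (X : Type) (P : seq X -> X -> Prop) :
  (forall s, exists x, P s x) -> exists b : nat -> X, forall n, P (mkseq b n) (b n).
Proof.
move=> /choice[F FP].
pose build := fix build n := if n is m.+1 then rcons (build m) (F (build m)) else [::].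
exists (fun n => F (build n)) => n.
suff -> : mkseq (fun n => F (build n)) n = build n by exact: FP.
by elim: n => // n IH; rewrite mkseqS IH.
Qed.

Lemma nondecreasing_bounded_cauchy (R : realType) (u : nat -> R) (B : R) :
  (forall n, u n <= u n.+1) -> (forall n, u n <= B) ->
  forall e, 0 < e -> exists N, forall m n, (N <= m)%N -> (N <= n)%N -> `|u n - u m| <= e.
Proof.
move=> /nondecreasing_seqP u_nd uB e e0; have e20 : 0 < e / 2 by lra.
have /cvg_ex[l ul] : cvg (u @ \oo).
  apply: nondecreasing_is_cvgn => //; exists B => _ [n _ <-]; exact: uB.
have /cvgrPdist_le/(_ _ e20)[N _ NP] := ul.
exists N => m n mN nN; rewrite (le_trans (ler_distD l _ _))// [e]splitr.
by apply: lerD; [rewrite distrC|]; exact: NP.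
Qed.

Section partial_isometry.
Variables (R : realType) (H : hilbertType R).
Implicit Types (x y : nat -> H) (z w : H).

Definition orthonormal_seq x :=
  (forall n, rnorm (x n) = 1) /\ (forall m n, m != n -> inner (x m) (x n) = 0).

Lemma rnorm_sqr_sum x (c : nat -> R[i]) m n : orthonormal_seq x ->
  rnorm (\sum_(m <= k < n) c k *: x k) ^+ 2 =
  \sum_(m <= k < n) rnorm (c k : R[i]^o) ^+ 2.
Proof.
move=> [x1 xo]; have [nm|mn] := leqP n m; first by rewrite !big_geq// rnorm0 expr0n.
rewrite -(subnKC (ltnW mn)); elim: (n - m)%N => [|d IH].
  by rewrite addn0 !big_geq// rnorm0 expr0n.
rewrite addnS !big_nat_recr ?leq_addr//= -IH -!rdotxx rdotDl !rdotDr.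
have h0 : rdot (\sum_(m <= k < m + d) c k *: x k) (c (m + d)%N *: x (m + d)%N) = 0.
  rewrite /rdot inner_suml big_nat_cond big1 ?raddf0// => k /andP[/andP[_ kmd] _].
  by rewrite innerZ innerZr xo ?mulr0// neq_ltn kmd.
by rewrite (rdotC (c _ *: _) (\sum_(_ <= _ < _) _)) h0 addr0 add0r !rdotxx rnormZ x1 mulr1.
Qed.

Lemma Re_mul_conj (a : R[i]) : complex.Re (a * a^*) = rnorm (a : R[i]^o) ^+ 2.
Proof. by apply: (@complexI R); rewrite rmorphXn/= rnormE -normCK RRe_real ?rpredX ?normr_real. Qed.

Lemma bessel y z n : orthonormal_seq y ->
  \sum_(0 <= k < n) rnorm (inner z (y k) : R[i]^o) ^+ 2 <= rnorm z ^+ 2.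
Proof.
move=> yo; pose S := \sum_(0 <= k < n) inner z (y k) *: y k.
have SE := rnorm_sqr_sum (fun k => inner z (y k)) 0 n yo.
have zS : rdot z S = \sum_(0 <= k < n) rnorm (inner z (y k) : R[i]^o) ^+ 2.
  rewrite /rdot inner_sumr raddf_sum/=; apply: eq_bigr => k _.
  by rewrite innerZr mulrC Re_mul_conj.
have := sqr_ge0 (rnorm (z - S)).
rewrite -[rnorm (z - S) ^+ 2]rdotxx rdotBl !rdotBr (rdotC S) zS !rdotxx SE; lra.
Qed.

(* T = \sum_k |x k><y k|, tested on vectors that see a single term of the sum. *)
Lemma partial_isometry x y : orthonormal_seq x -> orthonormal_seq y ->
  exists T : bop H H, forall k z w, (forall l, l != k -> inner (x l) w = 0) ->
    inner (T z) w = inner z (y k) * inner (x k) w.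
Proof.
move=> xo yo.
pose S z n := \sum_(0 <= k < n) inner z (y k) *: x k.
pose a z n := \sum_(0 <= k < n) rnorm (inner z (y k) : R[i]^o) ^+ 2.
have SS z n : rnorm (S z n) <= rnorm z.
  by rewrite -ler_sqr ?nnegrE ?rnorm_ge0// rnorm_sqr_sum// bessel.
have lim z : exists t, forall e, 0 < e -> exists N, forall n, (N <= n)%N -> rnorm (t - S z n) <= e.
  have cS : cauchy (S z @ \oo).
    apply: cauchy_exP => e e0.
    have /complex_realP[r re] : e \is Num.real by rewrite ger0_real// ltW.
    have r0 : 0 < r by rewrite -ltcR -re.
    have r20 : 0 < r / 2 by lra.
    have [||N NP] := @nondecreasing_bounded_cauchy _ (a z) (rnorm z ^+ 2) _ _ _ (exprn_gt0 2 r20).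
    - by move=> n; rewrite /a big_nat_recr//= lerDl sqr_ge0.
    - by move=> n; exact: bessel.
    exists (S z N), N => // n /= Nn; rewrite -ball_normE /= -rnormE re ltcR rnorm_distC.
    apply: (@le_lt_trans _ _ (r / 2)); last by lra.
    rewrite -ler_sqr ?nnegrE ?rnorm_ge0 ?(ltW r20)//.
    have -> : S z n - S z N = \sum_(N <= k < n) inner z (y k) *: x k.
      by apply/eqP; rewrite subr_eq addrC /S -big_cat_nat.
    rewrite rnorm_sqr_sum//; have := NP N n (leqnn N) Nn.
    have -> : a z n - a z N = \sum_(N <= k < n) rnorm (inner z (y k) : R[i]^o) ^+ 2.
      by apply/eqP; rewrite subr_eq addrC /a -big_cat_nat.
    exact: le_trans (ler_norm _).
  have [t tP] : exists t : H, S z @ \oo --> t by apply/cvg_ex; exact: (@cauchy_cvg H _).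
  exists t => e e0; have /cvg_rnormP/(_ _ e0)[N _ NP] := tP.
  by exists N => n Nn; apply/ltW/NP.
have /choice[T0 T0P] := lim.
have limit_uniq (u v : H) (s : nat -> H) :
    (forall e, 0 < e -> exists N, forall n, (N <= n)%N -> rnorm (u - s n) <= e) ->
    (forall e, 0 < e -> exists N, forall n, (N <= n)%N -> rnorm (v - s n) <= e) -> u = v.
  move=> us vs; apply: rnorm_eq_le => e e0; have e20 : 0 < e / 2 by lra.
  have [N NP] := us _ e20; have [M MP] := vs _ e20.
  rewrite (le_trans (rnorm_distD (s (maxn N M)) _ _))// [e]splitr [X in _ + X]rnorm_distC.
  by rewrite lerD ?NP ?MP ?leq_maxl ?leq_maxr.
have T0lin b u v : T0 (b *: u + v) = b *: T0 u + T0 v.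
  apply: limit_uniq (T0P _) _ => e e0.
  have b0 : 0 < rnorm (b : R[i]^o) + 1 by rewrite ltr_wpDl ?rnorm_ge0.
  have e20 : 0 < e / 2 by lra.
  have [N NP] := T0P u _ (divr_gt0 e20 b0); have [M MP] := T0P v _ e20.
  exists (maxn N M) => n; rewrite geq_max => /andP[Nn Mn].
  have -> : S (b *: u + v) n = b *: S u n + S v n.
    rewrite /S scaler_sumr -big_split/=; apply: eq_bigr => k _.
    by rewrite innerD innerZ scalerDl scalerA.
  rewrite opprD addrACA -scalerBr (le_trans (rnormD _ _))// [e]splitr lerD ?MP// rnormZ.
  rewrite (@le_trans _ _ ((rnorm (b : R[i]^o) + 1) * (e / 2 / (rnorm (b : R[i]^o) + 1))))//.
    by apply: ler_pM; rewrite ?rnorm_ge0 ?NP// lerDl.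
  by rewrite mulrC divfK ?gt_eqF.
have T0B : T0 \in @bop_pred R H H.
  apply: (@bounded_bop _ _ _ _ 1) => // z; rewrite mul1r -!rnormE lecR.
  apply/ler_addgt0Pr => e e0; have [N /(_ N (leqnn N)) NP] := T0P z e e0.
  rewrite -(subrK (S z N) (T0 z)) (le_trans (rnormD _ _))// addrC lerD//.
exists (Bop T0B) => k z w xw; apply/eqP; rewrite -subr_eq0 -(@rnorm_eq0 _ R[i]^o).
rewrite eq_le rnorm_ge0 andbT; apply/ler_addgt0Pr => e e0; rewrite add0r.
have w0 : 0 < rnorm w + 1 by rewrite ltr_wpDl ?rnorm_ge0.
have [N NP] := T0P z _ (divr_gt0 e0 w0).
(* Beyond [k], the partial sum contains the only term that [w] sees. *)
pose n := maxn N k.+1.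
have Sw : inner (S z n) w = inner z (y k) * inner (x k) w.
  rewrite /S inner_suml (bigD1_seq k)/= ?iota_uniq ?mem_index_iota ?leq_maxr//.
  rewrite innerZ big1 ?addr0// => l lk; by rewrite innerZ xw ?mulr0.
rewrite -Sw -[bop_fun _ z]/(T0 z) -innerNl -innerD.
rewrite (le_trans (rnorm_inner _ _))//.
rewrite (@le_trans _ _ ((e / (rnorm w + 1)) * (rnorm w + 1)))//.
  by apply: ler_pM; rewrite ?rnorm_ge0 ?NP ?leq_maxl// lerDl.
by rewrite divfK ?gt_eqF.
Qed.

End partial_isometry.

Lemma rnorm_conj (R : realType) (a : R[i]) : rnorm (a^* : R[i]^o) = rnorm (a : R[i]^o).
Proof. by rewrite /rnorm norm_conjC. Qed.

(** * Bessel's inequality for the mean *)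

Section mean_bessel.
Variables (R : realType) (G : compactGroupType) (H : hilbertType R).
Variables (x0 : H) (x01 : rnorm x0 = 1).
Implicit Types (F : G -> H) (W : nat -> G -> H).

Lemma continuous_scale_rc (c : R) F : continuous F -> continuous (fun g => rc c *: F g).
Proof. by move=> cF g; apply: cvgZr; exact: cF. Qed.

(** [F'] is [F] with its first [n] components subtracted. As the mean square of [W n] is at most 1,
    subtracting [s n] times [W n] lowers the mean square by at least [s n ^+ 2], and mean
    orthogonality leaves the later coefficients unchanged. *)
Lemma mean_bessel W F n : (forall k, continuous (W k)) -> continuous F ->
  (forall k g, rnorm (W k g) <= 1) -> (forall g, rnorm (F g) <= 1) ->
  (forall k l, k != l -> rmean (fun g => rdot (W k g) (W l g)) = 0) ->
  \sum_(0 <= k < n) rmean (fun g => rdot (F g) (W k g)) ^+ 2 <= 1.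
Proof.
move=> cW cF W1 F1 Wo.
pose s k := rmean (fun g => rdot (F g) (W k g)).
suff [F' [cF' F'W F'1]] : exists F', [/\ continuous F',
    forall k, (n <= k)%N -> rmean (fun g => rdot (F' g) (W k g)) = s k &
    rmean (fun g => rdot (F' g) (F' g)) + \sum_(0 <= k < n) s k ^+ 2 <= 1].
  apply: le_trans F'1; rewrite lerDr; apply: (rmean_ge x01) => [|g].
    exact: continuous_rdot.
  by rewrite rdotxx sqr_ge0.
elim: n => [|n [F' [cF' F'W F'1]]].
  exists F; split=> //; rewrite big_geq// addr0.
  apply: (rmean_le x01) => [|g]; first exact: continuous_rdot.
  by rewrite rdotxx expr_le1// rnorm_ge0.
have cs := @continuous_scale_rc (s n) _ (cW n).
have csW k : continuous (fun g => s n * rdot (W n g) (W k g)).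
  by move=> g; apply: cvgMr; exact: continuous_rdot.
exists (fun g => F' g - rc (s n) *: W n g); split.
- by move=> g; apply: cvgB; [exact: cF'|exact: cs].
- move=> k nk; have nk' := ltnW nk.
  under eq_fun do rewrite rdotBl rdotZl.
  rewrite (rmeanB x01) ?(rmeanZ x01)//; try exact: continuous_rdot.
  by rewrite F'W// Wo ?mulr0 ?subr0// neq_ltn nk.
- rewrite big_nat_recr//= addrA; apply: le_trans F'1; rewrite addrAC lerD2r.
  have -> : (fun g => rdot (F' g - rc (s n) *: W n g) (F' g - rc (s n) *: W n g)) =
      (fun g => rdot (F' g) (F' g) - (2 * s n) * rdot (F' g) (W n g)
         + s n ^+ 2 * rdot (W n g) (W n g)).
    apply/funext => g; rewrite rdotBl !rdotBr !rdotZl !rdotZr (rdotC (W n g) (F' g)); ring.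
  have c1 : continuous (fun g => rdot (F' g) (F' g)) by exact: continuous_rdot.
  have c2 : continuous (fun g => 2 * s n * rdot (F' g) (W n g)).
    by move=> g; apply: cvgMr; exact: continuous_rdot.
  have c3 : continuous (fun g => s n ^+ 2 * rdot (W n g) (W n g)).
    by move=> g; apply: cvgMr; exact: continuous_rdot.
  have c4 : continuous (fun g => rdot (F' g) (F' g) - 2 * s n * rdot (F' g) (W n g)).
    by move=> g; apply: cvgB; [exact: c1|exact: c2].
  rewrite (rmeanD x01)// (rmeanB x01)// !(rmeanZ x01)//; try exact: continuous_rdot.
  rewrite F'W//.
  have W1' : rmean (fun g => rdot (W n g) (W n g)) <= 1.
    apply: (rmean_le x01) => [|g]; first exact: continuous_rdot.
    by rewrite rdotxx expr_le1// rnorm_ge0.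
  have := sqr_ge0 (s n); move: W1'; rewrite !expr2; nra.
Qed.

Lemma mean_bessel_cvg W F : (forall k, continuous (W k)) -> continuous F ->
  (forall k g, rnorm (W k g) <= 1) -> (forall g, rnorm (F g) <= 1) ->
  (forall k l, k != l -> rmean (fun g => rdot (W k g) (W l g)) = 0) ->
  forall e, 0 < e ->
  \forall k \near \oo, `|rmean (fun g => rdot (F g) (W k g))| <= e.
Proof.
move=> cW cF W1 F1 Wo e e0.
pose s k := rmean (fun g => rdot (F g) (W k g)).
have [||N NP] := @nondecreasing_bounded_cauchy _ (fun n => \sum_(0 <= k < n) s k ^+ 2) 1
  _ _ _ (exprn_gt0 2 e0).
- by move=> n; rewrite big_nat_recr//= lerDl sqr_ge0.
- by move=> n; exact: mean_bessel.
exists N => // k /= Nk; have := NP k k.+1 Nk (leq_trans Nk (leqnSn k)).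
rewrite big_nat_recr//= [X in `|X|]addrC addKr ger0_norm ?sqr_ge0//.
by rewrite -[s k ^+ 2]real_normK ?num_real// ler_sqr ?nnegrE ?(ltW e0).
Qed.

End mean_bessel.

(** * Contradiction from infinitely many disjoint blocks *)

Section infinitely_many_blocks.
Variables (R : realType) (G : compactGroupType) (H : hilbertType R).
Variable act : G -> bop H H -> bop H H.
Hypothesis hact : continuous_star_action act.
Variable q : nat -> bop H H.
Hypotheses (qP : forall n, is_proj (q n)) (q_neq0 : forall n, q n != 0)
  (q_fixed : forall n, fixed act (q n))
  (q_disjoint : forall m n, m != n -> disjoint_proj act (q m) (q n)).
Implicit Types (x z : H) (S T : bop H H) (g h : G).

Let unit_choice : exists y : nat -> H, forall n, rnorm (y n) = 1 /\ q n (y n) = y n.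
Proof.
have : forall n, exists u, rnorm u = 1 /\ q n u = u.
  by move=> n; have [u u1 qu] := proj_unit (qP n) (q_neq0 n); exists u.
by move=> /choice[y yP]; exists y.
Qed.

Let y := projT1 (cid unit_choice).
Let y1 n : rnorm (y n) = 1. Proof. by case: (projT2 (cid unit_choice) n). Qed.
Let qy n : q n (y n) = y n. Proof. by case: (projT2 (cid unit_choice) n). Qed.

Let qq m n : m != n -> q m ** q n = 0.
Proof. by move=> mn; have := q_disjoint mn (fixed_id hact); rewrite bop_comp1. Qed.

Let y_ortho m n : m != n -> inner (y m) (y n) = 0.
Proof.
move=> mn; rewrite -(qy m) -(qy n) adjointPr (qP n).2 -bop_compE qq 1?eq_sym//.
by rewrite bop0E inner0l.
Qed.

Let x0 := y 0%N.
Let x01 : rnorm x0 = 1 := y1 0%N.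

(* Coefficients of the implementing projective representation are only defined
   up to a phase; w z is an H-valued substitute for g |-> <u_g z, z>. *)
Let w z g := act g (rank1 x0 z) z.

(** If [act g] is conjugation by [u_g], this is <u_g x, x> times the conjugate of <u_g z, z>, which
    does not depend on the phase of [u_g]. *)
Let coeff x z g := inner (act g (rank1 x z) z) x.

Let cw z : continuous (w z). Proof. exact: act_continuous_at. Qed.

Let w_le1 z g : rnorm z = 1 -> rnorm (w z g) <= 1.
Proof.
move=> z1; rewrite (le_trans (rnorm_bop _ _))// z1 mulr1 (rnorm_act hact).
by rewrite (le_trans (rnorm_rank1 _ _))// x01 z1 mulr1.
Qed.

Let inner_w z x g : inner (w z g) (w x g) = coeff x z g.
Proof.
rewrite /w adjointPr -(act_adjoint hact) -bop_compE -(act_comp hact) adjoint_rank1.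
by rewrite rank1_rank1 innerxx x01 expr1n rmorph1 scale1r.
Qed.

(** Schur orthogonality: the mean equals [rdot (e (y m)) (y n)] with [e] the mean of the orbit of
    [rank1 (y n) (y m)]. As [e] is fixed, disjointness gives [q n ** e ** q m = 0]. *)
Let w_ortho m n : m != n -> rmean (fun g => rdot (w (y m) g) (w (y n) g)) = 0.
Proof.
move=> mn; pose T := rank1 (y n) (y m).
have [e [fe eP _]] := mean_operator hact T.
have -> : (fun g => rdot (w (y m) g) (w (y n) g)) = (fun g => rdot (act g T (y m)) (y n)).
  by apply/funext => g; rewrite /rdot inner_w.
rewrite (rmean_rdot x01 _ (eP (y m))); last first.
  by apply: continuous_rdot; [exact: act_continuous_at|exact: cst_continuous].
rewrite -(qy m) -(qy n) /rdot adjointPr (qP n).2 -!bop_compE.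
by rewrite q_disjoint ?bop0E ?inner0l ?raddf0// eq_sym.
Qed.

Let coeff_le1 x z g : rnorm x = 1 -> rnorm z = 1 -> rnorm (coeff x z g : R[i]^o) <= 1.
Proof.
move=> xx z1; rewrite (le_trans (rnorm_inner _ _))// xx mulr1.
rewrite (le_trans (rnorm_bop _ _))// z1 mulr1 (rnorm_act hact).
by rewrite (le_trans (rnorm_rank1 _ _))// xx z1 mulr1.
Qed.

Let continuous_inner (F : G -> H) x : continuous F ->
  continuous (fun g => inner (F g) x : R[i]^o).
Proof.
apply: (@lip_continuous _ _ _ _ _ (fun u : H => inner u x : R[i]^o) (rnorm x)).
by move=> a b; rewrite -innerNl -innerD mulrC rnorm_inner.
Qed.

Let c_coeff x z : continuous (fun g => coeff x z g : R[i]^o).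
Proof. by apply: continuous_inner; exact: act_continuous_at. Qed.

Let select (s : seq nat) : exists c, c \notin s /\
  forall l, (l < size s)%N ->
    `|rmean (fun g => complex.Re (coeff (y l.*2) (y (nth 0%N s l).*2.+1) g *
       (coeff (y (size s).*2) (y c.*2.+1) g)^*))| <= (size s).+1%:R^-1.
Proof.
set k := size s.
pose f l g := coeff (y l.*2) (y (nth 0%N s l).*2.+1) g.
(* The candidate index [i] enters only through [W i], whereas [F l] is prescribed by the earlier
   choices. Bessel's inequality therefore makes each of the finitely many means tend to zero with
   [i]. *)
pose F l g := f l g *: w (y k.*2) g.
pose W i := w (y i.*2.+1).
have FW l i g : rdot (F l g) (W i g) =
    complex.Re (f l g * (coeff (y k.*2) (y i.*2.+1) g)^*).
  by rewrite /rdot innerZ innerC inner_w.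
have k0 : (0 : R) < k.+1%:R^-1 by rewrite invr_gt0 ltr0n.
have ev l : \forall i \near \oo, `|rmean (fun g => rdot (F l g) (W i g))| <= k.+1%:R^-1.
  apply: (mean_bessel_cvg x01) => //.
  - by move=> i; exact: cw.
  - by move=> g; apply: cvgZ; [exact: c_coeff|exact: cw].
  - by move=> i g; exact: w_le1.
  - move=> g; rewrite rnormZ -[leRHS]mulr1.
    by apply: ler_pM; rewrite ?rnorm_ge0 ?coeff_le1 ?w_le1.
  - move=> i j ij; apply: w_ortho; rewrite eqSS -(inj_eq double_inj) in ij *.
    by [].
have evs : \forall i \near \oo, i \notin s.
  exists (\max_(j <- s) j).+1 => // i /= mi; apply/negP => si.
  have : (i <= \max_(j <- s) j)%N by exact: (@leq_bigmax_seq _ s xpredT id i).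
  by rewrite leqNgt mi.
have ev' : \forall i \near \oo, forall l : 'I_k,
    `|rmean (fun g => rdot (F l g) (W i g))| <= k.+1%:R^-1.
  by apply: filter_forall => l; exact: ev.
have [c [cs cP]] := filter_ex (filterI evs ev').
exists c; split => // l lk; have := cP (Ordinal lk).
by under eq_fun do rewrite FW.
Qed.

Lemma infinitely_many_blocks : False.
Proof.
have [c cP] := dependent_sequence select.
have c_neq m n : (m < n)%N -> c m != c n.
  move=> mn; apply/eqP => cmn; have [/negP cn _] := cP n; apply: cn; rewrite -cmn.
  by apply/mapP; exists m => //; rewrite mem_iota.
have c_inj : injective c.
  by move=> m n cmn; case: (ltngtP m n) => // /c_neq; rewrite cmn eqxx.
pose x' k := y k.*2; pose y' k := y (c k).*2.+1.
have x'o : orthonormal_seq x'.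
  by split=> [n|m n mn]; [exact: y1|apply: y_ortho; rewrite (inj_eq double_inj)].
have y'o : orthonormal_seq y'.
  split=> [n|m n mn]; first exact: y1.
  by apply: y_ortho; rewrite eqSS (inj_eq double_inj) (inj_eq c_inj).
have [T TP] := partial_isometry x'o y'o.
pose f k g := inner (act g T (y' k)) (x' k).
(* The corner isolates the [k]-th term of [T]. Since the [q n] are fixed, it still does so after
   [act g], which identifies [f k] with a coefficient handled by [select]. *)
have qTq k : q k.*2 ** T ** q (c k).*2.+1 = rank1 (x' k) (y' k).
  apply: bop_eqP => z; apply: inner_sep => u; rewrite /rdot; congr complex.Re.
  have qa n v v' : inner (q n v) v' = inner v (q n v') by rewrite adjointP (qP n).2.
  rewrite !bop_compE qa (TP k) => [|l lk]; first by rewrite rank1E innerZ qa qy -qa qy.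
  rewrite -qa /x' -(qy l.*2) -bop_compE qq ?bop0E ?inner0l// (inj_eq double_inj) eq_sym//.
have fE k g : f k g = coeff (x' k) (y' k) g.
  rewrite /coeff -qTq !(act_comp hact) !q_fixed /f {1}/x' -(qy k.*2) {1}/y' -(qy (c k).*2.+1).
  by rewrite -!bop_compE adjointPr (qP _).2 -!bop_compE.
have cf k : continuous (fun g => f k g : R[i]^o).
  by apply: continuous_inner; exact: act_continuous_at.
have f1 k : f k 1%g = 1.
  rewrite fE /coeff (act1 hact) rank1E innerZ !innerxx !(proj1 x'o) !(proj1 y'o).
  by rewrite expr1n rmorph1 mulr1.
have f_le1 k g : rnorm (f k g : R[i]^o) <= 1.
  by rewrite fE; apply: coeff_le1; [exact: (proj1 x'o)|exact: (proj1 y'o)].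
have f_lip k g h : rnorm (f k g - f k h : R[i]^o) <= rnorm (act g T - act h T).
  rewrite -innerNl -innerD -bopBE (le_trans (rnorm_inner _ _))//.
  by rewrite (proj1 x'o) mulr1 (le_trans (rnorm_bop _ _))// (proj1 y'o) mulr1.
pose cross k l g := complex.Re (f k g * (f l g)^*).
have c_cross k l : continuous (cross k l).
  have -> : cross k l = (fun g => rdot (f k g *: x0) (f l g *: x0)).
    by apply/funext => g; rewrite /rdot innerZ innerZr innerxx x01 expr1n rmorph1 mulr1.
  by apply: continuous_rdot => g; apply: cvgZl; exact: cf.
have crossxx k g : cross k k g = rnorm (f k g : R[i]^o) ^+ 2 by rewrite /cross Re_mul_conj.
have small k l : (l < k)%N -> `|rmean (cross l k)| <= k.+1%:R^-1.
  move=> lk; have -> : cross l k = (fun g =>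
      complex.Re (coeff (x' l) (y' l) g * (coeff (x' k) (y' k) g)^*)).
    by apply/funext => g; rewrite /cross !fE.
  have [_ cPk] := cP k; rewrite size_mkseq in cPk.
  by have := cPk l lk; rewrite nth_mkseq.
(* By [f_lip] one list [K] serves all [k]: every [g] has an [h] in [K] such that [f k] is within 1/4
   of [f k 1 = 1] at the product of [g] with the inverse of [h]. There the square of its modulus is
   at least 9/16, hence above 1/2. *)
have [c0 c00 c0P] : exists2 c0 : R, 0 < c0 & forall k, c0 <= rmean (cross k k).
  have h4 : (0 : R) < 1 / 4 by lra.
  have [K K0 KP] := continuous_unif_net (act_continuous hact (T := T)) h4.
  have sK := size_gt0R R K0.
  exists ((1 / 2) / (size K)%:R) => [|k]; first by rewrite divr_gt0.
  rewrite ler_pdivrMr//; apply: (rmean_cover x01) => // [g|g]; first by rewrite crossxx sqr_ge0.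
  have [h hK hP] := KP g; exists h => //.
  have := hP 1%g h^-1%g; rewrite !mul1g mulgV => gh.
  rewrite crossxx; have := le_trans (f_lip k (g * h^-1)%g 1%g) gh; rewrite f1 => d.
  have f1' : 1 - 1 / 4 <= rnorm (f k (g * h^-1)%g : R[i]^o).
    have r1 : rnorm (1 : R[i]^o) = 1 by rewrite -(rmorph1 (real_complex R)) rnorm_rc normr1.
    have := rnormD (1 - f k (g * h^-1)%g : R[i]^o) (f k (g * h^-1)%g : R[i]^o).
    by rewrite subrK r1 rnorm_distC => h'; lra.
  by rewrite expr2; nra.
(* The final estimate needs [c0 / 2 + 3 * d <= c0], where [3 * d] comes from passing to a net point,
   from [f l] to [f k], and back. *)
pose d := c0 / 8; have d0 : 0 < d by rewrite /d; lra.
have [K K0 KP] := continuous_unif_net (act_continuous hact (T := T)) d0.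
have [U [UU FU]] := ultraFilterLemma (@eventually_filter).
(* Total boundedness: values on the finite net determine [f k] up to [d], and along the ultrafilter
   these values are nearly constant. *)
have [A UA AP] : exists2 A, U A & forall k l, A k -> A l ->
    forall h, h \in K -> rnorm (f k h - f l h : R[i]^o) <= d.
  elim: (K) => [|h L [A UA AP]]; first by exists setT => //; exact: filterT.
  have Ub : U [set k | rnorm (f k h : R[i]^o) <= 1] by apply: filterS filterT => k _; exact: f_le1.
  have [B UB BP] := ultra_small_oscillationC UU Ub d0.
  exists (A `&` B) => [|k l [Ak Bk] [Al Bl] h']; first exact: filterI.
  by rewrite inE => /orP[/eqP ->|]; [exact: BP|exact: AP].
have [l Al] := filter_ex UA.
(* The bound on [k] makes the almost orthogonality constant [k.+1%:R^-1] smaller than [c0 / 2]. *)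
have [k [Ak lk]] : exists k, A k /\ (maxn l (Num.bound (2 / c0)) < k)%N.
  have : U [set k | (maxn l (Num.bound (2 / c0)) < k)%N].
    by apply: FU; exact: nbhs_infty_gt.
  by move=> /(filterI UA)/filter_ex[k []]; exists k.
move: lk; rewrite gtn_max => /andP[lk ck].
have fkl g : rnorm (f l g - f k g : R[i]^o) <= 3 * d.
  have [h hK hP] := KP g.
  have := hP 1%g 1%g; rewrite !mul1g !mulg1 => gh.
  have h1 := le_trans (f_lip l g h) gh; have h2 := le_trans (f_lip k g h) gh.
  have h3 := AP l k Al Ak h hK.
  rewrite (le_trans (rnorm_distD (f l h : R[i]^o) _ _))//.
  rewrite (le_trans (lerD h1 (rnorm_distD (f k h : R[i]^o) _ _)))//.
  rewrite (rnorm_distC (f k h : R[i]^o)); lra.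
have cll : cross l l = (fun g => cross l k g + complex.Re (f l g * (f l g - f k g)^*)).
  apply/funext => g; rewrite /cross -raddfD -mulrDr -rmorphD/=.
  by rewrite addrC subrK.
have := c0P l; apply/negP; rewrite -ltNge.
have : rmean (cross l l) <= k.+1%:R^-1 + 3 * d.
  rewrite -[cross l l](_ : (fun g => cross l k g + (cross l l g - cross l k g)) = _); last first.
    by apply/funext => g; rewrite addrC subrK.
  have cd : continuous (fun g => cross l l g - cross l k g).
    by move=> g; apply: cvgB; exact: c_cross.
  rewrite (rmeanD x01)// lerD//; first exact: le_trans (ler_norm _) (small _ _ lk).
  apply: (rmean_le x01) => // g; rewrite {1}cll addrC addKr.
  rewrite (le_trans (ler_norm _))// (le_trans (Re_le_rnorm _))// rnormM.
  rewrite -[leRHS]mul1r; apply: ler_pM; rewrite ?rnorm_ge0 ?f_le1//.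
  by rewrite rnorm_conj.
move=> /le_lt_trans; apply.
have c2 : 0 <= 2 / c0 by rewrite divr_ge0 ?ltW.
have : 2 / c0 < k.+1%:R.
  rewrite (lt_le_trans (archi_boundP c2))// ler_nat.
  exact: leq_trans (ltnW ck) (leqnSn k).
rewrite ltr_pdivrMr// => kc.
have k2 : k.+1%:R^-1 < c0 / 2 by rewrite -[ltLHS]mul1r ltr_pdivrMr ?ltr0n//; lra.
apply: (@lt_le_trans _ _ (c0 / 2 + 3 * d)); first by rewrite ltrD2r.
by rewrite /d; lra.
Qed.

End infinitely_many_blocks.

(** A maximal free family of values spans all of them. The coefficients are linear in [v x], so they
    inherit continuity from [v]. *)
Lemma spanning_points (K : fieldType) (V : vectType K) (X : Type) (v : X -> V) :
  exists n (t : 'I_n -> X) (c : 'I_n -> {linear V -> K^o}),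
    forall x, v x = \sum_j c j (v x) *: v (t j).
Proof.
pose P n := `[< exists2 s : seq X, size s = n & free (map v s) >].
have P0 : exists n, P n by exists 0%N; apply/asboolP; exists [::] => //; exact: nil_free.
have Pb n : P n -> (n <= dim V)%N.
  move=> /asboolP[s <- /eqP fs]; rewrite -(size_map v) -fs.
  by rewrite -dimvf dimvS// subvf.
have [n /asboolP[s sn fs] nmax] := ex_maxnP P0 Pb.
pose b := map_tuple v (in_tuple s).
exists (size s), (tnth (in_tuple s)), (fun j => coord b j) => x.
have xs : v x \in <<b>>%VS.
  apply: contraT => xs.
  have /nmax : P n.+1.
    by apply/asboolP; exists (x :: s) => /=; [rewrite sn|rewrite free_cons xs fs].
  by rewrite ltnn.
rewrite {1}(coord_span xs); apply: eq_bigr => j _.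
by rewrite -tnth_nth tnth_map.
Qed.

Lemma linear_ffunE (K : fieldType) (I : finType) (c : {linear {ffun I -> K^o} -> K^o}) v :
  c v = \sum_k v k * c [ffun k' => (k' == k)%:R].
Proof.
have {1}-> : v = \sum_k v k *: [ffun k' => (k' == k)%:R : K^o].
  apply/ffunP => k; rewrite sum_ffunE (bigD1 k)//= [X in _ + X]big1 => [|k' kk'].
    by rewrite addr0 ffunE ffunE eqxx -[_ *: _]/(_ * _) mulr1.
  by rewrite ffunE ffunE eq_sym (negPf kk') scaler0.
by rewrite linear_sum; apply: eq_bigr => k _; rewrite linearZ.
Qed.

(** * From finitely many blocks to finitely many functions *)

Section finitely_many_blocks.
Variables (R : realType) (G : compactGroupType) (H : hilbertType R).
Variable act : G -> bop H H -> bop H H.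
Hypothesis hact : continuous_star_action act.
Implicit Types (x z : H) (S T p q : bop H H) (g h : G).

Lemma complete_list : exists ps : seq (bop H H), (forall p, p \in ps -> minimal_proj act p) /\
  forall q, minimal_proj act q -> exists2 p, p \in ps & ~ disjoint_proj act p q.
Proof.
apply: contrapT => /forallNP nops.
(* The implication makes the choice total; on lists containing a non-minimal operator the value 0 is
   arbitrary. *)
have next (s : seq (bop H H)) : exists q, (forall p, p \in s -> minimal_proj act p) ->
    minimal_proj act q /\ forall p, p \in s -> disjoint_proj act p q.
  have [sm|] := pselect (forall p, p \in s -> minimal_proj act p); last by exists 0.
  apply: contrapT => /forallNP noq; apply: (nops s); split=> // q qm.
  apply: contrapT => /forallPNP sq; apply: (noq q) => _; split=> // p ps.
  by apply: contrapT => /(sq _ ps).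
have [q qP] := dependent_sequence next.
have qm n : forall p, p \in mkseq q n -> minimal_proj act p.
  elim: n => // n IH p; rewrite mkseqS mem_rcons inE => /orP[/eqP ->|/IH//].
  by have [] := qP n IH.
have qmin n : minimal_proj act (q n) by have [] := qP n (qm n).
have qd m n : (m < n)%N -> disjoint_proj act (q m) (q n).
  move=> mn; have [_] := qP n (qm n); apply; apply/mapP; exists m => //.
  by rewrite mem_iota.
have q1 n : is_proj (q n) by have [] := qmin n.
have q0 n : q n != 0 by have [] := qmin n.
have qf n : fixed act (q n) by have [] := qmin n.
apply: (infinitely_many_blocks hact q1 q0 qf) => m n.
by rewrite neq_ltn => /orP[/qd//|/qd]; exact: disjoint_proj_sym.
Qed.

(* Every corner q A q' with q, q' minimal is carried into some p A p' with
   p, p' in ps by fixed elements, and b commutes with these. *)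
Lemma bimodule_map_eq0 (ps : seq (bop H H)) (Z : seq H) (b : bop H H -> bop H H) :
  (forall p, p \in ps -> minimal_proj act p) ->
  (forall q, minimal_proj act q -> exists2 p, p \in ps & ~ disjoint_proj act p q) ->
  (forall p, p \in ps -> exists2 s : seq (H * H), p = \sum_(u <- s) rank1 u.1 u.2 &
    forall u, u \in s -> u.1 \in Z /\ u.2 \in Z) ->
  (forall S T, b (S + T) = b S + b T) -> (forall a T, b (a *: T) = a *: b T) ->
  (forall u T, fixed act u -> b (u ** T) = u ** b T) ->
  (forall u T, fixed act u -> b (T ** u) = b T ** u) ->
  (forall x y z w, x \in Z -> y \in Z -> z \in Z -> w \in Z ->
    inner (b (rank1 x y) z) w = 0) ->
  forall T, b T = 0.
Proof.
move=> psm psc psZ bD bZ bl br bZ0 T.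
have b0 : b 0 = 0 by have := bZ 0 0; rewrite !scale0r.
have b_sum (I : Type) (s : seq I) (F : I -> bop H H) :
    b (\sum_(i <- s) F i) = \sum_(i <- s) b (F i).
  exact: (big_morph b bD b0).
have expand p p' S s s' : p = \sum_(u <- s) rank1 u.1 u.2 ->
    p' = \sum_(u <- s') rank1 u.1 u.2 ->
    p ** S ** p' = \sum_(u <- s) \sum_(u' <- s') inner (S u'.1) u.2 *: rank1 u.1 u'.2.
  move=> -> ->; rewrite bop_comp_suml bop_comp_suml; apply: eq_bigr => u _.
  rewrite bop_comp_sumr; apply: eq_bigr => u' _.
  by rewrite rank1_comp rank1_rank1 -adjointP.
have bp p p' S : p \in ps -> p' \in ps -> b (p ** S ** p') = 0.
  move=> pps pps'; have [s pE sZ] := psZ _ pps; have [s' pE' sZ'] := psZ _ pps'.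
  have [pP _ fp _ _] := psm _ pps; have [pP' _ fp' _ _] := psm _ pps'.
  (* [b] preserves the corner, so its value expands in the same rank-one operators, with
     coefficients that [bZ0] makes vanish. *)
  have -> : b (p ** S ** p') = p ** b (p ** S ** p') ** p'.
    by rewrite -bl// -br// !bop_compA pP.1 -(bop_compA _ p' p') pP'.1.
  rewrite (expand _ _ _ _ _ pE pE') big1_seq// => u /andP[_ us].
  rewrite big1_seq// => u' /andP[_ us'].
  rewrite (expand _ _ S _ _ pE pE') b_sum bop_sumE inner_suml big1_seq ?scale0r// => v /andP[_ vs].
  rewrite b_sum bop_sumE inner_suml big1_seq// => v' /andP[_ vs'].
  have [[? ?] [? ?]] := (sZ _ us, sZ' _ us'); have [[? ?] [? ?]] := (sZ _ vs, sZ' _ vs').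
  by rewrite bZ bopZE innerZ bZ0// mulr0.
have bq q q' S : minimal_proj act q -> minimal_proj act q' -> q ** b S ** q' = 0.
  move=> qm qm'; have [p pps /existsNP[w /not_implyP[fw /eqP v0]]] := psc _ qm.
  have [p' pps' /existsNP[w' /not_implyP[fw' /eqP v0']]] := psc _ qm'.
  have [pP _ fp _ _] := psm _ pps; have [pP' _ fp' _ _] := psm _ pps'.
  have [l l0 vE] := minimal_intertwiner hact fp qm fw v0.
  have [l' l0' vE'] := minimal_intertwiner hact fp' qm' fw' v0'.
  have [qP _ fq _ _] := qm; have [qP' _ fq' _ _] := qm'.
  set v := p ** w ** q in vE; set v' := p' ** w' ** q' in vE'.
  have fv : fixed act v by exact: (fixed_comp hact (fixed_comp hact fp fw) fq).
  have fv' : fixed act v' by exact: (fixed_comp hact (fixed_comp hact fp' fw') fq').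
  have pv : p ** v = v by rewrite /v !bop_compA pP.1.
  have vp : adjoint v' ** p' = adjoint v'.
    by rewrite -[p'](pP'.2) -adjoint_comp /v' !bop_compA pP'.1.
  clearbody v v'.
  have rl : rc l * rc l' != 0 by rewrite mulf_neq0 ?fmorph_eq0.
  apply: (scalerI rl); rewrite scaler0 -scalerA -bop_compZr -vE' -bop_compZl -bop_compZl -vE.
  (* Up to non-zero scalars [q] and [q'] are [adjoint v ** v] and [adjoint v' ** v']. Moving the
     inner factors through [b] places its argument in the corner of [p] and [p']. *)
  have -> : adjoint v ** v ** b S ** (adjoint v' ** v') =
      adjoint v ** b (p ** (v ** S ** adjoint v') ** p') ** v'.
    rewrite !bop_compA pv -(bop_compA _ (adjoint v') p') vp.
    by rewrite (br (adjoint v'))// ?bl//; [rewrite !bop_compA|exact: fixed_adjoint].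
  by rewrite bp// bop_comp0r bop_comp0l.
have bT q' : minimal_proj act q' -> b T ** q' = 0.
  move=> qm'; apply: bop_eqP => x; rewrite bop_compE bop0E.
  apply: (minimal_total hact) => q qm.
  by have := congr1 (fun S : bop H H => S x) (bq q q' T qm qm').
rewrite -[b T]adjointK; suff -> : adjoint (b T) = 0 by rewrite adjoint0.
apply: bop_eqP => x; rewrite bop0E; apply: (minimal_total hact) => q qm.
have [[_ qa] _ _ _ _] := qm.
have := congr1 (@adjoint _ _) (bT q qm); rewrite adjoint_comp qa adjoint0.
by move=> /(congr1 (fun S : bop H H => S x)).
Qed.

(** The coefficients of [act g] at vectors of [Z] form a vector [v g] of a finite-dimensional space,
    so [v g] is a combination of finitely many [v (t j)]. The difference between [act g] and the
    same combination of the [act (t j)] commutes with multiplication by fixed operators and has zero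
    coefficients at [Z]; [bimodule_map_eq0] applies. *)
Lemma finite_dimensional_action : exists n (t : 'I_n -> G) (f : 'I_n -> cfun R G),
  forall g T, act g T = \sum_j f j g *: act (t j) T.
Proof.
have [ps [psm psc]] := complete_list.
have [Z psZ] : exists Z : seq H, forall p, p \in ps ->
    exists2 s : seq (H * H), p = \sum_(u <- s) rank1 u.1 u.2 &
    forall u, u \in s -> u.1 \in Z /\ u.2 \in Z.
  elim: ps psm {psc} => [|p ps IH] psm; first by exists [::].
  have [p' p'ps|Z ZP] := IH _; first by apply: psm; rewrite inE p'ps orbT.
  have [_ _ _ [n [s _ pE]] _] := psm p (mem_head _ _).
  exists (map fst s ++ map snd s ++ Z) => p'; rewrite inE => /orP[/eqP ->|/ZP[s' p'E s'Z]].
    by exists s => // u us; rewrite !mem_cat !map_f ?orbT.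
  by exists s' => // u /s'Z[uZ uZ']; rewrite !mem_cat uZ uZ' !orbT.
pose N := size Z; pose z (i : 'I_N) := nth 0 Z i.
pose K := ('I_N * 'I_N * 'I_N * 'I_N)%type.
pose co (k : K) g : R[i]^o := inner (act g (rank1 (z k.1.1.1) (z k.1.1.2)) (z k.1.2)) (z k.2).
have cco k : continuous (co k).
  apply: (@lip_continuous _ _ _ _ _ (fun u : H => inner u (z k.2) : R[i]^o) (rnorm (z k.2))).
    by move=> a b; rewrite -innerNl -innerD mulrC rnorm_inner.
  exact: act_continuous_at.
pose v g : {ffun K -> R[i]^o} := [ffun k => co k g].
have [n [t [c vE]]] := spanning_points v.
have cc j : (fun g => c j (v g) : R[i]^o) \in @cfun_pred R G.
  apply/asboolP.
  have -> : (fun g => c j (v g) : R[i]^o) =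
      (fun g => \sum_k co k g * c j [ffun k' => (k' == k)%:R]).
    apply/funext => g; rewrite linear_ffunE.
    by apply: eq_bigr => k _; rewrite [v g k]ffunE.
  apply: continuous_sum => k g; apply: cvgMl; exact: cco.
exists n, t, (fun j => CFun (cc j)) => g T.
apply/eqP; rewrite -subr_eq0; apply/eqP.
apply: (@bimodule_map_eq0 ps Z
  (fun T => act g T - \sum_j CFun (cc j) g *: act (t j) T)) => //.
- move=> S U; rewrite (actD hact) [RHS]addrACA -opprD -big_split/=.
  by congr (_ - _); apply: eq_bigr => j _; rewrite (actD hact) scalerDr.
- move=> a U; rewrite (actZ hact) scalerBr scaler_sumr; congr (_ - _).
  by apply: eq_bigr => j _; rewrite (actZ hact) !scalerA mulrC.
- move=> u U fu; rewrite (act_comp hact) fu bop_compDr bop_compNr bop_comp_sumr.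
  by congr (_ - _); apply: eq_bigr => j _; rewrite (act_comp hact) fu bop_compZr.
- move=> u U fu; rewrite (act_comp hact) fu bop_compDl bop_compNl bop_comp_suml.
  by congr (_ - _); apply: eq_bigr => j _; rewrite (act_comp hact) fu bop_compZl.
- move=> x1 x2 x3 x4 /(nthP 0)[i1 i1N <-] /(nthP 0)[i2 i2N <-].
  move=> /(nthP 0)[i3 i3N <-] /(nthP 0)[i4 i4N <-].
  have := congr1 (fun u : {ffun K -> R[i]^o} =>
    u (Ordinal i1N, Ordinal i2N, Ordinal i3N, Ordinal i4N)) (vE g).
  rewrite sum_ffunE !ffunE /co/= => E.
  rewrite (_ : inner _ _ = co (Ordinal i1N, Ordinal i2N, Ordinal i3N, Ordinal i4N) g -
      inner ((\sum_j c j (v g) *: act (t j) (rank1 Z`_i1 Z`_i2)) Z`_i3) Z`_i4); last first.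
    by rewrite -innerNl -innerD.
  rewrite /co/= E bop_sumE inner_suml -sumrB big1// => j _.
  by rewrite !ffunE bopZE innerZ subrr.
Qed.

End finitely_many_blocks.

(** * Uniform continuity *)

Lemma weak_star_eval (R : realType) (F : normedModType R[i]) (u : F) :
  continuous (fun mu : weak_star F => (mu : dual F) u : R[i]^o).
Proof.
move=> mu; apply: (@continuous_comp _ _ _
  (fun mu : weak_star F => ((mu : dual F) : F -> R[i]^o) : {ptws F -> R[i]^o})
  (fun f : {ptws F -> R[i]^o} => f u)).
  exact: initial_continuous.
exact: proj_continuous.
Qed.

(** The orbit map of [a] is the tensor [sum_j f_j (x) act (t_j) a]. Between two functionals it
    varies by finitely many numbers that do not depend on [a], the differences at the [f j], times
    factors bounded on [B]. *)
Lemma finite_dimensional_uniformly_continuous (R : realType) (G : compactGroupType)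
    (A : normedModType R[i]) (act : G -> A -> A)
    (n : nat) (t : 'I_n -> G) (f : 'I_n -> cfun R G) :
  (forall g a, rnorm (act g a) <= rnorm a) ->
  (forall g a, act g a = \sum_j f j g *: act (t j) a) ->
  uniformly_continuous_action act.
Proof.
move=> act_le actE.
exists (fun a => \sum_j elem_tensor (f j) (act (t j) a)) => [a|B bB].
  split=> [|g]; first by apply: subset_closure; exists n, f, (fun j => act (t j) a).
  by rewrite bop_sumE [RHS]actE.
have [M M0 BM] : exists2 M : R, 0 < M & forall a, B a -> rnorm a <= M.
  have [r r0 rP] := pinfty_ex_gt0 bB.
  have /complex_realP[M rM] : r \is Num.real by rewrite ger0_real// ltW.
  exists M => [|a Ba]; first by rewrite -ltcR -rM.
  by rewrite rnorm_le -rM; exact: rP.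
move=> mu Ent; rewrite -entourage_ballE => -[e /= e0 eE].
have /complex_realP[r re] : e \is Num.real by rewrite ger0_real// ltW.
have r0 : 0 < r by rewrite -ltcR -re.
(* With [n.+1] the denominator is non-zero even if [n = 0], and [n%:R * d * M] stays strictly below
   [r]. *)
pose d := r / (M * n.+1%:R).
have d0 : 0 < d by rewrite divr_gt0// mulr_gt0// ltr0n.
have : \forall nu \near (mu : weak_star (cfun R G)), forall j : 'I_n,
    rnorm ((mu : dual _) (f j) - (nu : dual _) (f j) : R[i]^o) < d.
  apply: (@filter_forall _ _ _ _ (@nbhs_filter _ (mu : weak_star (cfun R G)))) => j.
  by have /cvg_rnormP/(_ _ d0) := @weak_star_eval _ _ (f j) mu.
apply: filterS => nu nuP _ [a Ba <-]; apply: eE => /=.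
rewrite -ball_normE /= -rnormE re ltcR !bop_sumE -sumrB.
apply: (@le_lt_trans _ _ (\sum_(j < n) d * M)).
  rewrite (le_trans (rnorm_sum _ _))//; apply: ler_sum => j _.
  rewrite /= -scalerBl rnormZ; apply: ler_pM; rewrite ?rnorm_ge0 ?(ltW (nuP j))//.
  exact: le_trans (act_le _ _) (BM _ Ba).
rewrite sumr_const card_ord -mulr_natr /d.
rewrite (_ : _ * _ * _ = r * (n%:R / n.+1%:R)); last first.
  by field; rewrite nat1r pnatr_eq0/= gt_eqF.
by rewrite gtr_pMr// ltr_pdivrMr ?ltr0n// mul1r ltr_nat.
Qed.

(** * Finite spectrum *)

Section irreducible_representations.
Variables (R : realType) (G : compactGroupType).
Implicit Types (rho sigma : irrep R G) (g h : G).

(** Schur's lemma; [v] witnesses that [phi] is non-zero. *)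
Lemma irrep_bij rho sigma (phi : 'Hom(irrep_space rho, irrep_space sigma)) v :
  (forall g x, phi (rho g x) = sigma g (phi x)) -> phi v != 0 -> bijective phi.
Proof.
move=> phiG phiv.
have k0 : lker phi = 0%VS.
  case: (irrep_irreducible (i := rho) (U := lker phi)) => // [g|kf].
    apply/subvP => _ /memv_imgP[x xk ->]; rewrite memv_ker phiG.
    by move: xk; rewrite memv_ker => /eqP->; rewrite linear0.
  by move: phiv; have := memvf v; rewrite -kf memv_ker => ->.
have lf : limg phi = fullv.
  case: (irrep_irreducible (i := sigma) (U := limg phi)) => // [g|l0].
    apply/subvP => _ /memv_imgP[_ /memv_imgP[x _ ->] ->].
    by rewrite -phiG memv_img ?memvf.
  by move: phiv; have := memv_img phi (memvf v); rewrite l0 memv0 => ->.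
exists (phi^-1)%VF => x; first by rewrite lker0_lfunK//; apply/eqP.
by rewrite limg_lfunVK// lf memvf.
Qed.

Lemma irrep_equiv_sym rho sigma : irrep_equiv rho sigma -> irrep_equiv sigma rho.
Proof.
move=> [phi bphi phiG]; have [psi0 psiK phiK] := bphi.
have inj := bij_inj bphi.
have k0 : lker phi == 0%VS by apply/lker0P.
have lV y : phi ((phi^-1)%VF y) = y by rewrite -[in LHS](phiK y) lker0_lfunK// phiK.
exists (phi^-1)%VF; first by exists phi => // x; exact: lker0_lfunK.
by move=> g v; apply: inj; rewrite phiG !lV.
Qed.

(** The span of the orbit of [v] is invariant and non-zero, hence everything; [spanning_points]
    selects finitely many orbit points. *)
Lemma orbit_frame rho v : v != 0 -> exists n (t : 'I_n -> G), forall x,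
  x = \sum_j coord [tuple rho (t j) v | j < n] j x *: rho (t j) v.
Proof.
move=> v0; have [n [t [c cP]]] := spanning_points (fun g => rho g v).
exists n, t => x; pose b := [tuple rho (t j) v | j < n].
have orb g : rho g v \in <<b>>%VS.
  rewrite cP; apply: memv_suml => j _; apply/memvZ/memv_span.
  by apply/mapP; exists j; rewrite ?mem_enum.
suff bf : <<b>>%VS = fullv.
  rewrite {1}(@coord_span _ _ _ b x) ?bf ?memvf//; apply: eq_bigr => j _.
  by rewrite -tnth_nth tnth_mktuple.
case: (irrep_irreducible (i := rho) (U := <<b>>%VS)) => // [g|b0].
  rewrite limg_span; apply/span_subvP => _ /mapP[_ /mapP[j _ ->] ->].
  by have := orb (g * t j)%g; rewrite irrepM lfunE.
by have := orb 1%g; rewrite b0 memv0 irrep1 lfunE/= (negPf v0).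
Qed.

(* b stands for the element \sum_(u <- b) u.1 u.2 of the group algebra *)
Definition galg rho (b : seq (R[i] * G)) (v : irrep_space rho) : irrep_space rho :=
  \sum_(u <- b) u.1 *: rho u.2 v.

Lemma galg0 rho b : galg b (0 : irrep_space rho) = 0.
Proof. by rewrite /galg big1// => u _; rewrite linear0 scaler0. Qed.

Lemma galg_mul rho b b' (v : irrep_space rho) :
  galg [seq (u.1 * u'.1, (u.2 * u'.2)%g) | u <- b, u' <- b'] v = galg b (galg b' v).
Proof.
rewrite /galg big_allpairs_dep/=; apply: eq_bigr => u _.
rewrite linear_sum scaler_sumr; apply: eq_bigr => u' _.
by rewrite irrepM lfunE/= linearZ scalerA.
Qed.

(* Otherwise rho(x) v |-> sigma(x) w would be a well-defined intertwiner. *)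
Lemma irrep_separate rho sigma (v : irrep_space rho) (w : irrep_space sigma) :
  v != 0 -> w != 0 -> ~ irrep_equiv rho sigma ->
  exists b, galg b v = 0 /\ galg b w != 0.
Proof.
move=> v0 w0 nequiv; apply: contrapT => /forallNP sep; apply: nequiv.
have [n [t tP0]] := orbit_frame v0.
pose c j := coord [tuple rho (t j) v | j < n] j.
have tP x : x = \sum_j c j x *: rho (t j) v := tP0 x.
pose phi0 x : irrep_space sigma := \sum_j c j x *: sigma (t j) w.
have phi_lin : linear phi0.
  move=> a x y; rewrite /phi0 scaler_sumr -big_split/=; apply: eq_bigr => j _.
  by rewrite /c linearP scalerDl scalerA.
pose phiL := GRing.isLinear.Build _ _ _ _ phi0 phi_lin.
pose phi1 : {linear irrep_space rho -> irrep_space sigma} := HB.pack phi0 phiL.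
pose phi := linfun phi1.
have phiE g : phi (rho g v) = sigma g w.
  rewrite lfunE/=; apply/eqP; rewrite eq_sym -subr_eq0.
  (* [b] is [g] minus the combination of the [t j] that expresses [rho g v]. It kills [v], hence
     also [w]. *)
  pose b := (1, g) :: [seq (- c j (rho g v), t j) | j <- enum 'I_n].
  have bE tau (u : irrep_space tau) :
      galg b u = tau g u - \sum_j c j (rho g v) *: tau (t j) u.
    rewrite /galg big_cons scale1r big_map big_enum/= -sumrN; congr (_ + _).
    by apply: eq_bigr => j _; rewrite scaleNr.
  apply: contrapT => bw; apply: (sep b); rewrite !bE -(tP (rho g v)) subrr.
  by split=> //; apply/negP.
have phiG g x : phi (rho g x) = sigma g (phi x).
  rewrite (tP x) !linear_sum; apply: eq_bigr => j _; rewrite !linearZ/=; congr (_ *: _).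
  have -> : rho g (rho (t j) v) = rho (g * t j)%g v by rewrite irrepM lfunE.
  by rewrite !phiE irrepM lfunE.
exists phi => //; apply: (irrep_bij phiG (v := v)).
by have := phiE 1%g; rewrite !irrep1 !lfunE/= => ->.
Qed.

(** A group algebra element that kills every other [v j] but not [v i] reduces the relation to the
    class [i]; the orbit of the surviving vector spans its space. *)
Lemma irrep_coefficients_independent (I : finType) (s : I -> irrep R G)
    (v : forall i, irrep_space (s i)) (l : forall i, {linear irrep_space (s i) -> R[i]^o}) :
  (forall i j, i != j -> ~ irrep_equiv (s i) (s j)) ->
  (forall g, \sum_i l i (s i g (v i)) = 0) ->
  forall i, v i != 0 -> l i (v i) = 0.
Proof.
move=> neq rel i vi.
have kill (A : seq I) : exists b, galg b (v i) != 0 /\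
    forall j, j \in A -> j != i -> galg b (v j) = 0.
  elim: A => [|j A [b [bi bA]]].
    by exists [:: (1, 1%g)]; rewrite /galg big_seq1 irrep1 lfunE/= scale1r.
  have [ji|ji] := eqVneq j i.
    by exists b; split=> // k; rewrite inE ji => /orP[/eqP ->|/bA//]; rewrite eqxx.
  have [bj|bj] := eqVneq (galg b (v j)) 0.
    by exists b; split=> // k; rewrite inE => /orP[/eqP ->|/bA].
  (* Separation is applied to the images under [b], so the product of [b'] and [b] kills [v j] and
     keeps all earlier annihilations. *)
  have [b' [b'j b'i]] := irrep_separate bj bi (neq _ _ ji).
  exists [seq (u.1 * u'.1, (u.2 * u'.2)%g) | u <- b', u' <- b]; rewrite galg_mul.
  split=> // k; rewrite galg_mul inE => /orP[/eqP ->//|kA ki].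
  by rewrite bA// galg0.
have [b [bi bI]] := kill (enum I).
have li g : l i (s i g (galg b (v i))) = 0.
  have : \sum_j l j (s j g (galg b (v j))) = 0.
    rewrite (eq_bigr (fun j => \sum_(u <- b) u.1 * l j (s j (g * u.2)%g (v j)))).
      by rewrite exchange_big big1// => u _; rewrite -mulr_sumr rel mulr0.
    move=> j _; rewrite /galg !linear_sum; apply: eq_bigr => u _.
    by rewrite !linearZ irrepM lfunE.
  rewrite (bigD1 i)//= big1 ?addr0// => j ji.
  by rewrite bI ?mem_enum// !linear0.
have [n [t tP]] := orbit_frame bi.
rewrite (tP (v i)) linear_sum big1// => j _.
by rewrite linearZ/= li scaler0.
Qed.

End irreducible_representations.

Section finite_spectrum.
Variables (R : realType) (G : compactGroupType).

(** The [m] coefficients lie in the span of [d] functions. For [m > d] the matrix of the [c i j] has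
    a non-zero left kernel vector, a relation that independence forbids. *)
Lemma irrep_spectrum_le (d m : nat) (f : 'I_d -> G -> R[i]) (s : 'I_m -> irrep R G)
    (v : forall i, irrep_space (s i)) (l : forall i, {linear irrep_space (s i) -> R[i]^o})
    (c : 'I_m -> 'I_d -> R[i]) :
  (forall i j, i != j -> ~ irrep_equiv (s i) (s j)) ->
  (forall i, l i (v i) != 0) ->
  (forall i g, l i (s i g (v i)) = \sum_j f j g * c i j) -> (m <= d)%N.
Proof.
move=> neq lv lE; rewrite leqNgt; apply/negP => dm.
pose M := \matrix_(i < m, j < d) c i j.
have : kermx M != 0.
  rewrite -mxrank_eq0 mxrank_ker -lt0n subn_gt0.
  exact: leq_ltn_trans (rank_leq_col M) dm.
move=> /rowV0Pn[a /sub_kermxP aM a0].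
pose l' i : irrep_space (s i) -> R[i]^o := fun x => a 0 i *: l i x.
have l'_lin i : linear (l' i).
  by move=> e x y; rewrite /l' linearP scalerDr !scalerA mulrC.
pose l1 i : {linear irrep_space (s i) -> R[i]^o} :=
  HB.pack (l' i) (GRing.isLinear.Build _ _ _ _ (l' i) (l'_lin i)).
have rel g : \sum_i l1 i (s i g (v i)) = 0.
  rewrite (eq_bigr (fun i => \sum_j a 0 i * (f j g * c i j))); last first.
    by move=> i _; rewrite /= /l' lE scaler_sumr.
  rewrite exchange_big/= big1// => j _.
  rewrite (eq_bigr (fun i => f j g * (a 0 i * c i j))); last by move=> i _; rewrite mulrCA.
  have aj : \sum_i a 0 i * c i j = 0.
    have := congr1 (fun N : 'rV_d => N 0 j) aM; rewrite !mxE => E.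
    by apply: etrans E; apply: eq_bigr => i _; rewrite mxE.
  by rewrite -mulr_sumr aj mulr0.
case/eqP: a0; apply/rowP => i; rewrite mxE.
have vi : v i != 0 by apply: contra (lv i) => /eqP->; rewrite linear0.
have /eqP := irrep_coefficients_independent neq rel vi.
by rewrite /= /l' scaler_eq0 (negPf (lv i)) orbF => /eqP.
Qed.

Variables (H : hilbertType R) (act : G -> bop H H -> bop H H).
Variables (n : nat) (t : 'I_n -> G) (f : 'I_n -> cfun R G).
Hypothesis actE : forall g T, act g T = \sum_j f j g *: act (t j) T.

Let occurs rho := exists2 a, isotypic act rho a & a != 0.

Lemma occurs_coefficient rho : occurs rho ->
  exists (v : irrep_space rho) (l : {linear irrep_space rho -> R[i]^o}) (c : 'I_n -> R[i]),
    l v != 0 /\ forall g, l (rho g v) = \sum_j f j g * c j.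
Proof.
move=> [a [m [k [w [wW aE]]]] a0].
have [i _] : exists i : 'I_m, True.
  case: m k w wW aE => [|m] k w wW aE; last by exists ord0.
  by move: a0; rewrite aE big_ord0 eqxx.
have [W [phi [phi_inj phiG _]] _] := wW i.
have [v v0] : exists v : irrep_space rho, v != 0.
  by exists (vpick fullv); rewrite vpick0; exact: irrep_neq0.
have [x px] : exists x, phi v x != 0.
  apply: contrapT => /forallNP px; case/eqP: v0; apply: phi_inj; rewrite linear0.
  by apply: bop_eqP => x; apply/eqP/negPn/negP/px.
(* Pairing with [phi v x] itself makes [l0 v] a squared norm, hence non-zero. *)
pose l0 (u : irrep_space rho) : R[i]^o := inner (phi u x) (phi v x).
have l0_lin : linear l0.
  by move=> e u u'; rewrite /l0 linearP bopDE bopZE innerD innerZ.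
pose l : {linear irrep_space rho -> R[i]^o} :=
  HB.pack l0 (GRing.isLinear.Build _ _ _ _ l0 l0_lin).
exists v, l, (fun j => inner (act (t j) (phi v) x) (phi v x)); split=> [|g].
  by rewrite /= /l0 innerxx fmorph_eq0 expf_eq0/= rnorm_eq0.
rewrite /= /l0 phiG actE bop_sumE inner_suml; apply: eq_bigr => j _.
by rewrite bopZE innerZ.
Qed.

Lemma finite_dimensional_finite_spectrum : finite_spectrum act.
Proof.
pose P m := `[< exists s : 'I_m -> irrep R G, (forall i, occurs (s i)) /\
  forall i j, i != j -> ~ irrep_equiv (s i) (s j) >].
have P0 : exists m, P m.
  exists 0%N; apply/asboolP.
  have s0 : 'I_0 -> irrep R G by case.
  by exists s0; split=> -[].
have Pn m : P m -> (m <= n)%N.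
  move=> /asboolP[s [occ neq]].
  have co i := occurs_coefficient (occ i).
  pose v i := projT1 (cid (co i)).
  have co' i := projT2 (cid (co i)).
  pose l i := projT1 (cid (co' i)).
  have co2 i := projT2 (cid (co' i)).
  pose c i := projT1 (cid (co2 i)).
  have cP i := projT2 (cid (co2 i)).
  apply: (@irrep_spectrum_le n m (fun j => f j) s v l c neq) => i.
    by have [] := cP i.
  by have [] := cP i.
have [m /asboolP[s [occ neq]] mmax] := ex_maxnP P0 Pn.
exists m, s => rho rho_occ; apply: contrapT => /forallNP rs.
have /mmax : P m.+1; last by rewrite ltnn.
apply/asboolP; exists (fun i => if unlift ord0 i is Some j then s j else rho); split=> [i|i j].
  by case: unliftP => [j _|_]; [exact: occ|exact: rho_occ].
case: unliftP => [i' ->|->]; case: unliftP => [j' ->|->] //.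
- by rewrite (inj_eq (@lift_inj _ _)); exact: neq.
- by move=> _ /irrep_equiv_sym/rs.
Qed.

End finite_spectrum.

Theorem corollary2p15 (R : realType) (G : compactGroupType) (H : hilbertType R)
    (act : G -> bop H H -> bop H H) :
  continuous_star_action act ->
  uniformly_continuous_action act /\ finite_spectrum act.
Proof.
move=> hact; have [n [t [f actE]]] := finite_dimensional_action hact.
split; last exact: finite_dimensional_finite_spectrum actE.
apply: finite_dimensional_uniformly_continuous actE => g T.
by rewrite (rnorm_act hact).
Qed.
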